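(* Let $H$ be a complex, separable, infinite-dimensional Hilbert space, $T\in B(H)$ and $f_0\in H$. Suppose $\{T^nf_0\}_{n\ge0}$ is a Riesz basis for $H$, so that $T=LSL^{-1}$ for some $L\in GL(H^2(\mathbb{T}),H)$. Then $$\mathcal{G}_T=\{Vf_0: V=LM_\varphi L^{-1},\ \text{where } \varphi \text{ is the radial limit of a function in } H^\infty(\mathbb{D}) \text{ which is bounded away from } 0\}.$$
   Context: $\mathcal{G}_T=\{h\in H:\{T^nh\}_{n\ge0}\text{ is a frame for }H\}$, where $\{f_n\}_{n\ge0}$ is a frame for $H$ if there are constants $0<C_1\le C_2$ with $C_1\|f\|^2\le\sum_{n\ge0}|\langle f,f_n\rangle|^2\le C_2\|f\|^2$ for all $f\in H$. $B(H)$ denotes the bounded linear operators on $H$; $GL(K,H)$ denotes the bounded invertible linear operators from $K$ onto $H$. $\mathbb{D}$ is the open unit disk and $\mathbb{T}$ the unit circle. $H^2(\mathbb{T})$ is the closed subspace of $L^2(\mathbb{T})$ of functions with vanishing negative Fourier coefficients, and $S$ is the unilateral shift on it, $(Sf)(z)=zf(z)$. $H^\infty(\mathbb{D})$ is the space of bounded analytic functions on $\mathbb{D}$; a function in it is bounded away from $0$ if its modulus is $\ge\delta$ on all of $\mathbb{D}$ for some $\delta>0$. Its radial limit is the a.e. defined boundary function on $\mathbb{T}$, which lies in $H^\infty(\mathbb{T})=H^2(\mathbb{T})\cap L^\infty(\mathbb{T})$. For $\varphi\in L^\infty(\mathbb{T})$, $M_\varphi$ is the Toeplitz operator on $H^2(\mathbb{T})$,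 $M_\varphi f=P_{H^2(\mathbb{T})}(\varphi f)$ (with $P_{H^2(\mathbb{T})}$ the orthogonal projection of $L^2(\mathbb{T})$ onto $H^2(\mathbb{T})$). *)

(* Defs.v *)
From HB Require Import structures.
From mathcomp Require Export all_boot all_order all_algebra.
From mathcomp Require Export sesquilinear ring_quotient complex.
From mathcomp Require Export all_classical all_reals all_analysis.
From mathcomp Require Import ess_sup_inf measurable_realfun.
Set Implicit Arguments.
Unset Strict Implicit.
Unset Printing Implicit Defensive.
Import Order.TTheory GRing.Theory Num.Theory Num.Def.
Import numFieldNormedType.Exports.
Local Open Scope classical_set_scope.
Local Open Scope ring_scope.
Local Open Scope quotient_scope.

Section InnerProduct.
Variables (R : realType) (V : lmodType R[i]) (ip : {dot V for conjC}).

Lemma dot_CauchySchwarz (u v : V) : `|ip u v| ^+ 2 <= ip u u * ip v v.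
Proof.
have [->|v0] := eqVneq v 0; first by rewrite !linear0r normr0 expr0n.
have vv : 0 < ip v v by rewrite neq0_dnorm_gt0.
have vvR : (ip v v)^* = ip v v by apply/CrealP; rewrite ger0_real ?ltW.
pose a := ip u v / ip v v.
have : 0 <= ip (u - a *: v) (u - a *: v) by exact: dnorm_ge0.
have -> : ip (u - a *: v) (u - a *: v) = ip u u - `|ip u v| ^+ 2 / ip v v.
  rewrite dnormB dnormZ.
  have vn : ip v v != 0 by rewrite gt_eqF.
  have ac : conjC a = conjC (ip u v) / ip v v by rewrite rmorphM fmorphV/= vvR.
  have -> : ip u (a *: v) = `|ip u v| ^+ 2 / ip v v.
    by rewrite linearZr_LR/= ac normCK mulrAC [_ * ip u v]mulrC.
  have -> : conjC (`|ip u v| ^+ 2 / ip v v) = `|ip u v| ^+ 2 / ip v v.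
    by apply/CrealP; rewrite ger0_real// divr_ge0// ?exprn_ge0// ltW.
  have -> : `|a| ^+ 2 * ip v v = `|ip u v| ^+ 2 / ip v v.
    by rewrite !normCK ac -!mulrA (mulVf vn) mulr1 [_^-1 * _]mulrC.
  by rewrite opprD addrA addrK.
by rewrite subr_ge0 ler_pdivrMr.
Qed.

Lemma dot_triangle (u v : V) :
  sqrtC (ip (u + v) (u + v)) <= sqrtC (ip u u) + sqrtC (ip v v).
Proof.
rewrite -ler_sqr ?nnegrE ?addr_ge0 ?sqrtC_ge0 ?dnorm_ge0//.
rewrite sqrrD !sqrtCK addrAC dnormD lerD2l -mulr_natr.
rewrite -[_ + _](divfK (negbT (pnatr_eq0 _ 2))) -/('Re _) -ReE ler_pM2r ?ltr0n//.
have /le_trans : 'Re (ip u v) <= `|ip u v| by exact: (leif_Re_Creal (ip u v)).1.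
apply.
rewrite -ler_sqr ?nnegrE ?mulr_ge0 ?sqrtC_ge0 ?dnorm_ge0//.
by rewrite exprMn !sqrtCK dot_CauchySchwarz.
Qed.

End InnerProduct.

Section CircleFunctions.
Variable R : realType.
Local Notation C := (R[i]).
Local Notation Re := (@complex.Re R).
Local Notation Im := (@complex.Im R).
(* Functions on the circle are written as functions of the angle; the measure
   below only sees the angles in [0, 2 * pi]. *)
Local Notation angle := (measurableTypeR R).

Fact inv_2pi_ge0 : 0 <= (2 * pi)^-1 :> R.
Proof. by rewrite invr_ge0 mulr_ge0// pi_ge0. Qed.

Definition circle_measure : {measure set angle -> \bar R} :=
  mscale (NngNum inv_2pi_ge0)
    (mrestr lebesgue_measure (measurable_itv `[0, 2 * pi])).
Local Notation mu := circle_measure.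

Lemma circle_measure_setT : mu setT = 1%E.
Proof.
rewrite /circle_measure/= /mscale/= /mrestr setTI.
rewrite lebesgue_measure_itv/= lte_fin mulr_gt0// ?pi_gt0//.
by rewrite -EFinB subr0 -EFinM mulVf// gt_eqF// mulr_gt0// pi_gt0.
Qed.

Definition circle_Lfun (p : \bar R) : {pred angle -> C^o} :=
  fun f => ((fun t => Re (f t)) \in Lfun mu p) &&
           ((fun t => Im (f t)) \in Lfun mu p).

Lemma circle_LfunP p f : reflect
  ((fun t => Re (f t)) \in Lfun mu p /\ (fun t => Im (f t)) \in Lfun mu p)
  (f \in circle_Lfun p).
Proof. exact: andP. Qed.

Lemma circle_Lfun_submod_closed p (p1 : (1 <= p)%E) :
  submod_closed (circle_Lfun p).
Proof.
have [L0 LD] := Lfun_submod_closed mu p1.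
split; first by apply/circle_LfunP; split.
move=> a f g /circle_LfunP[rf jf] /circle_LfunP[rg jg].
apply/circle_LfunP; split.
- rewrite (_ : (fun t => _) = Re a *: (fun t => Re (f t)) +
    ((- Im a) *: (fun t => Im (f t)) + (fun t => Re (g t)))).
    by apply: (LD) => //; apply: LD.
  apply/funext => t; rewrite !fctE/=.
  by case: a (f t) (g t) => [a b] [x y] [z w]/=; rewrite scaleNr addrA.
- rewrite (_ : (fun t => _) = Re a *: (fun t => Im (f t)) +
    (Im a *: (fun t => Re (f t)) + (fun t => Im (g t)))).
    by apply: (LD) => //; apply: LD.
  apply/funext => t; rewrite !fctE/=.
  by case: a (f t) (g t) => [a b] [x y] [z w]/=; rewrite addrA.
Qed.

Lemma circle_Lfun_conj p (p1 : (1 <= p)%E) (f : angle -> C) :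
  f \in circle_Lfun p -> (fun t => conjC (f t)) \in circle_Lfun p.
Proof.
move=> /circle_LfunP[rf jf]; apply/circle_LfunP; split.
  by rewrite (_ : (fun t => _) = fun t => Re (f t))//; apply/funext => t; case: (f t).
have [L0 LD] := Lfun_submod_closed mu p1.
rewrite (_ : (fun t => _) = (-1) *: (fun t => Im (f t)) + 0); first exact: LD.
by apply/funext => t; rewrite !fctE scaleN1r addr0; case: (f t).
Qed.

Lemma circle_Lfun_mul (f g : angle -> C) :
  f \in circle_Lfun 2%:E -> g \in circle_Lfun 2%:E ->
  (fun t => f t * g t) \in circle_Lfun 1%E.
Proof.
move=> /circle_LfunP[rf jf] /circle_LfunP[rg jg].
have [L0 LD] := Lfun_submod_closed mu (@lexx _ _ 1%E).
apply/circle_LfunP; split.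
- rewrite (_ : (fun t => _) =
    (-1) *: ((fun t => Im (f t)) \* (fun t => Im (g t))) +
      ((fun t => Re (f t)) \* (fun t => Re (g t)))).
    by apply: LD; exact: Lfun2_mul_Lfun1.
  apply/funext => t; rewrite !fctE/=.
  by case: (f t) (g t) => [a b] [x y]/=; rewrite scaleN1r addrC.
- rewrite (_ : (fun t => _) =
    1 *: ((fun t => Re (f t)) \* (fun t => Im (g t))) +
      ((fun t => Im (f t)) \* (fun t => Re (g t)))).
    by apply: LD; exact: Lfun2_mul_Lfun1.
  apply/funext => t; rewrite !fctE/=.
  by case: (f t) (g t) => [a b] [x y]/=; rewrite scale1r.
Qed.

(* The integral of a complex function against the normalized arc length. *)
Definition circle_int (f : angle -> C) : C :=
  ((\int[mu]_t Re (f t)) +i* (\int[mu]_t Im (f t)))%C.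

Lemma circle_intD (f g : angle -> C) :
  f \in circle_Lfun 1%E -> g \in circle_Lfun 1%E ->
  circle_int (fun t => f t + g t) = circle_int f + circle_int g.
Proof.
move=> /circle_LfunP[/Lfun1_integrable rf /Lfun1_integrable jf].
move=> /circle_LfunP[/Lfun1_integrable rg /Lfun1_integrable jg].
apply/eqP; rewrite eq_complex/= -!RintegralD//; apply/andP.
by split; apply/eqP; apply: eq_Rintegral => t _; case: (f t) (g t) => [a b] [].
Qed.

Lemma circle_intZ (a : C) (f : angle -> C) : f \in circle_Lfun 1%E ->
  circle_int (fun t => a * f t) = a * circle_int f.
Proof.
have L (r : R) (h : angle -> R) : mu.-integrable setT (EFin \o h) ->
    mu.-integrable setT (EFin \o (fun t => r * h t)).
  move=> ih; rewrite (_ : _ \o _ = fun t => r%:E * (EFin \o h) t)%E.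
    exact: integrableZl.
  by apply/funext.
move=> /circle_LfunP[/Lfun1_integrable rf /Lfun1_integrable jf].
case: a => a b; apply/eqP; rewrite eq_complex/=.
rewrite -!RintegralZl// -RintegralB//; [|exact: L..].
rewrite -RintegralD//; [|exact: L..].
by apply/andP; split; apply/eqP; apply: eq_Rintegral => t _; case: (f t).
Qed.

Lemma circle_int_conj (f : angle -> C) : f \in circle_Lfun 1%E ->
  circle_int (fun t => conjC (f t)) = conjC (circle_int f).
Proof.
move=> /circle_LfunP[/Lfun1_integrable rf /Lfun1_integrable jf].
apply/eqP; rewrite eq_complex/=.
rewrite -mulN1r -RintegralZl//.
apply/andP; split; apply/eqP; apply: eq_Rintegral => t _; case: (f t) => //= _ x.
by rewrite mulN1r.
Qed.

Lemma ae_circle_int (f g : angle -> C) :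
  f \in circle_Lfun 1%E -> g \in circle_Lfun 1%E ->
  f = g %[ae mu] -> circle_int f = circle_int g.
Proof.
move=> /circle_LfunP[/Lfun1_integrable rf /Lfun1_integrable jf].
move=> /circle_LfunP[/Lfun1_integrable rg /Lfun1_integrable jg] fg.
rewrite /circle_int /Rintegral; congr (Complex (fine _) (fine _));
  apply: ae_eq_integral => //; try exact: (measurable_int mu).
all: by apply: filterS fg => t ft _; rewrite /= ft.
Qed.


Definition circle_exp (n : int) (t : angle) : C :=
  (cos (n%:~R * t) +i* sin (n%:~R * t))%C.

Lemma circle_expD m n t :
  circle_exp (m + n) t = circle_exp m t * circle_exp n t.
Proof.
apply/eqP; rewrite eq_complex/= intrD mulrDl cosD sinD.
by rewrite [cos _ * sin _ + _]addrC !eqxx.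
Qed.

Lemma circle_exp_conjK n t : circle_exp n t * conjC (circle_exp n t) = 1.
Proof.
apply/eqP; rewrite eq_complex/= mulrN opprK -!expr2 cos2Dsin2.
by rewrite mulrN [sin _ * _]mulrC addNr !eqxx.
Qed.

Let Lfun_mul_bounded (f g : angle -> R) (M : R) : f \in Lfun mu 2%:E ->
  measurable_fun setT g -> {ae mu, forall t, `|g t| <= M} ->
  (fun t => f t * g t) \in Lfun mu 2%:E.
Proof.
move=> L2f mg gM.
have [L0 LD] := Lfun_submod_closed mu (lee1n 2).
have : M *: f + 0 \in Lfun mu 2%:E by exact: LD.
rewrite addr0 inE => /andP[/[!inE]/= mMf fMf].
have mf : measurable_fun setT f by move: L2f; rewrite inE => /andP[/[!inE]].
apply/andP; split; rewrite inE/=; first exact: measurable_funM.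
move: fMf; rewrite /finite_norm unlock/=; apply: le_lt_trans.
have mpow (h : angle -> R) : measurable_fun setT h ->
    measurable_fun setT (fun x => (`|h x| `^ 2)%:E).
  move=> mh; apply/measurable_EFinP.
  apply: (@measurableT_comp _ _ _ _ _ _ (fun x : R => x `^ 2)%R) => //.
  exact: measurableT_comp.
rewrite gt0_ler_poweR ?in_itv/= ?leey ?integral_ge0//.
apply: ae_ge0_le_integral => //.
- exact: (mpow (fun t => f t * g t) (measurable_funM mf mg)).
- exact: (mpow (M *: f) mMf).
- apply: filterS gM => t gM _; rewrite lee_fin ge0_ler_powR// ?nnegrE//.
  rewrite mulrC -[(M *: f) t]/(M * f t) !normrM ler_wpM2r// (le_trans gM)//.
  exact: ler_norm.
Qed.

Let Lfun_mul_le1 (f g : angle -> R) : f \in Lfun mu 2%:E ->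
  measurable_fun setT g -> (forall t, `|g t| <= 1) ->
  (fun t => f t * g t) \in Lfun mu 2%:E.
Proof. by move=> L2f mg g1; apply: (@Lfun_mul_bounded _ _ 1) => //; exact: aeW. Qed.

Let Lfun2_mul_Lfuny (f g : angle -> R) :
  f \in Lfun mu 2%:E -> g \in Lfun mu +oo%E ->
  (fun t => f t * g t) \in Lfun mu 2%:E.
Proof.
move=> L2f; rewrite inE => /andP[/[!inE]/= mg].
rewrite /finite_norm unlock/= circle_measure_setT lte01.
move=> /ess_supr_bounded[M gM].
by apply: (@Lfun_mul_bounded _ _ M) => //; apply: filterS gM => t; rewrite normr_id.
Qed.

Lemma circle_Lfuny_mul (phi f : angle -> C) :
  phi \in circle_Lfun +oo%E -> f \in circle_Lfun 2%:E ->
  (fun t => phi t * f t) \in circle_Lfun 2%:E.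
Proof.
move=> /circle_LfunP[rp jp] /circle_LfunP[rf jf].
have [L0 LD] := Lfun_submod_closed mu (lee1n 2).
apply/circle_LfunP; split.
- rewrite (_ : (fun t => _) = (-1) *: (fun t => Im (f t) * Im (phi t)) +
      (fun t => Re (f t) * Re (phi t))).
    by apply: LD; apply: Lfun2_mul_Lfuny.
  apply/funext => t; rewrite !fctE scaleN1r/=.
  by case: (f t) (phi t) => [a b] [c d]/=; rewrite addrC mulrC [b * _]mulrC.
- rewrite (_ : (fun t => _) = 1 *: (fun t => Re (f t) * Im (phi t)) +
      (fun t => Im (f t) * Re (phi t))).
    by apply: LD; apply: Lfun2_mul_Lfuny.
  apply/funext => t; rewrite !fctE scale1r/=.
  by case: (f t) (phi t) => [a b] [c d]/=; rewrite addrC [a * _]mulrC [b * _]mulrC.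
Qed.

Let Lfun2_1 : cst 1 \in Lfun mu 2%:E.
Proof.
rewrite inE; apply/andP; split; rewrite inE//=.
by rewrite /finite_norm (@Lnorm_cst1 _ _ _ mu) circle_measure_setT poweR_lty ?ltry.
Qed.

Let mcos (r : R) : measurable_fun setT (fun t : angle => cos (r * t)).
Proof.
apply: measurableT_comp; last exact: measurable_funM.
apply: continuous_measurable_fun; exact: continuous_cos.
Qed.

Let msin (r : R) : measurable_fun setT (fun t : angle => sin (r * t)).
Proof.
apply: measurableT_comp; last exact: measurable_funM.
apply: continuous_measurable_fun; exact: continuous_sin.
Qed.

Lemma circle_exp_L2 n : circle_exp n \in circle_Lfun 2%:E.
Proof.
apply/circle_LfunP; split.
  rewrite (_ : (fun t => _) = fun t => cst 1 t * cos (n%:~R * t)).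
    by apply: Lfun_mul_le1 => // t; rewrite ler_norml cos_geN1 cos_le1.
  by apply/funext => t; rewrite mul1r.
rewrite (_ : (fun t => _) = fun t => cst 1 t * sin (n%:~R * t)).
  by apply: Lfun_mul_le1 => // t; rewrite ler_norml sin_geN1 sin_le1.
by apply/funext => t; rewrite mul1r.
Qed.

Lemma circle_exp_mul_L2 n (f : angle -> C) : f \in circle_Lfun 2%:E ->
  (fun t => circle_exp n t * f t) \in circle_Lfun 2%:E.
Proof.
move=> /circle_LfunP[rf jf].
have [L0 LD] := Lfun_submod_closed mu (lee1n 2).
have c1 t : `|cos (n%:~R * t)| <= 1 :> R by rewrite ler_norml cos_geN1 cos_le1.
have s1 t : `|sin (n%:~R * t)| <= 1 :> R by rewrite ler_norml sin_geN1 sin_le1.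
apply/circle_LfunP; split.
- rewrite (_ : (fun t => _) = (-1) *: (fun t => Im (f t) * sin (n%:~R * t)) +
      (fun t => Re (f t) * cos (n%:~R * t))).
    by apply: LD; apply: Lfun_mul_le1.
  apply/funext => t; rewrite !fctE scaleN1r/=; case: (f t) => a b/=.
  by rewrite addrC mulrC [b * _]mulrC.
- rewrite (_ : (fun t => _) = 1 *: (fun t => Re (f t) * sin (n%:~R * t)) +
      (fun t => Im (f t) * cos (n%:~R * t))).
    by apply: LD; apply: Lfun_mul_le1.
  apply/funext => t; rewrite !fctE scale1r/=; case: (f t) => a b/=.
  by rewrite addrC [a * _]mulrC [b * _]mulrC.
Qed.

End CircleFunctions.

Section L2.
Variable R : realType.
Local Notation C := (R[i]).
Local Notation angle := (measurableTypeR R).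
Local Notation mu := (circle_measure R).

HB.instance Definition _ := GRing.isSubmodClosed.Build _ _
  (circle_Lfun 2%:E : {pred angle -> C^o})
  (circle_Lfun_submod_closed (lee1n 2)).

Record L2fun := MkL2fun {
  L2fun_val :> angle -> C^o ; _ : L2fun_val \in circle_Lfun 2%:E }.

HB.instance Definition _ := [isSub for L2fun_val].
HB.instance Definition _ := gen_eqMixin L2fun.
HB.instance Definition _ := gen_choiceMixin L2fun.
HB.instance Definition _ := [SubChoice_isSubLmodule of L2fun by <:].

(* The functions vanishing almost everywhere; L^2 is the quotient by them. *)
Definition L2null : {pred L2fun} :=
  fun f => `[< {ae mu, forall t, L2fun_val f t = 0} >].

Lemma L2null_zmod_closed : zmod_closed L2null.
Proof.
split; first by apply/asboolP; exact: aeW.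
move=> f g /asboolP f0 /asboolP g0; apply/asboolP.
by apply: filterS2 f0 g0 => t /=; rewrite /= !fctE => -> ->; rewrite subrr.
Qed.

HB.instance Definition _ := GRing.isZmodClosed.Build _ L2null L2null_zmod_closed.

Definition L2 : Type := {ideal_quot L2null}.
HB.instance Definition _ := GRing.Zmodule.on L2.
HB.instance Definition _ := EqQuotient.on L2.

Definition L2_scale (a : C) (x : L2) : L2 := \pi_L2 (a *: repr x).

Lemma L2_eqP (f g : L2fun) :
  \pi_L2 f = \pi_L2 g <-> {ae mu, forall t, L2fun_val f t = L2fun_val g t}.
Proof.
have -> : (\pi_L2 f = \pi_L2 g) <-> (f - g \in L2null).
  by rewrite Quotient.idealrBE; split => /eqP.
split=> [/asboolP|fg]; last apply/asboolP.
  by apply: filterS => t /=; rewrite !fctE => /eqP; rewrite subr_eq0 => /eqP.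
by apply: filterS fg => t /= ; rewrite !fctE => ->; rewrite subrr.
Qed.

Lemma L2_repr_pi (f : L2fun) :
  {ae mu, forall t, L2fun_val (repr (\pi_L2 f)) t = L2fun_val f t}.
Proof. by apply/L2_eqP; rewrite reprK. Qed.

Lemma L2_pi_scale a (f : L2fun) : L2_scale a (\pi_L2 f) = \pi_L2 (a *: f).
Proof.
apply/L2_eqP; apply: filterS (L2_repr_pi f) => t /= fE.
by rewrite !fctE fE.
Qed.

Let L2_pi_add (f g : L2fun) : \pi_L2 f + \pi_L2 g = \pi_L2 (f + g).
Proof. by rewrite (raddfD \pi_L2). Qed.

Let L2_scalerA a b x : L2_scale a (L2_scale b x) = L2_scale (a * b) x.
Proof. by elim/quotW: x => f; rewrite (L2_pi_scale b) !L2_pi_scale scalerA. Qed.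

Let L2_scale1r : left_id 1 L2_scale.
Proof. by elim/quotW => f; rewrite L2_pi_scale scale1r. Qed.

Let L2_scalerDr : right_distributive L2_scale +%R.
Proof.
move=> a; elim/quotW => f; elim/quotW => g.
by rewrite L2_pi_add !L2_pi_scale L2_pi_add scalerDr.
Qed.

Let L2_scalerDl x : {morph L2_scale^~ x : a b / a + b}.
Proof.
by move=> a b; elim/quotW: x => f; rewrite !L2_pi_scale L2_pi_add scalerDl.
Qed.

HB.instance Definition _ := GRing.Zmodule_isLmodule.Build C L2
  L2_scalerA L2_scale1r L2_scalerDr L2_scalerDl.

(* The class of a square-integrable function; the value on any other function
   is a meaningless 0. *)
Definition L2_of (f : angle -> C) : L2 := \pi_L2 (insubd 0 (f : angle -> C^o)).

Definition L2_dot (x y : L2) : C :=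
  circle_int (fun t => (repr x : L2fun) t * conjC ((repr y : L2fun) t)).

Let mul_conj_L1 (f g : L2fun) :
  (fun t => f t * conjC (g t)) \in circle_Lfun 1%E.
Proof.
apply: circle_Lfun_mul; first exact: (valP f).
by apply: circle_Lfun_conj; [exact: lee1n|exact: (valP g)].
Qed.

Lemma L2_dot_pi (f g : L2fun) :
  L2_dot (\pi_L2 f) (\pi_L2 g) = circle_int (fun t => f t * conjC (g t)).
Proof.
apply: ae_circle_int; [exact: mul_conj_L1..|].
by apply: filterS2 (L2_repr_pi f) (L2_repr_pi g) => t /= -> -> .
Qed.

Let L2_dot_linearl y : GRing.linear_for *%R (L2_dot^~ y).
Proof.
move=> a u v; elim/quotW: y => h; elim/quotW: u => f; elim/quotW: v => g.
rewrite -[a *: _]/(L2_scale a _) L2_pi_scale L2_pi_add !L2_dot_pi.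
rewrite -circle_intZ// -circle_intD//.
  by congr circle_int; apply/funext => t; rewrite mulrA -mulrDl.
rewrite (_ : (fun t => _) = fun t => (a *: f : L2fun) t * conjC (h t)) //.
by apply/funext => t; rewrite mulrA.
Qed.

Let L2_dotC x y : L2_dot x y = conjC (L2_dot y x).
Proof.
elim/quotW: x => f; elim/quotW: y => g; rewrite !L2_dot_pi -circle_int_conj//.
by congr circle_int; apply/funext => t; rewrite rmorphM/= conjCK mulrC.
Qed.

Let L2_dot_bilinear :
  bilinear_for (GRing.Scale.Law.clone C C *%R _)
    (GRing.Scale.Law.clone C C (conjC \; *%R) _) L2_dot.
Proof.
split; first exact: L2_dot_linearl.
move=> x a u v; rewrite L2_dotC L2_dot_linearl rmorphD rmorphM/=.
by rewrite -!(L2_dotC x).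
Qed.

HB.instance Definition _ := bilinear_isBilinear.Build C L2 L2 C
  *%R (conjC \; *%R) L2_dot L2_dot_bilinear.

HB.instance Definition _ := isHermitianSesquilinear.Build C L2 false conjC
  L2_dot (fun x y => etrans (L2_dotC x y) (esym (mul1r _))).

Let L2_dot_gt0 x : x != 0 -> 0 < L2_dot x x.
Proof.
elim/quotW: x => f; rewrite L2_dot_pi; apply: contraNT.
pose g t := complex.Re (f t) ^+ 2 + complex.Im (f t) ^+ 2.
have fg t : f t * conjC (f t) = Complex (g t) 0.
  rewrite /g; case: (f t : C) => a b; apply/eqP; rewrite eq_complex/=.
  by rewrite mulrN opprK -!expr2 mulrN [b * a]mulrC addNr !eqxx.
have -> : (fun t => f t * conjC (f t)) = fun t => Complex (g t) 0 by exact/funext.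
have g0 t : 0 <= g t by rewrite addr_ge0// sqr_ge0.
have ig : mu.-integrable setT (EFin \o g).
  have /circle_LfunP[/Lfun1_integrable + _] := mul_conj_L1 f f.
  by apply: eq_integrable => // t _; rewrite /= fg.
rewrite /circle_int/= ltcE/= Rintegral_cst// mul0r eqxx/=.
rewrite lt_neqAle Rintegral_ge0 ?andbT// negbK eq_sym => /eqP ig0.
have : (\int[mu]_t `|(EFin \o g) t| = 0)%E.
  under eq_integral do rewrite /= ger0_norm//.
  rewrite -[LHS]fineK; last exact: (integrable_fin_num measurableT ig).
  by rewrite -[fine _]/(Rintegral mu setT g) ig0.
have mg : measurable_fun setT (EFin \o g) by exact: (measurable_int mu).
move=> /(ae_eq_integral_abs mu measurableT mg) {}ig0; apply/eqP.
rewrite -(raddf0 \pi_L2); apply/L2_eqP.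
apply: filterS ig0 => t /(_ I) [] /eqP.
rewrite paddr_eq0 ?sqr_ge0// !sqrf_eq0 => /andP[/eqP a0 /eqP b0].
by apply/eqP; rewrite eq_complex a0 b0/= !eqxx.
Qed.

HB.instance Definition _ := isDotProduct.Build C L2 L2_dot L2_dot_gt0.

Let L2_norm x := sqrtC (L2_dot x x).

Let L2_normD x y : L2_norm (x + y) <= L2_norm x + L2_norm y.
Proof. exact: dot_triangle. Qed.

Let L2_normZ a x : L2_norm (a *: x) = `|a| * L2_norm x.
Proof.
by rewrite /L2_norm dnormZ rootCMl ?exprn_ge0// (sqrCK (normr_ge0 a)).
Qed.

Let L2_norm0_eq0 x : L2_norm x = 0 -> x = 0.
Proof. by move/eqP; rewrite sqrtC_eq0 dnorm_eq0 => /eqP. Qed.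

HB.instance Definition _ := Lmodule_isNormed.Build C L2
  L2_normD L2_normZ L2_norm0_eq0.

Lemma L2_normE (x : L2) : `|x| ^+ 2 = L2_dot x x.
Proof. by rewrite sqrtCK. Qed.

Definition fourier (x : L2) (n : int) : C :=
  circle_int (fun t => (repr x : L2fun) t * conjC (circle_exp n t)).

Let fourierE x n : fourier x n = L2_dot x (\pi_L2 (MkL2fun (circle_exp_L2 R n))).
Proof. by rewrite -[x in RHS]reprK L2_dot_pi. Qed.

Lemma fourier_pi (f : L2fun) n :
  fourier (\pi_L2 f) n = circle_int (fun t => f t * conjC (circle_exp n t)).
Proof. by rewrite fourierE L2_dot_pi. Qed.

Definition hardy2 : {pred L2} :=
  fun x => `[< forall n : int, n < 0 -> fourier x n = 0 >].

Lemma hardy2_submod_closed : submod_closed hardy2.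
Proof.
split=> [|a x y /asboolP x0 /asboolP y0]; apply/asboolP => n n0.
  by rewrite fourierE linear0l.
by rewrite fourierE linearPl/= -!fourierE x0// y0// mulr0 addr0.
Qed.

HB.instance Definition _ := GRing.isSubmodClosed.Build _ _ hardy2
  hardy2_submod_closed.

Record H2 := MkH2 { H2_val :> L2 ; _ : H2_val \in hardy2 }.

HB.instance Definition _ := [isSub for H2_val].
HB.instance Definition _ := gen_eqMixin H2.
HB.instance Definition _ := gen_choiceMixin H2.
HB.instance Definition _ := [SubChoice_isSubLmodule of H2 by <:].

Let H2_norm (x : H2) : C := `|H2_val x|.

Let H2_normD x y : H2_norm (x + y) <= H2_norm x + H2_norm y.
Proof. exact: ler_normD. Qed.

Let H2_normZ a x : H2_norm (a *: x) = `|a| * H2_norm x.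
Proof. exact: normrZ. Qed.

Let H2_norm0_eq0 x : H2_norm x = 0 -> x = 0.
Proof. by move/normr0_eq0 => x0; exact: val_inj. Qed.

HB.instance Definition _ := Lmodule_isNormed.Build C H2
  H2_normD H2_normZ H2_norm0_eq0.

Lemma H2_normE (x : H2) : `|x| ^+ 2 = L2_dot x x.
Proof. exact: L2_normE. Qed.

(* Multiplication by the independent variable z = circle_exp 1 t. *)
Let shift_val (x : L2) : L2 :=
  \pi_L2 (MkL2fun (circle_exp_mul_L2 1 (valP (repr x)))).

Let shift_hardy2 (x : H2) : shift_val x \in hardy2.
Proof.
case: x => x /= /asboolP x0; apply/asboolP => n n0.
rewrite fourier_pi -[RHS](x0 (n - 1)); last by rewrite subr_lt0 (lt_trans n0).
congr circle_int; apply/funext => t /=.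
have -> : circle_exp n t = circle_exp (n - 1) t * circle_exp 1 t.
  by rewrite -circle_expD subrK.
rewrite rmorphM/= [X in _ * X = _]mulrC mulrACA.
by rewrite circle_exp_conjK mul1r.
Qed.

Definition shift (x : H2) : H2 := MkH2 (shift_hardy2 x).

(* The orthogonal projection of L^2 onto H^2: the unique p in H^2 such that
   x - p is orthogonal to H^2. *)
Definition H2_proj (x : L2) : H2 :=
  xget 0 [set p | forall h : H2, L2_dot (x - H2_val p) h = 0].

(* For phi in L^oo, phi f is square-integrable by circle_Lfuny_mul. *)
Definition toeplitz (phi : angle -> C) (x : H2) : H2 :=
  H2_proj (L2_of (fun t => phi t * (repr (H2_val x) : L2fun) t)).

End L2.

Section BoundedAnalytic.
Variable R : realType.
Local Notation C := (R[i]).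

(* Complex differentiability at each point of the disk, and boundedness. The
   values of F outside the disk are irrelevant. *)
Definition Hinfty_disk (F : C -> C) :=
  (forall z, `|z| < 1 -> derivable (F : C^o -> C^o) z 1) /\
  exists M : C, forall z, `|z| < 1 -> `|F z| <= M.

Definition bounded_away_from_0 (F : C -> C) :=
  exists2 d : C, 0 < d & forall z, `|z| < 1 -> d <= `|F z|.

Definition radial_limit (F : C -> C) (phi : measurableTypeR R -> C) :=
  {ae circle_measure R, forall t,
    (F (r%:C%C * circle_exp 1 t) : C^o) @[r --> (1 : R)^'-] --> (phi t : C^o)}.

End BoundedAnalytic.

Section HilbertSpaces.
Variable R : realType.
Local Notation C := (R[i]).

Definition bounded_operator (K H : normedModType C) (f : {linear K -> H}) :=
  exists M : C, forall x, `|f x| <= M * `|x|.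

(* [L] is a bounded invertible operator with inverse [L']. *)
Definition GL (K H : normedModType C) (L : {linear K -> H})
    (L' : {linear H -> K}) :=
  [/\ bounded_operator L, bounded_operator L', cancel L L' & cancel L' L].

Definition separable (H : normedModType C) :=
  exists2 D : set H, countable D & dense D.

Definition finite_dimensional (H : lmodType C) :=
  exists n (e : 'I_n -> H), forall x, exists c : 'I_n -> C,
    x = \sum_(i < n) c i *: e i.

Definition linear_span (H : lmodType C) (e : nat -> H) : set H :=
  [set x | exists n (c : nat -> C), x = \sum_(i < n) c i *: e i].

Section Bases.
Variables (H : completeNormedModType C) (ip : {dot H for conjC}).

Definition orthonormal_basis (e : nat -> H) :=
  (forall m n, ip (e m) (e n) = (m == n)%:R) /\
  closure (linear_span e) = setT.

Definition riesz_basis (f : nat -> H) :=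
  exists e (U U' : {linear H -> H}),
    [/\ orthonormal_basis e, GL U U' & forall n, f n = U (e n)].

(* The squared moduli and norms live in R[i]; Re turns them into reals. The
   series of nonnegative terms is taken in the extended reals. *)
Definition frame (f : nat -> H) :=
  exists C1 C2 : R, [/\ 0 < C1, C1 <= C2 & forall x : H,
    ((C1 * complex.Re (`|x| ^+ 2))%:E <=
       \sum_(0 <= n <oo) (complex.Re (`|ip x (f n)| ^+ 2))%:E /\
     \sum_(0 <= n <oo) (complex.Re (`|ip x (f n)| ^+ 2))%:E <=
       (C2 * complex.Re (`|x| ^+ 2))%:E)%E].

Definition frame_vectors (T : H -> H) : set H :=
  [set h | frame (fun n => iter n T h)].

End Bases.

End HilbertSpaces.

(* Main.v *)
Require Import Defs.
From HB Require Import structures.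
From mathcomp Require Import ring lra measurable_realfun.
Set Implicit Arguments.
Unset Strict Implicit.
Unset Printing Implicit Defensive.
Import Order.TTheory GRing.Theory Num.Theory Num.Def.
Import numFieldNormedType.Exports.
Local Open Scope classical_set_scope.
Local Open Scope ring_scope.

(** Similar operators have similar orbits, so everything takes place in H^2: the
    question is for which u the orbit z^n u is a frame.  A sequence is a frame
    exactly when its synthesis operator c |-> sum c_n f_n maps l^2 boundedly onto
    the space ([synthesis_onto_frame], [frame_synthesis_onto]); this property,
    called [synthesis_onto] and phrased with finite sums only, holds for Riesz
    bases and is carried along by bounded invertible operators
    ([synthesis_onto_GL]).  For the orbit of u the synthesis operator sends a
    polynomial p to p u.

    The heart of the matter is [synthesis_onto_unit]: the orbit of u has this
    property if and only if u is a unit, that is, u is bounded, bounded away from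
    0, and 1/u lies in H^2.  Boundedness of p |-> p u by A says that |u|^2 <= A
    when averaged against any |p|^2.  The truncated Cauchy kernels are such p, and
    the squared modulus of a Cauchy kernel is a multiple of a Poisson kernel;
    hence the Poisson integrals of |u|^2 are at most A, and so is |u|^2 almost
    everywhere, by Fatou's theorem ([ae_ge0_of_polynomials]).  For the lower
    bound, surjectivity provides polynomials p_k of controlled norm with
    p_k u -> q u.  The equations expressing the coefficients of p u by those of p
    are triangular, so the coefficients of p_k tend to those of q and
    |q|^2 <= A |q u|^2 ([almost_onto_lower]); the same averaging argument gives
    |u|^2 >= 1/A.  With q u replaced by 1, the p_k converge to 1/u in square mean,
    so that 1/u lies in H^2.  Conversely, for a unit u, the polynomials
    approximating y/u solve p u = y up to any precision.

    Let L^-1 f0 = g, a unit since the orbit of f0 is a Riesz basis.  The Toeplitz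
    operator with an analytic symbol phi is the multiplication by phi, so
    V f0 = L (phi g).  As products and quotients of units are units, V f0 runs
    through all L u with u a unit when phi runs through the units.  It remains to
    see that the units are the radial limits of the bounded analytic F that are
    bounded away from 0.  A unit phi is the radial limit of its Cauchy integral,
    which coincides with its Poisson integral and is therefore bounded; point
    evaluations being multiplicative ([cauchy_int_mul]), the Cauchy integral of
    1/phi is the reciprocal of that of phi, which is thus bounded away from 0
    ([analytic_unit_boundary]).  Conversely, Goursat's argument on polar
    rectangles shows that the Fourier coefficients of negative index of F vanish
    on each circle of radius r < 1, and dominated convergence transfers this to
    the radial limit; the same applies to 1/F ([radial_limit_unit]).

    The similarity of T to the shift comes from the isometry of H^2 onto H that
    sends z^n to an orthonormal basis e_n ([hardy_model]), followed by the operator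
    sending e_n to T^n f0: T and the shift then agree on a total family.

    The classical facts used on the way are Fatou's theorem, deduced from
    Lebesgue's differentiation theorem by bounding the Poisson kernel by a sum of
    indicators of dyadic balls ([poisson_radial_limit]); uniqueness of Fourier
    coefficients, a consequence of it ([circle_fourier_unique]); and the
    Riesz-Fischer theorem ([riesz_fischer]), which together with uniqueness yields
    the density of polynomials in H^2 ([analytic_approx]). *)

(** * Poisson kernel and Lebesgue points *)

Section Poisson.
Variable R : realType.
Local Notation angle := (measurableTypeR R).
Local Notation mu := (circle_measure R).
Local Notation leb := (@lebesgue_measure R).
Local Notation arc := (`[0, 2 * pi]%classic : set angle).

Lemma twopi_gt0 : 0 < 2 * pi :> R.
Proof. by rewrite mulr_gt0// pi_gt0. Qed.

Lemma circle_null (A : set angle) : measurable A -> leb (A `&` arc) = 0%E ->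
  mu A = 0%E.
Proof. by move=> mA A0; rewrite /circle_measure/= /mscale/= /mrestr A0 mule0. Qed.

Lemma circle_ae (P : angle -> Prop) : {ae leb, forall t, P t} ->
  {ae mu, forall t, P t}.
Proof.
move=> [N [mN N0 PN]]; exists N; split => //; apply: circle_null => //.
apply/eqP; rewrite eq_le measure_ge0 andbT -N0 le_measure ?inE//.
  exact: measurableI.
Qed.

Lemma circle_ae_arc : {ae mu, forall t : angle, 0 < t < 2 * pi}.
Proof.
exists (~` `]0, 2 * pi[%classic); split.
- exact: measurableC.
- apply: circle_null; first exact: measurableC.
  rewrite (_ : _ `&` _ = [set 0] `|` [set 2 * pi]); last first.
    apply/seteqP; split => t /=; rewrite !in_itv/=.
      move=> [/negP]; rewrite negb_and -!leNgt => /orP[] t0 /andP[t1 t2].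
        by left; apply/eqP; rewrite eq_le t0.
      by right; apply/eqP; rewrite eq_le t0 t2.
    by case=> ->; rewrite ltxx ?andbF ?lexx (ltW twopi_gt0); split.
  by apply: countable_lebesgue_measure0; apply: finite_set_countable; rewrite finite_setU; split; exact: finite_set1.
- by apply: subsetC => t /=; rewrite in_itv.
Qed.

Lemma ge0_circle_integralE (f : angle -> \bar R) :
  measurable_fun setT f -> (forall t, 0 <= f t)%E ->
  (\int[mu]_t f t = (2 * pi)^-1%:E * \int[leb]_(t in arc) f t)%E.
Proof.
move=> mf f0; rewrite (@ge0_negligible_integral _ _ _ mu setT (~` arc))//; first last.
- apply: circle_null; first exact: measurableC.
  by rewrite setIC setICr measure0.
- exact: measurableC.
rewrite setTD setCK (@eq_measure_integral _ _ _ arc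
    (mscale (NngNum (inv_2pi_ge0 R)) leb)); last first.
  by move=> A mA Aarc; rewrite /circle_measure/= /mscale/= /mrestr; congr (_ * leb _)%E; apply/setIidPl.
by rewrite ge0_integral_mscale//; exact: measurable_funS mf.
Qed.

Definition poisson (r s : R) : R := (1 - r ^+ 2) / (1 - 2 * r * cos s + r ^+ 2).

Lemma poisson_denE (r s : R) :
  1 - 2 * r * cos s + r ^+ 2 = (1 - r) ^+ 2 + 2 * r * (1 - cos s).
Proof. ring. Qed.

Lemma poisson_den_gt0 (r s : R) : 0 <= r < 1 -> 0 < 1 - 2 * r * cos s + r ^+ 2.
Proof.
move=> /andP[r0 r1]; rewrite poisson_denE ltr_wpDr ?exprn_gt0 ?subr_gt0//.
by rewrite mulr_ge0 ?mulr_ge0// subr_ge0 cos_le1.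
Qed.

Lemma poisson_ge0 (r s : R) : 0 <= r < 1 -> 0 <= poisson r s.
Proof.
move=> r01; rewrite /poisson divr_ge0 ?(ltW (poisson_den_gt0 _ r01))//.
by case/andP: r01 => r0 r1; rewrite subr_ge0 expr_le1// ltW.
Qed.

Lemma poisson_measurable (r x : R) : 0 <= r < 1 ->
  measurable_fun (setT : set angle) (fun t => poisson r (x - t)).
Proof.
move=> r01; apply: continuous_measurable_fun => t.
rewrite /poisson; apply: cvgM; first exact: cvg_cst.
apply: cvgV; first by rewrite gt_eqF ?poisson_den_gt0.
apply: cvgD; last exact: cvg_cst.
apply: cvgB; first exact: cvg_cst.
apply: cvgM; first exact: cvg_cst.
apply: (@continuous_comp _ _ _ (fun t => x - t) cos); last exact: continuous_cos.
by apply: cvgB; [exact: cvg_cst|exact: cvg_id].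
Qed.

(** Where 1 - cos s is at least a constant, the kernel is of the order of 1 - r;
    near 0 the term (1 - r)^2 takes over. *)
Lemma poisson_le (d r s : R) : 0 < d -> 2^-1 <= r < 1 ->
  d <= (1 - r) ^+ 2 + (1 - cos s) -> poisson r s <= 2 * (1 - r) / d.
Proof.
move=> d0 /andP[r2 r1] ds; rewrite /poisson poisson_denE.
have r0 : 0 <= r by rewrite (le_trans _ r2).
have D : d <= (1 - r) ^+ 2 + 2 * r * (1 - cos s).
  rewrite (le_trans ds)// lerD2l ler_peMl ?subr_ge0 ?cos_le1//.
  by rewrite -ler_pdivrMl// mulr1.
apply: ler_pM.
- by nra.
- by rewrite invr_ge0 (le_trans (ltW d0)).
- by nra.
- by rewrite lef_pV2 ?posrE// (lt_le_trans d0).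
Qed.

(** The factor 4^-1 ^+ k beats the length 2 ^+ k of the k-th ball, leaving a
    geometric series. *)
Let layer (c r s : R) k := (2 + 8 / c) * (4^-1 ^+ k) / (1 - r) * (`|s| < 2 ^+ k * (1 - r))%R%:R.

(** The least k whose ball contains s gives the layer that does the work: outside
    the previous ball, s ^+ 2 is at least a multiple of (2 ^+ k * (1 - r)) ^+ 2. *)
Lemma poisson_layers (c r s : R) K : 0 < c -> 2^-1 <= r < 1 ->
  c * s ^+ 2 <= 1 - cos s -> `|s| < 2 ^+ K * (1 - r) ->
  poisson r s <= \sum_(k < K.+1) layer c r s k.
Proof.
move=> c0 r12 cs sK; case/andP: (r12) => r2 r1.
have d0 : 0 < 1 - r by rewrite subr_gt0.
have lay0 k : 0 <= layer c r s k.
  by rewrite mulr_ge0// mulr_ge0 ?invr_ge0 ?(ltW d0)// mulr_ge0 ?exprn_ge0// addr_ge0// divr_ge0// ltW.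
have ex : exists k, `|s| < 2 ^+ k * (1 - r) by exists K.
case: (ex_minnP ex) => k sk kmin.
have kK : (k < K.+1)%N by rewrite ltnS kmin.
rewrite (bigD1 (Ordinal kK))//= ler_wpDr//; first by apply: sumr_ge0 => i _.
rewrite /layer sk mulr1.
case: k sk kmin {kK} => [|k] sk kmin.
  rewrite expr0 mulr1 (@le_trans _ _ (2 * (1 - r) / (1 - r) ^+ 2))//.
    by apply: poisson_le => //; rewrite ?exprn_gt0// lerDl subr_ge0 cos_le1.
  rewrite (_ : 2 * (1 - r) / (1 - r) ^+ 2 = 2 / (1 - r)); last by field; rewrite gt_eqF.
  rewrite ler_wpM2r ?invr_ge0 ?(ltW d0)// lerDl.
  by rewrite divr_ge0// ltW.
have sk' : 2 ^+ k * (1 - r) <= `|s|.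
  by rewrite leNgt; apply/negP => /kmin; rewrite ltnn.
rewrite (@le_trans _ _ (2 * (1 - r) / (c * (2 ^+ k * (1 - r)) ^+ 2)))//.
  apply: poisson_le => //; first by rewrite mulr_gt0// exprn_gt0// mulr_gt0// exprn_gt0.
  rewrite ler_wpDl ?sqr_ge0// (le_trans _ cs)// ler_wpM2l ?(ltW c0)//.
  by rewrite -[s ^+ 2]real_normK ?num_real// ler_sqr ?nnegrE// mulr_ge0 ?(ltW d0)// exprn_ge0.
have -> : 2 * (1 - r) / (c * (2 ^+ k * (1 - r)) ^+ 2) = 8 / c * 4^-1 ^+ k.+1 / (1 - r).
  have e4 : 4^-1 ^+ k = ((2 ^+ k) ^+ 2)^-1 :> R by rewrite exprVn -exprM mulnC exprM -(natrX _ 2 2).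
  have : 2 ^+ k != 0 :> R by rewrite expf_neq0.
  rewrite [4^-1 ^+ _]exprS e4; move: (2 ^+ k) => x x0; field.
  by rewrite x0 !gt_eqF.
rewrite ler_wpM2r ?invr_ge0 ?(ltW d0)// ler_wpM2r ?exprn_ge0 ?invr_ge0//.
by rewrite lerDr.
Qed.

Lemma one_sub_cos (s : R) : 1 - cos s = 2 * sin (s / 2) ^+ 2.
Proof.
rewrite {1}(_ : s = s / 2 + s / 2); last by field.
rewrite cosD -!expr2; have := cos2Dsin2 (s / 2); lra.
Qed.

(** The derivative of the sine at 0 gives |sin (s/2)| >= |s|/4, hence the
    constant 8^-1. *)
Lemma one_sub_cos_near0 : exists2 d : R, 0 < d &
  forall s, `|s| < d -> 8^-1 * s ^+ 2 <= 1 - cos s.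
Proof.
have : (h^-1 *: (sin (h *: 1 + 0) - sin 0)) @[h --> 0^'] --> (1 : R).
  have [d] := @is_derive_sin R 0; rewrite cos0 => dE.
  by rewrite -[X in _ --> X]dE; exact: d.
move=> /cvgrPdist_lt /(_ 2^-1 ltac:(by [])) [d/= d0 H].
exists d => // s sd; rewrite one_sub_cos.
have [->|s0] := eqVneq s 0; first by rewrite mul0r sin0 expr0n/= !mulr0.
have bs : ball_ [eta normr] 0 d (s / 2).
  rewrite /ball_/= sub0r normrN normrM normfV [`|2|]gtr0_norm// ltr_pdivrMr//.
  by rewrite (lt_le_trans sd)// ler_peMr ?(ltW d0)// ler1n.
have s20 : s / 2 != 0 by rewrite mulf_neq0// invr_neq0.
have := H (s / 2) bs s20.
rewrite sin0 subr0 addr0 [_ *: 1]mulr1 => /ltr_normlW; rewrite ltrBlDr -ltrBlDl.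
set y := sin _; rewrite /GRing.scale/= => h.
have -> : y = s / 2 * ((s / 2)^-1 * y) by rewrite mulVKf.
move: h; set w := _ * y => h.
have w2 : 4^-1 <= w ^+ 2 by nra.
have := ler_wpM2l (sqr_ge0 s) w2; rewrite !exprMn; lra.
Qed.

(** The end points of the arc are excluded because x - t could come close to
    2 pi there. *)
Lemma one_sub_cos_far (x d : R) : 0 < x < 2 * pi -> 0 < d ->
  exists2 eta : R, 0 < eta & forall t, arc t -> d <= `|x - t| ->
    eta <= 1 - cos (x - t).
Proof.
move=> /andP[x0 x2] d0; pose m := Num.max x (2 * pi - x).
have m1 : x <= m by rewrite le_max lexx.
have m2 : 2 * pi - x <= m by rewrite le_max lexx orbT.
have mt t : arc t -> `|x - t| <= m.
  by rewrite /= in_itv/= => /andP[t0 t2]; rewrite ler_norml; apply/andP; split; lra.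
have [md|dm] := ltP m d.
  by exists 1 => // t /mt tm /(lt_le_trans md)/(le_lt_trans tm); rewrite ltxx.
have [c cdm cmax] := EVT_max dm (continuous_subspaceT (@continuous_cos R)).
exists (1 - cos c) => [|t].
  rewrite one_sub_cos mulr_gt0// exprn_gt0// sin_gt0_pi//.
  move: cdm; rewrite in_itv/= => /andP[dc cm].
  have m0 : m < 2 * pi by rewrite gt_max x2 gtrBl.
  by apply/andP; split; lra.
move=> /mt tm dt.
by rewrite -[cos (x - t)]cos_norm lerD2l lerN2 cmax// in_itv/= dt.
Qed.

Lemma geometric_half_le2 K : \sum_(k < K) 2^-1 ^+ k <= 2 :> R.
Proof.
have -> : \sum_(k < K) 2^-1 ^+ k = 2 - 2 * 2^-1 ^+ K :> R.
  elim: K => [|n ih]; first by rewrite big_ord0 expr0 mulr1 subrr.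
  by rewrite big_ord_recr/= ih exprS; field.
by rewrite gerBl mulr_ge0// exprn_ge0// invr_ge0.
Qed.

Let layer_ball (c r x t : R) k : (layer c r (x - t) k =
  (2 + 8 / c) * 4^-1 ^+ k / (1 - r) * \1_(ball x (2 ^+ k * (1 - r))) t)%R.
Proof.
rewrite indicE (_ : (t \in _) = (`|x - t| < 2 ^+ k * (1 - r)))//.
by apply/idP/idP; rewrite inE.
Qed.

(** A point where the small balls carry a small proportion of h sees a small
    Poisson average of h: near the point each layer contributes a term of a
    geometric series, away from it the kernel tends to 0 uniformly. *)
Lemma poisson_average (x : R) (h : angle -> R) : 0 < x < 2 * pi ->
  measurable_fun setT h -> (forall t, 0 <= h t) ->
  (\int[leb]_(t in arc) (h t)%:E < +oo)%E ->
  (forall e, 0 < e -> exists2 d, 0 < d & forall rho, 0 < rho <= d ->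
    (\int[leb]_(t in arc `&` ball x rho) (h t)%:E <= (rho * e)%:E)%E) ->
  forall e, 0 < e -> exists2 d, 0 < d & forall r, 1 - d < r < 1 ->
    (\int[leb]_(t in arc) (poisson r (x - t) * h t)%:E <= e%:E)%E.
Proof.
move=> x0 mh h0 hoo ha e e0.
have [d1 d10 near1] := one_sub_cos_near0.
(* The constant of layer for c = 8^-1, as provided by one_sub_cos_near0. *)
pose A : R := 2 + 8 / 8^-1.
have A0 : 0 < A by rewrite /A; lra.
have [d2 d20 avg] := ha (e / (4 * A)) ltac:(by rewrite divr_gt0// mulr_gt0).
have [d0 d00 [d01 d02]] : exists2 d0 : R, 0 < d0 & d0 <= d1 /\ d0 <= d2.
  by exists (Num.min d1 d2); rewrite ?lt_min ?d10// !ge_min !lexx orbT.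
have [eta eta0 far] : exists2 eta : R, 0 < eta & forall t, arc t -> d0 / 2 <= `|x - t| ->
    eta <= 1 - cos (x - t).
  by apply: one_sub_cos_far => //; rewrite divr_gt0.
pose M := fine (\int[leb]_(t in arc) (h t)%:E).
have M0 : 0 <= M by rewrite fine_ge0// integral_ge0// => t _; rewrite lee_fin.
have ME : (\int[leb]_(t in arc) (h t)%:E)%E = M%:E.
  by rewrite fineK// ge0_fin_numE// integral_ge0// => t _; rewrite lee_fin.
(* The last bound makes the part far from x, at most 2 (1 - r) M / eta, less
   than e / 2. *)
pose d := Num.min (Num.min d0 2^-1) (eta * e / (4 * (M + 1))).
have d_gt0 : 0 < d.
  by rewrite !lt_min d00 invr_gt0 ltr0n/= divr_gt0 ?mulr_gt0// ltr_wpDl.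
exists d => // r /andP[dr r1].
have : 1 - r < d by lra.
rewrite !lt_min => /andP[/andP[rd0 r2] rM].
have {}r2 : 2^-1 <= r < 1 by apply/andP; split => //; lra.
have r0 : 0 < 1 - r by lra.
have r01 : 0 <= r < 1 by lra.
(* The largest ball of the dyadic family has radius between d0 / 2 and d0. *)
have [K K1 K2] : exists2 K, 2 ^+ K * (1 - r) <= d0 & d0 < 2 ^+ K.+1 * (1 - r).
  have ex : exists k, d0 < 2 ^+ k * (1 - r).
    exists (Num.bound (d0 / (1 - r))); rewrite -ltr_pdivrMr//.
    rewrite (lt_le_trans (archi_boundP (divr_ge0 (ltW d00) (ltW r0))))//.
    by rewrite -natrX ler_nat ltnW// ltn_expl.
  case: (ex_minnP ex) => -[|K] dK Kmin.
    by move: dK; rewrite expr0 mul1r ltNge (ltW rd0).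
  by exists K => //; rewrite leNgt; apply/negP => /Kmin; rewrite ltnn.
pose a k : R := A * 4^-1 ^+ k / (1 - r).
have a0 k : 0 <= a k by rewrite !mulr_ge0 ?invr_ge0 ?exprn_ge0 ?invr_ge0 ?(ltW A0) ?(ltW r0).
pose B k := ball x (2 ^+ k * (1 - r)) : set R.
have mB k : measurable (B k : set angle) by exact: measurable_ball.
have marc : measurable arc by exact: measurable_itv.
have hB0 k t : 0 <= \1_(B k) t * h t by rewrite indicE mulr_ge0.
have aB0 k t : 0 <= a k * (\1_(B k) t * h t) by exact: mulr_ge0 (a0 k) (hB0 k t).
have pw t : arc t -> poisson r (x - t) * h t <=
    \sum_(k < K.+1) a k * (\1_(B k) t * h t) + 2 / eta * (1 - r) * h t.
  move=> at_; have sum0 : 0 <= \sum_(k < K.+1) a k * (\1_(B k) t * h t).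
    exact: sumr_ge0.
  have [xt|xt] := ltP `|x - t| (2 ^+ K * (1 - r)).
    rewrite ler_wpDr ?mulr_ge0 ?invr_ge0 ?(ltW eta0) ?(ltW r0)//.
    have -> : \sum_(k < K.+1) a k * (\1_(B k) t * h t) = (\sum_(k < K.+1) layer 8^-1 r (x - t) k) * h t.
      by rewrite big_distrl/=; apply: eq_bigr => k _; rewrite layer_ball mulrA.
    rewrite ler_wpM2r// poisson_layers// near1// (lt_le_trans xt)// (le_trans K1)//.
  rewrite ler_wpDl// ler_wpM2r// [2 / eta * _]mulrAC poisson_le// ler_wpDl ?sqr_ge0//.
  rewrite far// (le_trans _ xt)//; move: K2; rewrite exprS; lra.
have mhB k : measurable_fun setT (fun t : angle => \1_(B k) t * h t).
  by apply: measurable_funM => //; exact: measurable_indic.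
apply: (@le_trans _ _ (\int[leb]_(t in arc) (\sum_(k < K.+1) (a k)%:E * (\1_(B k) t * h t)%:E +
    (2 / eta * (1 - r))%:E * (h t)%:E))%E).
  apply: ge0_le_integral => //=.
  - by move=> t _; rewrite lee_fin mulr_ge0// poisson_ge0.
  - apply/measurable_EFinP; apply: measurable_funTS; apply: measurable_funM => //.
    exact: poisson_measurable.
  - apply: emeasurable_funD; first apply: emeasurable_sum => k.
      by apply: measurable_funeM; apply/measurable_EFinP; exact: measurable_funTS.
    by apply: measurable_funeM; apply/measurable_EFinP; exact: measurable_funTS.
  - by move=> t /pw; rewrite -lee_fin EFinD -sumEFin.
rewrite ge0_integralD//=; first last.
- by apply: measurable_funeM; apply/measurable_EFinP; exact: measurable_funTS.
- by move=> t _; rewrite lee_fin mulr_ge0// !mulr_ge0 ?invr_ge0 ?(ltW eta0) ?(ltW r0).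
- apply: emeasurable_sum => k.
  by apply: measurable_funeM; apply/measurable_EFinP; exact: measurable_funTS.
- by move=> t _; apply: sume_ge0 => k _; rewrite lee_fin.
rewrite ge0_integral_sum//; first last.
- by move=> k t _; rewrite lee_fin.
- by move=> k; apply: measurable_funeM; apply/measurable_EFinP; exact: measurable_funTS.
rewrite [X in (_ + X)%E]ge0_integralZl_EFin//; first last.
- by rewrite !mulr_ge0 ?invr_ge0 ?(ltW eta0) ?(ltW r0).
- by apply/measurable_EFinP; exact: measurable_funTS.
- by move=> t _; rewrite lee_fin.
rewrite ME (_ : e = e / 2 + e / 2); last by field.
rewrite EFinD leeD//; last first.
  rewrite lee_fin; move: rM; rewrite ltr_pdivlMr; last by rewrite mulr_gt0// ltr_wpDl.
  move=> rM; rewrite (_ : 2 / eta * _ * M = 2 * (1 - r) * M / eta); last by ring.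
  rewrite ler_pdivrMr//; nra.
have term k : (k < K.+1)%N -> (\int[leb]_(t in arc) ((a k)%:E * (\1_(B k) t * h t)%:E) <=
    (e / 4 * 2^-1 ^+ k)%:E)%E.
  move=> kK; rewrite ge0_integralZl_EFin//; first last.
  - by apply/measurable_EFinP; exact: measurable_funTS.
  - by move=> t _; rewrite lee_fin.
  rewrite (_ : (\int[leb]_(t in arc) _)%E = (\int[leb]_(t in arc `&` B k) (h t)%:E)%E); last first.
    rewrite integral_mkcondr; apply: eq_integral => t _.
    by rewrite patchE indicE; case: ifPn => _; rewrite ?mul1r ?mul0r.
  apply: (@le_trans _ _ ((a k)%:E * (2 ^+ k * (1 - r) * (e / (4 * A)))%:E)%E).
    rewrite lee_wpmul2l ?lee_fin//; apply: avg.
    rewrite mulr_gt0 ?exprn_gt0//= (le_trans _ (le_trans K1 d02))//.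
    by rewrite ler_wpM2r ?(ltW r0)// ler_weXn2l ?ler1n.
  rewrite -EFinM lee_fin /a (_ : 4^-1 = 2^-1 * 2^-1 :> R); last by field.
  rewrite exprMn exprVn; have : 2 ^+ k != 0 :> R by rewrite expf_neq0.
  move: (2 ^+ k) => y y0; rewrite le_eqVlt; apply/orP; left; apply/eqP; field.
  by rewrite y0 !gt_eqF.
apply: (@le_trans _ _ (\sum_(k < K.+1) (e / 4 * 2^-1 ^+ k)%:E)%E).
  by apply: lee_sum => k _; apply: term.
rewrite sumEFin lee_fin -big_distrr/=.
rewrite (_ : e / 2 = e / 4 * 2); last by field.
by rewrite ler_wpM2l ?divr_ge0 ?(ltW e0)// geometric_half_le2.
Qed.

Lemma circle_integrable_arc (f : angle -> R) : measurable_fun setT f ->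
  mu.-integrable setT (EFin \o f) <-> leb.-integrable arc (EFin \o f).
Proof.
move=> mf; have mnf : measurable_fun setT (fun t : angle => `|(f t)%:E|%E).
  by apply: measurableT_comp => //; exact/measurable_EFinP.
have k0 : (0 < (2 * pi)^-1%:E :> \bar R)%E by rewrite lte_fin invr_gt0 twopi_gt0.
split=> /integrableP[_ foo]; apply/integrableP; split.
- by apply: measurable_funTS; exact/measurable_EFinP.
- move: foo; rewrite ge0_circle_integralE//.
  by rewrite lte_pdivrMl ?twopi_gt0// gt0_muley// lte_fin twopi_gt0.
- exact/measurable_EFinP.
- by rewrite ge0_circle_integralE// lte_mul_pinfty// ltW.
Qed.

(** Almost every point is a Lebesgue point, and there the averages of the deviation
    |f t - f x| over small balls are small, as poisson_average requires. *)
Lemma poisson_lebesgue (f : angle -> R) : mu.-integrable setT (EFin \o f) ->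
  {ae mu, forall x : angle, forall e, 0 < e -> exists2 d, 0 < d & forall r, 1 - d < r < 1 ->
    (\int[mu]_t (poisson r (x - t) * `|f t - f x|)%:E <= e%:E)%E}.
Proof.
move=> intf; have mf : measurable_fun setT f.
  by apply/measurable_EFinP; exact: (measurable_int mu).
have mlf : leb.-integrable arc (EFin \o f) by apply/circle_integrable_arc.
have := lebesgue_differentiation (integrable_locally_restrict (measurable_itv _) mlf).
move/circle_ae; apply: filterS2 circle_ae_arc => x x02 Lx e e0.
have arcx : arc x by rewrite /= in_itv/=; case/andP: x02 => /ltW -> /ltW ->.
have mh : measurable_fun setT (fun t : angle => `|f t - f x|).
  by apply: measurableT_comp => //; exact: measurable_funB.
have e1 : 0 < 2 * pi * e by rewrite mulr_gt0// twopi_gt0.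
have [||c c0|d d0 H] := poisson_average x02 mh _ _ _ e1.
- by move=> t; rewrite normr_ge0.
- have /integrableP[_] : leb.-integrable arc (EFin \o (fun t => `|f t - f x|)).
    apply: integrable_norm; rewrite (_ : _ \o _ = ((EFin \o f) \- cst (f x)%:E)%E)//.
    apply: integrableB => //.
    apply/integrableP; split; first exact: measurable_cst.
    rewrite integral_cst//=.
    by rewrite lebesgue_measure_itv/= lte_fin twopi_gt0 -EFinB -EFinM ltry.
  by under eq_integral do rewrite /= normr_id.
- have c2 : 0 < c / 2 by rewrite divr_gt0.
  have /fine_cvgP[fin /cvgrPdist_lt/(_ _ c2) near0] := Lx.
  have [d/= d0 H] := filterI fin near0.
  exists (d / 2) => [|rho /andP[rho0 rhod]]; first by rewrite divr_gt0.
  have [] := H rho.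
  - by rewrite /ball_/= sub0r normrN gtr0_norm//; lra.
  - exact: rho0.
  move=> /= fin_rho; rewrite sub0r normrN => /ltr_normlW.
  rewrite -lte_fin fineK// /davg /iavg lebesgue_measure_ball ?(ltW rho0)//.
  rewrite inver gt_eqF ?mulrn_wgt0// lte_pdivrMl ?mulrn_wgt0//.
  rewrite -EFinM (_ : rho *+ 2 * (c / 2) = rho * c); last by rewrite -mulr_natr; field.
  move=> /ltW; apply: le_trans.
  apply: (@le_trans _ _ (\int[leb]_(y in arc `&` ball x rho) `|((center ((f \_ arc) x) \o (f \_ arc)) y)%:E|)%E).
    rewrite le_eqVlt; apply/orP; left; apply/eqP/eq_integral => t.
    by rewrite inE => -[at_ _]; rewrite /= !patchE !mem_set.
  apply: ge0_subset_integral => //.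
  - by apply: measurableI; [exact: measurable_itv|exact: measurable_ball].
  - exact: measurable_ball.
  - apply: measurableT_comp => //; apply/measurable_EFinP; apply: measurable_funTS.
    apply: measurable_funB => //; apply/(measurable_restrictT _ _).1 => //.
    exact: measurable_funTS.
exists (Num.min d 1) => [|r /andP[dr r1]]; first by rewrite lt_min d0 ltr01.
have r0 : 0 <= r < 1.
  rewrite r1 andbT; have : 1 - r < Num.min d 1 by lra.
  by rewrite lt_min; lra.
rewrite ge0_circle_integralE//; first last.
- by move=> t; rewrite lee_fin mulr_ge0// poisson_ge0.
- by apply/measurable_EFinP; apply: measurable_funM => //; exact: poisson_measurable.
rewrite lee_pdivrMl ?twopi_gt0// H// r1 andbT (le_lt_trans _ dr)// lerD2l lerN2.
by rewrite ge_min lexx.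
Qed.
End Poisson.

(** * Complex functions on the circle and their integrals *)

Section ComplexIntegrals.
Variable R : realType.
Local Notation C := (R[i]).
Local Notation angle := (measurableTypeR R).
Local Notation mu := (circle_measure R).
Local Notation nc := (@Normc.normc R).
Local Notation Re := (@complex.Re R).
Local Notation Im := (@complex.Im R).

Lemma normc_ge0 (z : C) : 0 <= nc z.
Proof. by case: z => a b; exact: sqrtr_ge0. Qed.

Lemma sqr_normcE (z : C) : nc z ^+ 2 = Re z ^+ 2 + Im z ^+ 2.
Proof. by case: z => a b /=; rewrite sqr_sqrtr// addr_ge0 ?sqr_ge0. Qed.

(** The norm of R[i] has its values in R[i]; estimates are made with the real-valued
    modulus instead. *)
Lemma normr_normc (z : C) : `|z| = (nc z)%:C%C.
Proof. by []. Qed.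

Lemma ler_Re_normc (z : C) : `|Re z| <= nc z.
Proof. by rewrite -[leRHS]ger0_norm ?normc_ge0// -ler_sqr ?nnegrE// !real_normK ?num_real// sqr_normcE lerDl sqr_ge0. Qed.

Lemma ler_Im_normc (z : C) : `|Im z| <= nc z.
Proof. by rewrite -[leRHS]ger0_norm ?normc_ge0// -ler_sqr ?nnegrE// !real_normK ?num_real// sqr_normcE lerDr sqr_ge0. Qed.

Lemma normc_le_ReIm (z : C) : nc z <= `|Re z| + `|Im z|.
Proof.
rewrite -ler_sqr ?nnegrE ?normc_ge0 ?addr_ge0// sqr_normcE sqrrD !real_normK ?num_real//.
by rewrite addrAC lerDl mulrn_wge0// mulr_ge0.
Qed.

Lemma normcX (z : C) n : nc (z ^+ n) = nc z ^+ n.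
Proof. by elim: n => [|n ih]; rewrite ?expr0 ?Normc.normc1// !exprS Normc.normcM ih. Qed.

Lemma normc_conj (z : C) : nc (conjC z) = nc z.
Proof. by case: z => a b /=; rewrite sqrrN. Qed.

Lemma normc_real (r : R) : nc r%:C%C = `|r|.
Proof. by rewrite /= expr0n addr0 sqrtr_sqr. Qed.

Lemma normc_eq0 (z : C) : (nc z == 0) = (z == 0).
Proof.
apply/eqP/eqP => [/Normc.eq0_normc//|->]; exact: Normc.normc0.
Qed.

Lemma ler_normcB (z w : C) : nc (z - w) <= nc z + nc w.
Proof. by rewrite (le_trans (le_normcD _ _))// (normcN w). Qed.

Lemma distcC (z w : C) : nc (z - w) = nc (w - z).
Proof. by rewrite -(normcN (z - w)) opprB. Qed.

Lemma normc_sum I (s : seq I) (P : pred I) (F : I -> C) :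
  nc (\sum_(i <- s | P i) F i) <= \sum_(i <- s | P i) nc (F i).
Proof.
elim/big_ind2 : _ => //; first by rewrite Normc.normc0.
by move=> ? ? ? ? h1 h2; rewrite (le_trans (le_normcD _ _))// lerD.
Qed.

Lemma mul_conj_normc (z : C) : z * conjC z = ((nc z) ^+ 2)%:C%C.
Proof. by rewrite -normCK normr_normc rmorphXn. Qed.

Lemma circle_exp0 (t : angle) : circle_exp 0 t = 1.
Proof. by apply/eqP; rewrite eq_complex/= mul0r cos0 sin0 !eqxx. Qed.

Lemma circle_expN n (t : angle) : circle_exp (- n) t = conjC (circle_exp n t).
Proof.
by apply/eqP; rewrite eq_complex/= mulrNz mulNr cosN sinN !eqxx.
Qed.

Lemma normc_circle_exp n (t : angle) : nc (circle_exp n t) = 1.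
Proof. by rewrite /= cos2Dsin2 sqrtr1. Qed.

Lemma circle_expX n (t : angle) : circle_exp n%:Z t = circle_exp 1 t ^+ n.
Proof.
elim: n => [|n ih]; first by rewrite circle_exp0.
by rewrite exprS -ih -circle_expD -intS.
Qed.

Definition cmeasurable (f : angle -> C) :=
  measurable_fun setT (fun t => Re (f t)) /\ measurable_fun setT (fun t => Im (f t)).

Lemma cmeasurable_cst z : cmeasurable (fun=> z).
Proof. by split; exact: measurable_cst. Qed.

Lemma cmeasurableD f g : cmeasurable f -> cmeasurable g ->
  cmeasurable (fun t => f t + g t).
Proof.
move=> [rf jf] [rg jg]; split.
  rewrite (_ : (fun t => _) = (fun t => Re (f t) + Re (g t))); first exact: measurable_funD.
  by apply/funext => t; case: (f t) (g t) => ? ? [].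
rewrite (_ : (fun t => _) = (fun t => Im (f t) + Im (g t))); first exact: measurable_funD.
by apply/funext => t; case: (f t) (g t) => ? ? [].
Qed.

Lemma cmeasurableM f g : cmeasurable f -> cmeasurable g ->
  cmeasurable (fun t => f t * g t).
Proof.
move=> [rf jf] [rg jg]; split.
  rewrite (_ : (fun t => _) = (fun t => Re (f t) * Re (g t) - Im (f t) * Im (g t))).
    by apply: measurable_funB; exact: measurable_funM.
  by apply/funext => t; case: (f t) (g t) => ? ? [].
rewrite (_ : (fun t => _) = (fun t => Re (f t) * Im (g t) + Im (f t) * Re (g t))).
  by apply: measurable_funD; exact: measurable_funM.
by apply/funext => t; case: (f t) (g t) => ? ? [].
Qed.

Lemma cmeasurableB f g : cmeasurable f -> cmeasurable g ->
  cmeasurable (fun t => f t - g t).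
Proof.
move=> mf mg; rewrite (_ : (fun t => _) = fun t => f t + -1 * g t).
  by apply: cmeasurableD => //; apply: cmeasurableM => //; exact: cmeasurable_cst.
by apply/funext => t; rewrite mulN1r.
Qed.

Lemma cmeasurable_conj f : cmeasurable f -> cmeasurable (fun t => conjC (f t)).
Proof.
move=> [rf jf]; split.
  by rewrite (_ : (fun t => _) = (fun t => Re (f t)))//; apply/funext => t; case: (f t).
rewrite (_ : (fun t => _) = (fun t => - Im (f t))); first exact: measurable_funN.
by apply/funext => t; case: (f t).
Qed.

Lemma measurable_normc f : cmeasurable f -> measurable_fun setT (fun t => nc (f t)).
Proof.
move=> [rf jf]; rewrite (_ : (fun t => _) = (fun t => (Re (f t) ^+ 2 + Im (f t) ^+ 2) `^ 2^-1)).
  apply: (measurableT_comp (measurable_powR _)).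
  by apply: measurable_funD; exact: measurable_funX.
by apply/funext => t; case: (f t) => a b /=; rewrite powR12_sqrt// addr_ge0 ?sqr_ge0.
Qed.

Lemma cmeasurableV f : cmeasurable f -> cmeasurable (fun t => (f t)^-1).
Proof.
move=> mf; have [rf jf] := mf.
pose q t := (nc (f t) ^+ 2) `^ (-1).
have mq : measurable_fun setT q.
  apply: (measurableT_comp (measurable_powR _)); apply: measurable_funX.
  exact: measurable_normc.
have qE t : q t = (Re (f t) ^+ 2 + Im (f t) ^+ 2)^-1.
  by rewrite /q powR_inv1 ?sqr_ge0// sqr_normcE.
split.
  rewrite (_ : (fun t => _) = (fun t => Re (f t) * q t)); first exact: measurable_funM.
  by apply/funext => t; rewrite qE; case: (f t).
rewrite (_ : (fun t => _) = (fun t => (- Im (f t)) * q t)).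
  by apply: measurable_funM => //; exact: measurable_funN.
by apply/funext => t; rewrite qE; case: (f t) => a b /=; rewrite mulNr.
Qed.

Lemma circle_L2P (f : angle -> C) : f \in circle_Lfun 2%:E <->
  cmeasurable f /\ mu.-integrable setT (fun t => (nc (f t) ^+ 2)%:E).
Proof.
have sqrL (g : angle -> R) : measurable_fun setT g ->
    mu.-integrable setT (fun t => (g t ^+ 2)%:E) -> g \in Lfun mu 2%:E.
  move=> mg /integrableP[_ goo]; rewrite inE; apply/andP; split; rewrite inE//=.
  rewrite /finite_norm unlock poweR_lty// (le_lt_trans _ goo)//.
  rewrite le_eqVlt; apply/orP; left; apply/eqP/eq_integral => t _ /=.
  by rewrite powR_mulrn// real_normK ?num_real// ger0_norm ?sqr_ge0.
split=> [/circle_LfunP[rf jf]|[mf ff]].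
  have mf : cmeasurable f.
    by split; [move: rf|move: jf]; rewrite inE => /andP[/[!inE]].
  split => //; rewrite (_ : (fun t => _) = ((EFin \o (fun t => Re (f t) ^+ 2)%R) \+
    (EFin \o (fun t => Im (f t) ^+ 2)%R))%E); last by apply/funext => t /=; rewrite sqr_normcE.
  by apply: integrableD => //; exact: Lfun2_integrable_sqr.
have [rf jf] := mf.
apply/circle_LfunP; split; apply: sqrL => //; apply: le_integrable ff => //.
- by apply/measurable_EFinP; exact: measurable_funX.
- by move=> t _; rewrite /= lee_fin !ger0_norm ?sqr_ge0// sqr_normcE lerDl sqr_ge0.
- by apply/measurable_EFinP; exact: measurable_funX.
- by move=> t _; rewrite /= lee_fin !ger0_norm ?sqr_ge0// sqr_normcE lerDr sqr_ge0.
Qed.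

Lemma circle_L1P (f : angle -> C) : f \in circle_Lfun 1%E <->
  cmeasurable f /\ mu.-integrable setT (fun t => (nc (f t))%:E).
Proof.
split=> [/circle_LfunP[/Lfun1_integrable rf /Lfun1_integrable jf]|[mf ff]].
  have mf : cmeasurable f.
    by split; apply/measurable_EFinP; [exact: measurable_int rf|exact: measurable_int jf].
  split => //; apply: (@le_integrable _ _ _ _ _ _ _
      ((abse \o (EFin \o (fun t => Re (f t)))) \+ (abse \o (EFin \o (fun t => Im (f t)))))%E) => //.
  - by apply/measurable_EFinP; exact: measurable_normc.
  - move=> t _; rewrite /= lee_fin ger0_norm ?normc_ge0// [leRHS]ger0_norm ?addr_ge0//.
    exact: normc_le_ReIm.
  - by apply: integrableD => //; exact: integrable_abse.
have [rf jf] := mf.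
apply/circle_LfunP; split; apply/Lfun1_integrable; apply: le_integrable ff => //.
- exact/measurable_EFinP.
- by move=> t _; rewrite /= lee_fin [leRHS]ger0_norm ?normc_ge0// ler_Re_normc.
- exact/measurable_EFinP.
- by move=> t _; rewrite /= lee_fin [leRHS]ger0_norm ?normc_ge0// ler_Im_normc.
Qed.

Lemma circle_LinftyP (f : angle -> C) : f \in circle_Lfun +oo%E <->
  cmeasurable f /\ exists M, {ae mu, forall t, nc (f t) <= M}.
Proof.
have mu1 : (0 < mu setT)%E by rewrite circle_measure_setT.
have bndP (g : angle -> R) : g \in Lfun mu +oo%E <->
    measurable_fun setT g /\ exists M, {ae mu, forall t, `|g t| <= M}.
  split.
    rewrite inE => /andP[/[!inE]/= mg]; rewrite /finite_norm unlock/= mu1.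
    by move=> /ess_sup_inf.ess_supr_bounded[M gM]; split => //; exists M; apply: filterS gM => t; rewrite /= ?normr_id.
  move=> [mg [M gM]]; rewrite inE; apply/andP; split; rewrite inE//=.
  rewrite /finite_norm unlock/= mu1 (@le_lt_trans _ _ M%:E) ?ltry//.
  apply/ess_sup_inf.ess_supP; apply: filterS gM => t /=; rewrite lee_fin ?normr_id//.
split=> [/circle_LfunP[/bndP[rf [M1 fM1]] /bndP[jf [M2 fM2]]]|[[rf jf] [M fM]]].
  split => //; exists (M1 + M2); apply: filterS2 fM1 fM2 => t h1 h2.
  by rewrite (le_trans (normc_le_ReIm _))// lerD.
apply/circle_LfunP; split; apply/bndP; split => //; exists M.
  by apply: filterS fM => t; apply: le_trans; exact: ler_Re_normc.
by apply: filterS fM => t; apply: le_trans; exact: ler_Im_normc.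
Qed.

Lemma integrable_ae_le (h g : angle -> R) : measurable_fun setT h ->
  mu.-integrable setT (EFin \o g) -> {ae mu, forall t, `|h t| <= g t} ->
  mu.-integrable setT (EFin \o h).
Proof.
move=> mh ig hg; apply/integrableP; split; first exact/measurable_EFinP.
have /integrableP[mg] := ig; apply: le_lt_trans.
apply: ae_ge0_le_integral => //.
- by apply: measurableT_comp => //; exact/measurable_EFinP.
- exact: measurableT_comp.
- by apply: filterS hg => t h1 _; rewrite /= lee_fin (le_trans h1)// ler_norm.
Qed.

Lemma circle_L1_ae_le (h : angle -> C) (g : angle -> R) : cmeasurable h ->
  mu.-integrable setT (EFin \o g) -> {ae mu, forall t, nc (h t) <= g t} ->
  h \in circle_Lfun 1%E.
Proof.
move=> mh ig hg; apply/circle_L1P; split => //.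
apply: (integrable_ae_le _ ig); first exact: measurable_normc.
by apply: filterS hg => t; rewrite ger0_norm ?normc_ge0.
Qed.

Lemma circle_L2_ae_le (h f : angle -> C) M : cmeasurable h ->
  f \in circle_Lfun 2%:E -> {ae mu, forall t, nc (h t) <= M * nc (f t)} ->
  h \in circle_Lfun 2%:E.
Proof.
move=> mh /circle_L2P[mf if2] hg; apply/circle_L2P; split => //.
apply: (@integrable_ae_le (fun t => nc (h t) ^+ 2) (fun t => M ^+ 2 * nc (f t) ^+ 2)).
- by apply: measurable_funX; exact: measurable_normc.
- exact: (integrableZl measurableT (M ^+ 2) if2).
- apply: filterS hg => t h1; rewrite ger0_norm ?sqr_ge0// -exprMn ler_sqr ?nnegrE ?normc_ge0//.
  by rewrite (le_trans (normc_ge0 _) h1).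
Qed.

Lemma circle_exp_measurable n : cmeasurable (circle_exp n).
Proof. by have /circle_L2P[] := circle_exp_L2 R n. Qed.

Lemma bounded_circle_L2 (f : angle -> C) M : cmeasurable f -> {ae mu, forall t, nc (f t) <= M} ->
  f \in circle_Lfun 2%:E.
Proof.
move=> mf fM; apply: (@circle_L2_ae_le _ _ M _ (circle_exp_L2 R 0)) => //.
by apply: filterS fM => t; rewrite normc_circle_exp mulr1.
Qed.

Lemma circle_L2_L1 (f : angle -> C) : f \in circle_Lfun 2%:E -> f \in circle_Lfun 1%E.
Proof.
move=> f2; rewrite (_ : f = fun t => f t * circle_exp 0 t).
  by apply: circle_Lfun_mul => //; exact: circle_exp_L2.
by apply/funext => t; rewrite circle_exp0 mulr1.
Qed.

Lemma bounded_circle_L1 (f : angle -> C) M : cmeasurable f -> {ae mu, forall t, nc (f t) <= M} ->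
  f \in circle_Lfun 1%E.
Proof. by move=> mf fM; apply: circle_L2_L1; exact: (bounded_circle_L2 mf fM). Qed.

Lemma circle_L1_mul_bounded (f g : angle -> C) M : f \in circle_Lfun 1%E -> cmeasurable g ->
  {ae mu, forall t, nc (g t) <= M} -> (fun t => f t * g t) \in circle_Lfun 1%E.
Proof.
move=> /circle_L1P[mf if1] mg gM.
apply: (@circle_L1_ae_le _ (fun t => M * nc (f t))).
- exact: cmeasurableM.
- exact: (integrableZl measurableT M if1).
- by apply: filterS gM => t h; rewrite Normc.normcM mulrC ler_wpM2r// normc_ge0.
Qed.

Lemma circle_L2_mul_bounded (f g : angle -> C) M : f \in circle_Lfun 2%:E -> cmeasurable g ->
  {ae mu, forall t, nc (g t) <= M} -> (fun t => f t * g t) \in circle_Lfun 2%:E.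
Proof.
move=> f2 mg gM; have /circle_L2P[mf _] := f2.
apply: (@circle_L2_ae_le _ f M) => //; first exact: cmeasurableM.
by apply: filterS gM => t h; rewrite Normc.normcM mulrC ler_wpM2r// normc_ge0.
Qed.

Lemma circle_L1D (f g : angle -> C) : f \in circle_Lfun 1%E -> g \in circle_Lfun 1%E ->
  (fun t => f t + g t) \in circle_Lfun 1%E.
Proof.
move=> f1 g1; have [_ H] := @circle_Lfun_submod_closed R _ (@lexx _ _ 1%E).
by have := H 1 f g f1 g1; rewrite scale1r.
Qed.

Lemma circle_L1Z (a : C) (f : angle -> C) : f \in circle_Lfun 1%E -> (fun t => a * f t) \in circle_Lfun 1%E.
Proof.
move=> f1; have [H0 H] := @circle_Lfun_submod_closed R _ (@lexx _ _ 1%E).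
by have := H a f 0 f1 H0; rewrite addr0.
Qed.

Lemma circle_L1B (f g : angle -> C) : f \in circle_Lfun 1%E -> g \in circle_Lfun 1%E ->
  (fun t => f t - g t) \in circle_Lfun 1%E.
Proof.
move=> f1 g1; rewrite (_ : (fun t => _) = fun t => f t + (-1) * g t).
  by apply: circle_L1D => //; exact: circle_L1Z.
by apply/funext => t; rewrite mulN1r.
Qed.

Lemma circle_intB (f g : angle -> C) : f \in circle_Lfun 1%E -> g \in circle_Lfun 1%E ->
  circle_int (fun t => f t - g t) = circle_int f - circle_int g.
Proof.
move=> f1 g1; rewrite (_ : (fun t => _) = fun t => f t + (-1) * g t).
  by rewrite circle_intD ?circle_intZ ?mulN1r//; exact: circle_L1Z.
by apply/funext => t; rewrite mulN1r.
Qed.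

Lemma circle_L1_sum n (f : 'I_n -> angle -> C) :
  (forall i, f i \in circle_Lfun 1%E) -> (fun t => \sum_(i < n) f i t) \in circle_Lfun 1%E.
Proof.
elim: n f => [|n ih] f f1.
  rewrite (_ : (fun t => _) = fun t => 0 * circle_exp 0 t).
    by apply: circle_L1Z; apply: circle_L2_L1; exact: circle_exp_L2.
  by apply/funext => t; rewrite big_ord0 mul0r.
rewrite (_ : (fun t => _) = fun t => \sum_(i < n) f (widen_ord (leqnSn n) i) t + f ord_max t).
  by apply: circle_L1D => //; apply: ih.
by apply/funext => t; rewrite big_ord_recr.
Qed.

Lemma circle_int_sum n (f : 'I_n -> angle -> C) :
  (forall i, f i \in circle_Lfun 1%E) ->
  circle_int (fun t => \sum_(i < n) f i t) = \sum_(i < n) circle_int (f i).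
Proof.
elim: n f => [|n ih] f f1.
  rewrite big_ord0 (_ : (fun t => _) = fun t => 0 * circle_exp 0 t).
    by rewrite circle_intZ ?mul0r//; apply: circle_L2_L1; exact: circle_exp_L2.
  by apply/funext => t; rewrite big_ord0 mul0r.
rewrite (_ : (fun t => _) = fun t => \sum_(i < n) f (widen_ord (leqnSn n) i) t + f ord_max t).
  by rewrite circle_intD ?ih ?big_ord_recr//; exact: circle_L1_sum.
by apply/funext => t; rewrite big_ord_recr.
Qed.

Lemma circle_int_cst (z : C) : circle_int (fun=> z : C) = z.
Proof.
rewrite /circle_int !Rintegral_cst// circle_measure_setT/= !mulr1.
by case: z.
Qed.

(** Rotating the integral onto the positive half-line reduces the triangle
    inequality to the comparison of a real part with a modulus. *)
Lemma normc_circle_int (f : angle -> C) : f \in circle_Lfun 1%E ->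
  nc (circle_int f) <= \int[mu]_t nc (f t).
Proof.
move=> f1; have /circle_L1P[mf if1] := f1.
have [->|z0] := eqVneq (circle_int f) 0.
  by rewrite Normc.normc0 Rintegral_ge0// => t _; exact: normc_ge0.
set z := circle_int f in z0 *; have nz0 : nc z != 0 by rewrite normc_eq0.
pose a : C := conjC z / (nc z)%:C%C.
have na : nc a = 1.
  by rewrite Normc.normcM normc_conj Normc.normcV normc_real ger0_norm ?normc_ge0// divff.
have az : a * z = (nc z)%:C%C.
  rewrite /a mulrAC [conjC z * z]mulrC mul_conj_normc rmorphXn/= expr2 mulfK//.
  by rewrite fmorph_eq0.
have -> : nc z = Re (circle_int (fun t => a * f t)) by rewrite circle_intZ// az.
have /circle_LfunP[/Lfun1_integrable raf _] := circle_L1Z a f1.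
apply: le_Rintegral => // t _; apply: le_trans (ler_norm _) _.
by rewrite (le_trans (ler_Re_normc _))// Normc.normcM na mul1r.
Qed.

Lemma normc_circle_int_le (f : angle -> C) M : 0 <= M -> f \in circle_Lfun 1%E ->
  {ae mu, forall t, nc (f t) <= M} -> nc (circle_int f) <= M.
Proof.
move=> M0 f1 fM; have /circle_L1P[mf if1] := f1.
apply: (le_trans (normc_circle_int f1)).
have cM : (\int[mu]_t M%:E = M%:E)%E by rewrite integral_cst// circle_measure_setT mule1.
rewrite -lee_fin -cM fineK; last exact: (integrable_fin_num measurableT if1).
have mM := measurable_normc mf.
apply: ae_ge0_le_integral => //.
- by move=> t _; rewrite lee_fin normc_ge0.
- exact/measurable_EFinP.
- by apply: filterS fM => t h _; rewrite lee_fin.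
Qed.

Lemma circle_int_dominated (f_ : nat -> angle -> C) f (g : angle -> R) :
  (forall n, cmeasurable (f_ n)) -> cmeasurable f ->
  mu.-integrable setT (EFin \o g) ->
  {ae mu, forall t, forall n, nc (f_ n t) <= g t} ->
  {ae mu, forall t, nc (f_ n t - f t) @[n --> \oo] --> 0} ->
  f \in circle_Lfun 1%E /\
  nc (circle_int (f_ n) - circle_int f) @[n --> \oo] --> 0.
Proof.
move=> mf_ mf ig fg ff.
have fg0 : {ae mu, forall t, nc (f t) <= g t}.
  apply: filterS2 fg ff => t h1 h2; apply/ler_addgt0Pr => e e0.
  have [n _ /(_ n (leqnn n))] : \forall n \near \oo, `|0 - nc (f_ n t - f t)| < e.
    by move/cvgrPdist_lt: h2 => /(_ e e0).
  rewrite /= sub0r normrN ger0_norm ?normc_ge0// => /ltW h3.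
  have -> : f t = f_ n t - (f_ n t - f t) by rewrite subKr.
  by rewrite (le_trans (ler_normcB _ _))// lerD.
have f1 : f \in circle_Lfun 1%E by exact: circle_L1_ae_le ig fg0.
have fn1 n : f_ n \in circle_Lfun 1%E.
  by apply: circle_L1_ae_le ig _ => //; apply: filterS fg => t; exact.
split => //.
have mfB n : measurable_fun setT (fun t => nc (f_ n t - f t)).
  by apply: measurable_normc; exact: cmeasurableB.
have ifB n : mu.-integrable setT (EFin \o (fun t => nc (f_ n t - f t))).
  by have /circle_L1P[] := circle_L1B (fn1 n) f1.
have [] := @dominated_convergence _ _ _ mu setT measurableT
  (fun n t => (nc (f_ n t - f t))%:E) (cst 0%E) (fun t => (2 * g t)%:E).
- by move=> n; exact/measurable_EFinP.
- exact: measurable_cst.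
- by apply: filterS ff => t h _; apply/fine_cvgP; split; [exact: nearW|exact: h].
- exact: (integrableZl measurableT 2 ig).
- apply: filterS2 fg fg0 => t h1 h2 n _; rewrite lee_fin ger0_norm ?normc_ge0//.
  by rewrite (le_trans (ler_normcB _ _))// [2 * _]mulrDl mul1r lerD.
move=> _ _; rewrite integral0 => /fine_cvgP[_ lim0].
apply: (squeeze_cvgr _ (cvg_cst 0) lim0).
apply: nearW => n; apply/andP; split; first exact: normc_ge0.
by rewrite -circle_intB//; apply: normc_circle_int; exact: circle_L1B.
Qed.
End ComplexIntegrals.

(** * Cauchy kernel, Poisson integrals and Fatou's theorem *)

Section Kernels.
Variable R : realType.
Local Notation C := (R[i]).
Local Notation angle := (measurableTypeR R).
Local Notation mu := (circle_measure R).
Local Notation leb := (@lebesgue_measure R).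
Local Notation nc := (@Normc.normc R).
Local Notation arc := (`[0, 2 * pi]%classic : set angle).
Arguments Normc.normc : simpl never.

Lemma Rintegral_FTC (F f : R -> R) a b : a <= b ->
  (forall x, is_derive x (1 : R^o) F (f x)) -> continuous f ->
  \int[leb]_(t in `[a, b]) f t = F b - F a.
Proof.
rewrite le_eqVlt => /predU1P[-> _ _|ab dF cf].
  by rewrite set_itv1 Rintegral_set1 subrr.
have cF : continuous F by move=> x; apply: differentiable_continuous; apply/derivable1_diffP; have [] := dF x.
rewrite /Rintegral (@continuous_FTC2 _ _ F)//; first exact: continuous_subspaceT.
  split; first by move=> x _; have [] := dF x.
    exact: cvg_at_right_filter (cF a).
  exact: cvg_at_left_filter (cF b).
by move=> x _; rewrite derive1E; have [_ ->] := dF x.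
Qed.

Lemma circle_RintegralE (f : angle -> R) : mu.-integrable setT (EFin \o f) ->
  \int[mu]_t f t = (2 * pi)^-1 * \int[leb]_(t in arc) f t.
Proof.
move=> intf; have mf : measurable_fun setT f.
  by apply/measurable_EFinP; exact: (measurable_int mu).
have ilf : leb.-integrable arc (EFin \o f) by apply/circle_integrable_arc.
have mp : measurable_fun setT (EFin \o f) by exact/measurable_EFinP.
have Ep : (\int[mu]_t (EFin \o f)^\+ t = (2 * pi)^-1%:E * \int[leb]_(t in arc) (EFin \o f)^\+ t)%E.
  by apply: ge0_circle_integralE => //; exact: measurable_funepos.
have En : (\int[mu]_t (EFin \o f)^\- t = (2 * pi)^-1%:E * \int[leb]_(t in arc) (EFin \o f)^\- t)%E.
  by apply: ge0_circle_integralE => //; exact: measurable_funeneg.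
rewrite /Rintegral (integralE mu) (integralE leb) Ep En.
have marc : measurable arc by exact: measurable_itv.
have := integrable_pos_fin_num marc ilf.
have := integrable_neg_fin_num marc ilf.
case: (integral _ _ _) => // a _; case: (integral _ _ _) => // b _.
by rewrite /= mulrBr.
Qed.

Lemma circle_exp_2pi n : circle_exp n (2 * pi) = 1 :> C.
Proof.
have e1 : circle_exp 1 (2 * pi) = 1 :> C.
  by apply/eqP; rewrite eq_complex/= mul1r mulrC mulr_natr cos2pi sin2pi !eqxx.
case: n => n; first by rewrite circle_expX e1 expr1n.
by rewrite NegzE circle_expN circle_expX e1 expr1n rmorph1.
Qed.

Lemma is_derive_scaled (f : R -> R) (f' : R -> R) (k : R) :
  (forall x, is_derive x (1 : R^o) f (f' x)) ->
  forall x, is_derive x (1 : R^o) (fun t => f (k * t)) (k * f' (k * x)).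
Proof.
move=> df x; rewrite mulrC; apply: (@is_derive1_comp _ f (fun t => k * t)).
have := @is_deriveZ _ _ _ (@id R^o) k x 1 1 (@is_derive_id _ _ x 1).
by rewrite [k *: 1]mulr1.
Qed.

Lemma continuous_scaled (f : R -> R) (k : R) : continuous f -> continuous (fun t => f (k * t)).
Proof.
move=> cf x; apply: (@continuous_comp _ _ _ (fun t => k * t) f); last exact: cf.
by apply: cvgM; [exact: cvg_cst|exact: cvg_id].
Qed.

Lemma Rintegral_cos (k a b : R) : k != 0 -> a <= b ->
  \int[leb]_(t in `[a, b]) cos (k * t) = k^-1 * (sin (k * b) - sin (k * a)).
Proof.
move=> k0 ab.
have dF x : is_derive x (1 : R^o) (fun t => k^-1 *: (sin (k * t) : R^o)) (cos (k * x)).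
  have := is_derive_scaled k (@is_derive_sin R) x.
  by move/(@is_deriveZ _ _ _ _ k^-1); rewrite [_ *: _]mulKf.
rewrite (Rintegral_FTC ab dF); first by rewrite mulrBr.
by apply: continuous_scaled; exact: continuous_cos.
Qed.

Lemma Rintegral_sin (k a b : R) : k != 0 -> a <= b ->
  \int[leb]_(t in `[a, b]) sin (k * t) = k^-1 * (cos (k * a) - cos (k * b)).
Proof.
move=> k0 ab.
have dF x : is_derive x (1 : R^o) (fun t => (- k^-1) *: (cos (k * t) : R^o)) (sin (k * x)).
  have := is_derive_scaled k (@is_derive_cos R) x.
  move/(@is_deriveZ _ _ _ _ (- k^-1)).
  by rewrite [_ *: _]mulNr [k * _]mulrN mulrN opprK mulKf.
rewrite (Rintegral_FTC ab dF).
  by rewrite /GRing.scale/= !mulNr mulrBr opprK addrC.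
by apply: continuous_scaled; exact: continuous_sin.
Qed.

Lemma circle_int_exp n : circle_int (@circle_exp R n) = (n == 0)%:R.
Proof.
have [->|n0] := eqVneq n 0.
  rewrite (_ : circle_exp 0 = fun=> 1) ?circle_int_cst//.
  by apply/funext => t; rewrite circle_exp0.
have /circle_LfunP[/Lfun1_integrable rf /Lfun1_integrable jf] := circle_L2_L1 (circle_exp_L2 R n).
rewrite /circle_int !circle_RintegralE//=.
have k0 : n%:~R != 0 :> R by rewrite intr_eq0.
have tp := ltW (twopi_gt0 R).
have := circle_exp_2pi n => /eqP; rewrite eq_complex/= => /andP[/eqP c1 /eqP s1].
rewrite Rintegral_cos// Rintegral_sin// c1 s1 !mulr0 sin0 cos0 !subrr !mulr0.
by [].
Qed.

Definition cauchy_kernel (z : C) (t : angle) : C := (1 - z * circle_exp (-1) t)^-1.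

Lemma normc_cauchy_den (z : C) (t : angle) : 1 - nc z <= nc (1 - z * circle_exp (-1) t).
Proof.
rewrite lerBlDr -(@Normc.normc1 R) -{1}(subrK (z * circle_exp (-1) t) 1).
rewrite (le_trans (le_normcD _ _))// lerD2l Normc.normcM normc_circle_exp.
by rewrite mulr1.
Qed.

Lemma cauchy_den_neq0 (z : C) (t : angle) : nc z < 1 -> 1 - z * circle_exp (-1) t != 0.
Proof.
move=> z1; rewrite -normc_eq0 gt_eqF// (lt_le_trans _ (normc_cauchy_den z t))//.
by rewrite subr_gt0.
Qed.

Lemma cauchy_kernel_bound (z : C) (t : angle) : nc z < 1 ->
  nc (cauchy_kernel z t) <= (1 - nc z)^-1.
Proof.
move=> z1; rewrite Normc.normcV lef_pV2 ?posrE ?normc_cauchy_den ?subr_gt0//.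
by rewrite (lt_le_trans _ (normc_cauchy_den z t))// subr_gt0.
Qed.

Lemma cauchy_kernel_measurable (z : C) : cmeasurable (cauchy_kernel z).
Proof.
apply: cmeasurableV; apply: cmeasurableB; first exact: cmeasurable_cst.
by apply: cmeasurableM; [exact: cmeasurable_cst|exact: circle_exp_measurable].
Qed.

Lemma circle_exp_mul_cauchy (z : C) (t : angle) : nc z < 1 ->
  cauchy_kernel z t = 1 + z * circle_exp (-1) t * cauchy_kernel z t.
Proof. move=> z1; rewrite /cauchy_kernel; field; exact: cauchy_den_neq0.
Qed.

Lemma cauchy_kernel_expansion (z : C) (t : angle) N : nc z < 1 ->
  cauchy_kernel z t = \sum_(n < N) z ^+ n * circle_exp (- n%:Z) t +
    z ^+ N * circle_exp (- N%:Z) t * cauchy_kernel z t.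
Proof.
move=> z1; elim: N => [|N ih].
  by rewrite big_ord0 add0r expr0 oppr0 circle_exp0 !mul1r.
rewrite big_ord_recr/= {1}ih -addrA; congr (_ + _).
rewrite {1}(circle_exp_mul_cauchy t z1) mulrDr mulr1; congr (_ + _).
rewrite exprSr -addn1 PoszD opprD circle_expD; ring.
Qed.

Lemma circle_int_cauchy_expansion (g : angle -> C) (z : C) N :
  g \in circle_Lfun 1%E -> nc z < 1 ->
  circle_int (fun t => g t * cauchy_kernel z t) =
    \sum_(n < N) z ^+ n * circle_int (fun t => g t * circle_exp (- n%:Z) t) +
    z ^+ N * circle_int (fun t => g t * circle_exp (- N%:Z) t * cauchy_kernel z t).
Proof.
move=> g1 z1.
have ge n : (fun t => g t * circle_exp n t) \in circle_Lfun 1%E.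
  apply: (@circle_L1_mul_bounded _ _ _ 1) => //; first exact: circle_exp_measurable.
  by apply: aeW => t; rewrite normc_circle_exp.
have gek n : (fun t => g t * circle_exp n t * cauchy_kernel z t) \in circle_Lfun 1%E.
  apply: (circle_L1_mul_bounded (ge n) (cauchy_kernel_measurable z)).
  by apply: aeW => t; exact: cauchy_kernel_bound.
rewrite -circle_intZ//; under eq_bigr do rewrite -circle_intZ//.
rewrite -circle_int_sum; last by move=> i; exact: circle_L1Z.
rewrite -circle_intD; [|by apply: circle_L1_sum => i; exact: circle_L1Z|exact: circle_L1Z].
congr circle_int; apply/funext => t; rewrite {1}(cauchy_kernel_expansion t N z1).
rewrite mulrDr big_distrr/=; congr (_ + _); last by ring.
by apply: eq_bigr => i _; ring.
Qed.

Lemma cvg_exprn_normc (z : C) : nc z < 1 -> nc (z ^+ N) @[N --> \oo] --> 0.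
Proof.
move=> z1; under eq_fun do rewrite normcX.
by apply: cvg_expr; rewrite ger0_norm// normc_ge0.
Qed.

(** The remainder of the geometric expansion of the kernel tends to 0. *)
Lemma circle_int_cauchy_eq0 (g : angle -> C) (z : C) :
  g \in circle_Lfun 1%E -> nc z < 1 ->
  (forall n : nat, circle_int (fun t => g t * circle_exp (- n%:Z) t) = 0) ->
  circle_int (fun t => g t * cauchy_kernel z t) = 0.
Proof.
move=> g1 z1 g0; apply/eqP; rewrite -normc_eq0 eq_le normc_ge0 andbT.
pose M := \int[mu]_t (nc (g t) * (1 - nc z)^-1).
have le_n N : nc (circle_int (fun t => g t * cauchy_kernel z t)) <= nc (z ^+ N) * M.
  rewrite (circle_int_cauchy_expansion N g1 z1) big1 ?add0r; last by move=> i _; rewrite g0 mulr0.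
  rewrite Normc.normcM ler_wpM2l ?normc_ge0//.
  have gk1 : (fun t => g t * circle_exp (- N%:Z) t * cauchy_kernel z t) \in circle_Lfun 1%E.
    apply: (@circle_L1_mul_bounded _ _ _ (1 - nc z)^-1).
    - apply: (@circle_L1_mul_bounded _ _ _ 1) => //; first exact: circle_exp_measurable.
      by apply: aeW => t; rewrite normc_circle_exp.
    - exact: cauchy_kernel_measurable.
    - by apply: aeW => t; exact: cauchy_kernel_bound.
  apply: (le_trans (normc_circle_int gk1)); apply: le_Rintegral => //.
  - by have /circle_L1P[] := gk1.
  - have /circle_L1P[_ ig] := g1.
    rewrite (_ : _ \o _ = fun t => ((1 - nc z)^-1%:E * (nc (g t))%:E)%E); first exact: integrableZl.
    by apply/funext => t /=; rewrite mulrC.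
  - move=> t _; rewrite !Normc.normcM normc_circle_exp mulr1 ler_wpM2l ?normc_ge0//.
    exact: cauchy_kernel_bound.
have : (nc (z ^+ N) * M) @[N --> \oo] --> 0 * M.
  by apply: cvgM; [exact: cvg_exprn_normc|exact: cvg_cst].
rewrite mul0r => h; apply: (ler_cvg_to (cvg_cst _) h).
exact: nearW le_n.
Qed.

Lemma circle_L1_conj (f : angle -> C) : f \in circle_Lfun 1%E ->
  (fun t => conjC (f t)) \in circle_Lfun 1%E.
Proof. by move=> f1; apply: circle_Lfun_conj. Qed.

Lemma circle_L1_mul_exp (f : angle -> C) n : f \in circle_Lfun 1%E ->
  (fun t => f t * circle_exp n t) \in circle_Lfun 1%E.
Proof.
move=> f1; apply: (@circle_L1_mul_bounded _ _ _ 1) => //; first exact: circle_exp_measurable.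
by apply: aeW => t; rewrite normc_circle_exp.
Qed.

Lemma circle_L1_mul_cauchy (f : angle -> C) z : f \in circle_Lfun 1%E -> nc z < 1 ->
  (fun t => f t * cauchy_kernel z t) \in circle_Lfun 1%E.
Proof.
move=> f1 z1; apply: (circle_L1_mul_bounded f1 (cauchy_kernel_measurable z)).
by apply: aeW => t; exact: cauchy_kernel_bound.
Qed.

Lemma circle_L1_mul_cauchy_conj (f : angle -> C) z : f \in circle_Lfun 1%E -> nc z < 1 ->
  (fun t => f t * conjC (cauchy_kernel z t)) \in circle_Lfun 1%E.
Proof.
move=> f1 z1.
apply: (circle_L1_mul_bounded f1 (cmeasurable_conj (cauchy_kernel_measurable z))).
by apply: aeW => t; rewrite normc_conj; exact: cauchy_kernel_bound.
Qed.

Lemma circle_int_cauchy_conj_eq0 (g : angle -> C) (z : C) :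
  g \in circle_Lfun 1%E -> nc z < 1 ->
  (forall n : nat, circle_int (fun t => g t * circle_exp n%:Z t) = 0) ->
  circle_int (fun t => g t * conjC (cauchy_kernel z t)) = 0.
Proof.
move=> g1 z1 g0; apply: (can_inj conjCK); rewrite rmorph0.
rewrite -circle_int_conj; last exact: circle_L1_mul_cauchy_conj.
have := @circle_int_cauchy_eq0 (fun t => conjC (g t)) z (circle_L1_conj g1) z1.
rewrite (_ : (fun t => conjC _) = (fun t => conjC (g t) * cauchy_kernel z t)); last first.
  by apply/funext => t; rewrite rmorphM/= conjCK.
apply=> n; rewrite (_ : (fun t => _) = fun t => conjC (g t * circle_exp n t)).
  by rewrite circle_int_conj ?g0 ?rmorph0//; exact: circle_L1_mul_exp.
by apply/funext => t; rewrite rmorphM/= circle_expN.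
Qed.

Lemma circle_int_cauchy (z : C) : nc z < 1 -> circle_int (cauchy_kernel z) = 1.
Proof.
move=> z1; have e1 n : @circle_exp R n \in circle_Lfun 1%E.
  by apply: circle_L2_L1; exact: circle_exp_L2.
rewrite (_ : cauchy_kernel z = fun t => circle_exp 0 t + z * (circle_exp (-1) t * cauchy_kernel z t)).
  rewrite circle_intD//; last by apply: circle_L1Z; exact: circle_L1_mul_cauchy.
  rewrite circle_intZ; last exact: circle_L1_mul_cauchy.
  rewrite circle_int_exp (@circle_int_cauchy_eq0 (circle_exp (-1)))// ?mulr0 ?addr0// => n.
  rewrite (_ : (fun t => _) = circle_exp (-1 - n%:Z)).
    by rewrite circle_int_exp -opprD oppr_eq0 -PoszD.
  by apply/funext => t; rewrite circle_expD.
by apply/funext => t; rewrite circle_exp0 mulrA -circle_exp_mul_cauchy.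
Qed.

Definition polar (r x : R) : C := r%:C%C * circle_exp 1 x.

Lemma normc_polar r x : 0 <= r -> nc (polar r x) = r.
Proof. by move=> r0; rewrite Normc.normcM normc_real normc_circle_exp mulr1 ger0_norm. Qed.

Lemma normc_polar_lt1 r x : 0 <= r < 1 -> nc (polar r x) < 1.
Proof. by move=> /andP[r0 r1]; rewrite normc_polar. Qed.

Lemma circle_exp1D (x t : R) : circle_exp 1 (x - t) = circle_exp 1 x * circle_exp (-1) t :> C.
Proof.
apply/eqP; rewrite eq_complex/= !mul1r mulN1r cosN sinN cosD sinD cosN sinN.
by rewrite [sin x * _ + _]addrC !eqxx.
Qed.

Lemma normc_cauchy_polar r x t :
  nc (1 - polar r x * circle_exp (-1) t) ^+ 2 = 1 - 2 * r * cos (x - t) + r ^+ 2.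
Proof.
rewrite /polar -mulrA -circle_exp1D sqr_normcE/= !mul1r !mul0r !subr0 !addr0 sub0r.
by have := cos2Dsin2 (x - t); move: (cos _) (sin _) => c s; nra.
Qed.

Lemma poisson_normc_cauchy r x t :
  poisson r (x - t) = (1 - r ^+ 2) * nc (cauchy_kernel (polar r x) t) ^+ 2.
Proof. by rewrite /poisson Normc.normcV exprVn normc_cauchy_polar. Qed.

(** Here lies the positivity behind all bounds on analytic functions: the real part
    of 2 K - 1 is a multiple of the squared modulus of K, K being the Cauchy
    kernel. *)
Lemma sqr_normc_cauchy (z : C) t : nc z < 1 ->
  ((1 - nc z ^+ 2) * nc (cauchy_kernel z t) ^+ 2)%:C%C =
  cauchy_kernel z t + conjC (cauchy_kernel z t) - 1.
Proof.
move=> z1; rewrite rmorphM/= -mul_conj_normc /cauchy_kernel.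
have := cauchy_den_neq0 t z1; set w := z * circle_exp (-1) t => w0.
have ww : w * conjC w = (nc z ^+ 2)%:C%C.
  by rewrite mul_conj_normc Normc.normcM normc_circle_exp mulr1.
have wc0 : 1 - conjC w != 0 by rewrite -(rmorph1 conjC) -rmorphB fmorph_eq0.
rewrite (_ : (1 - nc z ^+ 2)%:C%C = 1 - w * conjC w); last by rewrite ww rmorphB rmorph1.
have -> : conjC (1 - w)^-1 = (1 - conjC w)^-1 by rewrite fmorphV rmorphB rmorph1.
by field; rewrite w0 wc0.
Qed.

Lemma poisson_cauchy r x t : 0 <= r < 1 -> (poisson r (x - t))%:C%C =
  cauchy_kernel (polar r x) t + conjC (cauchy_kernel (polar r x) t) - 1.
Proof.
move=> r01; rewrite -sqr_normc_cauchy ?normc_polar_lt1// poisson_normc_cauchy.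
by rewrite normc_polar//; case/andP: r01.
Qed.

Lemma circle_L1_cst (z : C) : (fun=> z : C) \in circle_Lfun 1%E.
Proof. by apply: (@bounded_circle_L1 _ _ (nc z)); [exact: cmeasurable_cst|exact: aeW]. Qed.

Definition poisson_int (f : angle -> C) r x :=
  circle_int (fun t => (poisson r (x - t))%:C%C * f t).

Lemma cmeasurable_real (f : angle -> R) : measurable_fun setT f ->
  cmeasurable (fun t => (f t)%:C%C).
Proof. by move=> mf; split => //=; exact: measurable_cst. Qed.

Lemma poisson_intE (f : angle -> C) r x : f \in circle_Lfun 1%E -> 0 <= r < 1 ->
  poisson_int f r x = circle_int (fun t => f t * cauchy_kernel (polar r x) t) +
    circle_int (fun t => f t * conjC (cauchy_kernel (polar r x) t)) - circle_int f.
Proof.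
move=> f1 r01; have z1 := normc_polar_lt1 x r01.
have fk := circle_L1_mul_cauchy f1 z1; have fc := circle_L1_mul_cauchy_conj f1 z1.
rewrite -circle_intD// -circle_intB//; last exact: circle_L1D.
congr circle_int; apply/funext => t; rewrite poisson_cauchy//; ring.
Qed.

Lemma poisson_bound r x t : 0 <= r < 1 -> nc (poisson r (x - t))%:C%C <= 2 * (1 - r)^-1 + 1.
Proof.
move=> r01; have z1 := normc_polar_lt1 x r01.
rewrite poisson_cauchy// (le_trans (ler_normcB _ _))// Normc.normc1 lerD2r.
rewrite (le_trans (le_normcD _ _))// normc_conj mulr_natl mulr2n.
have := cauchy_kernel_bound t z1; rewrite normc_polar; last by case/andP: r01.
by move=> h; exact: lerD.
Qed.

Lemma poisson_L1 (f : angle -> C) r x : f \in circle_Lfun 1%E -> 0 <= r < 1 ->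
  (fun t => (poisson r (x - t))%:C%C * f t) \in circle_Lfun 1%E.
Proof.
move=> f1 r01; rewrite (_ : (fun t => _) = fun t => f t * (poisson r (x - t))%:C%C).
  apply: (@circle_L1_mul_bounded _ _ _ (2 * (1 - r)^-1 + 1)) => //.
    by apply: cmeasurable_real; exact: poisson_measurable.
  by apply: aeW => t; exact: poisson_bound.
by apply/funext => t; rewrite mulrC.
Qed.

Lemma poisson_int1 r x : 0 <= r < 1 -> poisson_int (fun=> 1) r x = 1.
Proof.
move=> r01; have z1 := normc_polar_lt1 x r01.
have c1 := circle_L1_cst 1.
have kE : (fun t => 1 * cauchy_kernel (polar r x) t) = cauchy_kernel (polar r x).
  by apply/funext => t; rewrite mul1r.
rewrite poisson_intE// kE circle_int_cst circle_int_cauchy//.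
rewrite (_ : (fun t => 1 * _) = fun t => conjC (cauchy_kernel (polar r x) t)); last first.
  by apply/funext => t; rewrite mul1r.
rewrite circle_int_conj ?circle_int_cauchy ?rmorph1 ?addrK//.
by rewrite -kE; exact: circle_L1_mul_cauchy.
Qed.

(** Fatou's theorem.  The Poisson kernel having integral 1, the difference between
    the Poisson integral and the value at x is the average of f t - f x, which is
    small at a Lebesgue point of the real and imaginary parts. *)
Theorem poisson_radial_limit (f : angle -> C) : f \in circle_Lfun 1%E ->
  {ae mu, forall x : angle, forall e, 0 < e -> exists2 d, 0 < d & forall r, 1 - d < r < 1 ->
    nc (poisson_int f r x - f x) <= e}.
Proof.
move=> f1; have /circle_LfunP[/Lfun1_integrable rf /Lfun1_integrable jf] := f1.
apply: filterS2 (poisson_lebesgue rf) (poisson_lebesgue jf) => x hr hj e e0.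
have e2 : 0 < e / 2 by rewrite divr_gt0.
have [d1 d10 h1] := hr _ e2; have [d2 d20 h2] := hj _ e2.
exists (Num.min 1 (Num.min d1 d2)) => [|r /andP[dr r1]].
  by rewrite !lt_min ltr01 d10 d20.
have : 1 - r < Num.min 1 (Num.min d1 d2) by lra.
rewrite !lt_min => /and3P[r0 rd1 rd2].
have r01 : 0 <= r < 1 by lra.
have {h1} h1 := h1 r ltac:(lra); have {h2} h2 := h2 r ltac:(lra).
have -> : poisson_int f r x - f x =
    circle_int (fun t => (poisson r (x - t))%:C%C * (f t - f x)).
  have fxE : f x = f x * poisson_int (fun=> 1) r x by rewrite poisson_int1// mulr1.
  rewrite [X in _ - X = _]fxE -circle_intZ; last first.
    by apply: poisson_L1 => //; exact: circle_L1_cst.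
  rewrite -circle_intB; [|exact: poisson_L1|]; last first.
    by apply: circle_L1Z; apply: poisson_L1 => //; exact: circle_L1_cst.
  by congr circle_int; apply/funext => t; ring.
have fB : (fun t => (poisson r (x - t))%:C%C * (f t - f x)) \in circle_Lfun 1%E.
  by apply: poisson_L1 => //; apply: circle_L1B => //; exact: circle_L1_cst.
apply: (le_trans (normc_circle_int fB)).
have /circle_L1P[mfB ifB] := fB.
have mP := poisson_measurable x r01.
have mr : measurable_fun setT (fun t : angle => poisson r (x - t) * `|complex.Re (f t) - complex.Re (f x)|).
  apply: measurable_funM => //; apply: measurableT_comp => //; apply: measurable_funB => //.
  by apply/measurable_EFinP; exact: (measurable_int mu).
have mj : measurable_fun setT (fun t : angle => poisson r (x - t) * `|complex.Im (f t) - complex.Im (f x)|).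
  apply: measurable_funM => //; apply: measurableT_comp => //; apply: measurable_funB => //.
  by apply/measurable_EFinP; exact: (measurable_int mu).
rewrite -lee_fin fineK; last exact: (integrable_fin_num measurableT ifB).
rewrite (_ : e = e / 2 + e / 2); last by field.
rewrite EFinD (le_trans _ (leeD h1 h2))// -ge0_integralD//; first last.
- exact/measurable_EFinP.
- by move=> t _; rewrite lee_fin mulr_ge0// poisson_ge0.
- exact/measurable_EFinP.
- by move=> t _; rewrite lee_fin mulr_ge0// poisson_ge0.
apply: ge0_le_integral => //.
- by move=> t _; rewrite lee_fin normc_ge0.
- by apply/measurable_EFinP; exact: measurable_normc.
- by apply: emeasurable_funD; exact/measurable_EFinP.
- move=> t _; rewrite -EFinD lee_fin Normc.normcM normc_real ger0_norm ?poisson_ge0//.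
  rewrite -mulrDr ler_wpM2l ?poisson_ge0// (le_trans (normc_le_ReIm _))//.
  by case: (f t) (f x) => ? ? [].
Qed.

(** Vanishing Fourier coefficients make all Poisson integrals vanish, through the
    geometric expansions of the Cauchy kernel and of its conjugate. *)
Lemma circle_fourier_unique (f : angle -> C) : f \in circle_Lfun 1%E ->
  (forall n, circle_int (fun t => f t * circle_exp n t) = 0) ->
  {ae mu, forall t, f t = 0}.
Proof.
move=> f1 f0; apply: filterS (poisson_radial_limit f1) => x h.
apply/eqP; rewrite -normc_eq0 eq_le normc_ge0 andbT; apply/ler_addgt0Pl => e e0.
rewrite addr0; have [d d0 hd] := h e e0.
pose r := Num.max 0 (1 - d / 2).
have r01 : 0 <= r < 1.
  by rewrite le_max lexx/= gt_max ltr01 ltrBlDr ltrDl divr_gt0.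
have rd : 1 - d < r by rewrite lt_max; apply/orP; right; lra.
have := hd r; rewrite rd; case/andP: (r01) => _ -> /(_ isT).
rewrite poisson_intE// circle_int_cauchy_eq0//; last exact: normc_polar_lt1.
rewrite circle_int_cauchy_conj_eq0//; last exact: normc_polar_lt1.
rewrite (_ : circle_int f = 0) ?subr0 ?addr0 ?sub0r ?(normcN (f x))//.
rewrite -[RHS](f0 0); congr circle_int; apply/funext => t.
by rewrite circle_exp0 mulr1.
Qed.
End Kernels.

(** * Integrals of complex functions over a segment *)

Section PathIntegrals.
Variable R : realType.
Local Notation C := (R[i]).
Local Notation angle := (measurableTypeR R).
Local Notation leb := (@lebesgue_measure R).
Local Notation nc := (@Normc.normc R).
Local Notation Re := (@complex.Re R).
Local Notation Im := (@complex.Im R).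
Arguments Normc.normc : simpl never.

Definition ccontinuous (f : R -> C) :=
  continuous (fun t => Re (f t)) /\ continuous (fun t => Im (f t)).

Lemma ccontinuous_cst z : ccontinuous (fun=> z).
Proof. by split=> t; exact: cvg_cst. Qed.

Lemma ccontinuousM f g : ccontinuous f -> ccontinuous g -> ccontinuous (fun t => f t * g t).
Proof.
move=> [rf jf] [rg jg]; split.
  rewrite (_ : (fun t => _) = (fun t => Re (f t) * Re (g t) - Im (f t) * Im (g t))).
    move=> t; apply: cvgB; apply: cvgM; [exact: rf|exact: rg|exact: jf|exact: jg].
  by apply/funext => t; case: (f t) (g t) => ? ? [].
rewrite (_ : (fun t => _) = (fun t => Re (f t) * Im (g t) + Im (f t) * Re (g t))).
  move=> t; apply: cvgD; apply: cvgM; [exact: rf|exact: jg|exact: jf|exact: rg].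
by apply/funext => t; case: (f t) (g t) => ? ? [].
Qed.

Lemma ccontinuous_real (f : R -> R) : continuous f -> ccontinuous (fun t => (f t)%:C%C).
Proof. by move=> cf; split => //= t; exact: cvg_cst. Qed.

Lemma ccontinuous_exp n : ccontinuous (@circle_exp R n).
Proof.
by split; apply: continuous_scaled; [exact: continuous_cos|exact: continuous_sin].
Qed.

Lemma ccontinuous_eps (f : R -> C) :
  (forall x e, 0 < e -> exists2 d, 0 < d & forall y, `|y - x| < d -> nc (f y - f x) <= e) ->
  ccontinuous f.
Proof.
move=> H; split=> x; apply/cvgrPdist_le => e e0; have [d d0 h] := H x e e0;
    near=> y; have {}h : nc (f y - f x) <= e.
- by apply: h; near: y; apply/nbhs_ballP; exists d => //= y; rewrite /ball/= distrC.
- rewrite distrC (le_trans _ h)// (le_trans _ (ler_Re_normc _))//.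
  by case: (f y) (f x) => ? ? [].
- by apply: h; near: y; apply/nbhs_ballP; exists d => //= y; rewrite /ball/= distrC.
- rewrite distrC (le_trans _ h)// (le_trans _ (ler_Im_normc _))//.
  by case: (f y) (f x) => ? ? [].
Unshelve. all: by end_near. Qed.

Let int (f : R -> R) a b := \int[leb]_(t in `[a, b]) f t.

Let continuous_integrable (f : R -> R) a b : continuous f ->
  leb.-integrable `[a, b] (EFin \o f).
Proof.
move=> cf; apply: continuous_compact_integrable; first exact: segment_compact.
exact: continuous_subspaceT.
Qed.

(** Unlike circle_int, the measure is not normalized. *)
Definition cint (f : R -> C) a b : C :=
  Complex (int (fun t => Re (f t)) a b) (int (fun t => Im (f t)) a b).

Lemma cintD f g a b : ccontinuous f -> ccontinuous g ->
  cint (fun t => f t + g t) a b = cint f a b + cint g a b.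
Proof.
move=> [rf jf] [rg jg]; apply/eqP; rewrite eq_complex/= /int -!RintegralD//; try exact: continuous_integrable.
by apply/andP; split; apply/eqP/eq_Rintegral => t _; case: (f t) (g t) => ? ? [].
Qed.

Lemma cintZ z f a b : ccontinuous f -> cint (fun t => z * f t) a b = z * cint f a b.
Proof.
move=> [rf jf]; case: z => x y; apply/eqP; rewrite eq_complex/= /int.
have cZ k (h : R -> R) : continuous h -> continuous (fun t => k * h t).
  by move=> ch t; apply: cvgM; [exact: cvg_cst|exact: ch].
rewrite -!RintegralZl//; try exact: continuous_integrable.
rewrite -RintegralB//; try (apply: continuous_integrable; exact: cZ).
rewrite -RintegralD//; try (apply: continuous_integrable; exact: cZ).
by apply/andP; split; apply/eqP/eq_Rintegral => t _; case: (f t) => ? ?.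
Qed.

Lemma eq_cint f g a b : (forall t, a <= t <= b -> f t = g t) -> cint f a b = cint g a b.
Proof.
move=> fg; rewrite /cint /int; congr Complex; apply: eq_Rintegral => t;
  by rewrite inE/= in_itv/= => /fg ->.
Qed.

Lemma cint_split f a b c : ccontinuous f -> a <= b -> b <= c ->
  cint f a c = cint f a b + cint f b c.
Proof.
have H (h : R -> R) : continuous h -> a <= b -> b <= c ->
    int h a c = int h a b + int h b c.
  move=> ch ab bc; rewrite /int -(@Rintegral_itv_obnd_cbnd _ b (BRight c)).
  rewrite -(@Rintegral_itvB _ h (BLeft a) (BRight c) b)//; last exact: continuous_integrable.
    by rewrite addrC subrK.
  apply: (integrableS _ _ _ (continuous_integrable b c ch)) => //.
  exact: subset_itv_oc_cc.
move=> [rf jf] ab bc; apply/eqP; rewrite eq_complex/=.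
by rewrite -!H// !eqxx.
Qed.

(** The factor 2 comes from treating the real and imaginary parts separately; it is
    harmless. *)
Lemma normc_cint f a b M : ccontinuous f -> a <= b ->
  (forall t, a <= t <= b -> nc (f t) <= M) -> nc (cint f a b) <= 2 * M * (b - a).
Proof.
have H (h : R -> R) : continuous h -> a <= b ->
    (forall t, a <= t <= b -> `|h t| <= M) -> `|int h a b| <= M * (b - a).
  move=> ch ab hM; apply: (le_trans (le_normr_Rintegral _ (continuous_integrable _ _ ch))) => //.
  have -> : M * (b - a) = int (fun=> M) a b.
    rewrite /int Rintegral_cst//= lebesgue_measure_itv/= lte_fin.
    by case: ltP => //= ba; have -> : a = b by [apply/eqP; rewrite eq_le ab]; rewrite subrr.
  apply: le_Rintegral => //.
  - by apply: continuous_integrable => t; apply: continuous_comp; [exact: ch|exact: norm_continuous].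
  - by apply: continuous_integrable => t; exact: cvg_cst.
move=> [rf jf] ab fM; apply: (le_trans (normc_le_ReIm _)).
rewrite -mulrA mulr_natl mulr2n lerD//= H// => t /fM; apply: le_trans.
  exact: ler_Re_normc.
exact: ler_Im_normc.
Qed.

Lemma cint_exp (k a b : R) : k != 0 -> a <= b ->
  'i%C * k%:C%C * cint (fun t => Complex (cos (k * t)) (sin (k * t))) a b =
  Complex (cos (k * b)) (sin (k * b)) - Complex (cos (k * a)) (sin (k * a)).
Proof.
move=> k0 ab; rewrite /cint /int/= Rintegral_cos// Rintegral_sin//.
by apply/eqP; rewrite eq_complex/=; apply/andP; split; apply/eqP; field.
Qed.
End PathIntegrals.

(** * Bisection of rectangles *)

Section Goursat.
Variable R : realType.
Local Notation C := (R[i]).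
Local Notation nc := (@Normc.normc R).
Arguments Normc.normc : simpl never.

Lemma nested_segments (x w : nat -> R) : (forall n, 0 <= w n) ->
  (forall n, x n <= x n.+1 /\ x n.+1 + w n.+1 <= x n + w n) ->
  exists p, forall n, x n <= p <= x n + w n.
Proof.
move=> w0 nest.
have mono n k : x n <= x (k + n)%N /\ x (k + n)%N + w (k + n)%N <= x n + w n.
  elim: k => [//|k [h1 h2]]; have [h3 h4] := nest (k + n)%N.
  by rewrite addSn (le_trans h1 h3) (le_trans h4 h2).
have cross m n : x m <= x n + w n.
  have [h1 _] := mono m n; have [_ h2] := mono n m.
  rewrite addnC in h1; rewrite (le_trans h1)// (le_trans _ h2)// lerDl//.
exists (sup (range x)) => n; apply/andP; split.
  by apply: ub_le_sup; [exists (x 0%N + w 0%N) => _ [m _ <-]|exists n].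
by apply: ge_sup; [exists (x 0%N), 0%N|move=> _ [m _ <-]].
Qed.

(** A rectangle functional that is additive under bisection and negligible against
    the squared diameter at each point vanishes: otherwise repeated quartering
    would keep a definite proportion of it near some point. *)
Lemma rectangle_bisection (Phi : R -> R -> R -> R -> C) (a b c d : R) :
  a <= b -> c <= d ->
  (forall x1 x2 x3 t1 t2, a <= x1 -> x1 <= x2 -> x2 <= x3 -> x3 <= b ->
    c <= t1 -> t1 <= t2 -> t2 <= d ->
    Phi x1 x3 t1 t2 = Phi x1 x2 t1 t2 + Phi x2 x3 t1 t2) ->
  (forall x1 x2 t1 t2 t3, a <= x1 -> x1 <= x2 -> x2 <= b ->
    c <= t1 -> t1 <= t2 -> t2 <= t3 -> t3 <= d ->
    Phi x1 x2 t1 t3 = Phi x1 x2 t1 t2 + Phi x1 x2 t2 t3) ->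
  (forall p q e, a <= p <= b -> c <= q <= d -> 0 < e ->
    exists2 del, 0 < del & forall x1 x2 t1 t2,
      a <= x1 -> x1 <= p <= x2 -> x2 <= b -> c <= t1 -> t1 <= q <= t2 -> t2 <= d ->
      x2 - x1 < del -> t2 - t1 < del ->
      nc (Phi x1 x2 t1 t2) <= e * (x2 - x1 + (t2 - t1)) ^+ 2) ->
  Phi a b c d = 0.
Proof.
move=> ab cd addx addt loc.
pose w n := (b - a) * 2^-1 ^+ n; pose h n := (d - c) * 2^-1 ^+ n.
have half0 n : 0 <= 2^-1 ^+ n :> R by rewrite exprn_ge0.
have w0 n : 0 <= w n by rewrite mulr_ge0// subr_ge0.
have h0 n : 0 <= h n by rewrite mulr_ge0// subr_ge0.
have wS n : w n = w n.+1 + w n.+1 by rewrite /w exprS; field.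
have hS n : h n = h n.+1 + h n.+1 by rewrite /h exprS; field.
(* The n-th rectangle has lower corner p, and its sides have been halved n
   times. *)
pose quad n (p : R * R) := nc (Phi p.1 (p.1 + w n) p.2 (p.2 + h n)).
pose inv n (p : R * R) := [/\ a <= p.1, p.1 + w n <= b, c <= p.2 & p.2 + h n <= d].
pose next n (p p' : R * R) := [/\ inv n.+1 p', quad n p <= 4 * quad n.+1 p',
  p.1 <= p'.1 /\ p'.1 + w n.+1 <= p.1 + w n & p.2 <= p'.2 /\ p'.2 + h n.+1 <= p.2 + h n].
have step n p : inv n p -> exists p', next n p p'.
  move: p => [x t] [/= ax xb ct td].
  have wn := w0 n.+1; have hn := h0 n.+1; rewrite wS in xb; rewrite hS in td.
  pose x' := x + w n.+1; pose t' := t + h n.+1.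
  have xE : x + w n = x' + w n.+1 by rewrite wS addrA.
  have tE : t + h n = t' + h n.+1 by rewrite hS addrA.
  (* One of the four quarters keeps a quarter of the functional. *)
  have le4 : quad n (x, t) <= quad n.+1 (x, t) + quad n.+1 (x', t) +
      (quad n.+1 (x, t') + quad n.+1 (x', t')).
    have xx' : x <= x' by rewrite lerDl.
    have x'' : x' <= x' + w n.+1 by rewrite lerDl.
    have xb' : x' + w n.+1 <= b by rewrite -addrA.
    have tt' : t <= t' by rewrite lerDl.
    have t'' : t' <= t' + h n.+1 by rewrite lerDl.
    have td' : t' + h n.+1 <= d by rewrite -addrA.
    have x3 := le_trans xx' x''; have t3 := le_trans t'' td'; have t4 := le_trans ct tt'.
    rewrite /quad xE tE (addt x _ t t')// (addx x x' _ t t')// (addx x x' _ t')//.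
    by rewrite (le_trans (le_normcD _ _))// lerD// le_normcD.
  have mk x0 t0 : x <= x0 -> x0 + w n.+1 <= x + (w n.+1 + w n.+1) ->
      t <= t0 -> t0 + h n.+1 <= t + (h n.+1 + h n.+1) ->
      quad n (x, t) <= 4 * quad n.+1 (x0, t0) -> exists p', next n (x, t) p'.
    move=> l1 l2 l3 l4 lq; exists (x0, t0); split => //=.
    - by split=> /=; [exact: le_trans l1|exact: le_trans xb|exact: le_trans l3|exact: le_trans td].
    - by rewrite (wS n).
    - by rewrite (hS n).
  have [q1|q1] := leP (quad n (x, t)) (4 * quad n.+1 (x, t)).
    by apply: mk q1 => //; rewrite lerD2l lerDl.
  have [q2|q2] := leP (quad n (x, t)) (4 * quad n.+1 (x', t)).
    by apply: mk q2; rewrite ?lexx ?lerDl// ?lerD2l ?lerDl// -addrA.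
  have [q3|q3] := leP (quad n (x, t)) (4 * quad n.+1 (x, t')).
    by apply: mk q3; rewrite ?lexx ?lerDl// ?lerD2l ?lerDl// -addrA.
  by apply: (mk x' t'); rewrite ?lerDl// -?addrA//; lra.
pose S := fix S n := if n is m.+1 then xget (0, 0) [set p | next m (S m) p] else (a, c).
have invS n : inv n (S n).
  elim: n => [|n ih]; first by rewrite /inv /w /h/= !expr0; split; lra.
  by have [p np] := step n _ ih; have [] : next n (S n) (S n.+1) := xgetI (0, 0) np.
have nextS n : next n (S n) (S n.+1).
  by have [p np] := step n _ (invS n); exact: xgetI np.
have [p hp] : exists p, forall n, (S n).1 <= p <= (S n).1 + w n.
  by apply: nested_segments => // n; have [] := nextS n.
have [q hq] : exists q, forall n, (S n).2 <= q <= (S n).2 + h n.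
  by apply: nested_segments => // n; have [] := nextS n.
have quad0 n : quad 0%N (a, c) <= 4 ^+ n * quad n (S n).
  elim: n => [|n ih]; first by rewrite expr0 mul1r.
  rewrite (le_trans ih)// exprSr -mulrA ler_wpM2l ?exprn_ge0//.
  by have [] := nextS n.
apply/eqP; rewrite -normc_eq0 eq_le normc_ge0 andbT.
have -> : Phi a b c d = Phi a (a + w 0%N) c (c + h 0%N).
  by rewrite /w /h !expr0 !mulr1 !subrKC.
rewrite -/(quad 0%N (a, c)).
pose K := b - a + (d - c); have K0 : 0 <= K by rewrite /K; lra.
apply/ler_addgt0Pl => e e0; rewrite addr0.
have [|||del del0 hdel] := loc p q (e / (K ^+ 2 + 1)).
- by have := hp 0%N; rewrite /w expr0/=; lra.
- by have := hq 0%N; rewrite /h expr0/=; lra.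
- by rewrite divr_gt0// ltr_wpDl ?sqr_ge0.
have [n nK] : exists n, K * 2^-1 ^+ n < del.
  have : (K * 2^-1 ^+ n) @[n --> \oo] --> K * 0.
    by apply: cvgM; [exact: cvg_cst|apply: cvg_expr; rewrite ger0_norm; lra].
  rewrite mulr0 => /cvgrPdist_lt/(_ _ del0)[n _ /(_ n (leqnn n))] /=.
  by rewrite sub0r normrN => /ltr_normlW; exists n.
have [ax xb ct td] := invS n.
have := hdel (S n).1 ((S n).1 + w n) (S n).2 ((S n).2 + h n) ax (hp n) xb ct (hq n) td.
have E1 : (S n).1 + w n - (S n).1 = w n by rewrite addrAC subrr add0r.
have E2 : (S n).2 + h n - (S n).2 = h n by rewrite addrAC subrr add0r.
rewrite E1 E2 -/(quad n (S n)) => H.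
have wn : w n < del by rewrite (le_lt_trans _ nK)// ler_wpM2r// /K; lra.
have hn : h n < del by rewrite (le_lt_trans _ nK)// ler_wpM2r// /K; lra.
apply: (le_trans (quad0 n)); apply: (@le_trans _ _ (4 ^+ n * (e / (K ^+ 2 + 1) * (K * 2^-1 ^+ n) ^+ 2))).
  rewrite ler_wpM2l ?exprn_ge0//; have -> : K * 2^-1 ^+ n = w n + h n by rewrite -mulrDl.
  exact: H.
rewrite exprMn -exprM mulnC exprM (_ : 2^-1 ^+ 2 = 4^-1 :> R); last by field.
rewrite exprVn; have : 4 ^+ n != 0 :> R by rewrite expf_neq0.
move: (4 ^+ n) => z z0; rewrite (_ : z * _ = e * (K ^+ 2 / (K ^+ 2 + 1))); last first.
  by field; rewrite z0 gt_eqF// ltr_wpDl ?sqr_ge0.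
by rewrite ler_piMr ?(ltW e0)// ler_pdivrMr ?mul1r ?lerDl// ltr_wpDl ?sqr_ge0.
Qed.
End Goursat.

(** * Goursat's theorem on polar rectangles *)

Section PolarGoursat.
Variable R : realType.
Local Notation C := (R[i]).
Local Notation leb := (@lebesgue_measure R).
Local Notation nc := (@Normc.normc R).
Arguments Normc.normc : simpl never.

(** Complex differentiability as affine approximation, which is the form used by
    Goursat's argument. *)
Definition cdifferentiable (H : C -> C) (z0 : C) := exists D : C,
  forall e, 0 < e -> exists2 d, 0 < d & forall z, nc (z - z0) < d ->
    nc (H z - H z0 - D * (z - z0)) <= e * nc (z - z0).

Definition disk_continuous (H : C -> C) := forall z0 : C, nc z0 < 1 ->
  forall e, 0 < e -> exists2 d, 0 < d & forall z, nc (z - z0) < d -> nc (H z - H z0) <= e.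

Lemma cdifferentiable_continuous H : (forall z, nc z < 1 -> cdifferentiable H z) ->
  disk_continuous H.
Proof.
move=> dH z0 /dH [D hD] e e0; have [d d0 h] := hD 1 ltr01.
have k0 : 0 < 1 + nc D by rewrite ltr_wpDr// normc_ge0.
exists (Num.min d (e / (1 + nc D))); first by rewrite lt_min d0 divr_gt0.
move=> z; rewrite lt_min => /andP[zd ze].
have -> : H z - H z0 = (H z - H z0 - D * (z - z0)) + D * (z - z0) by rewrite subrK.
rewrite (le_trans (le_normcD _ _))// Normc.normcM.
rewrite (@le_trans _ _ ((1 + nc D) * nc (z - z0)))//.
  by rewrite mulrDl lerD2r h.
by rewrite -ler_pdivlMl// mulrC ltW.
Qed.

Lemma disk_continuous_affine a b : disk_continuous (fun z => a + b * z).
Proof.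
apply: cdifferentiable_continuous => z0 _; exists b => e e0; exists 1 => // z _.
rewrite (_ : _ - _ - _ = 0) ?Normc.normc0 ?mulr_ge0 ?normc_ge0 ?(ltW e0)//; ring.
Qed.

Lemma disk_continuousB H G : disk_continuous H -> disk_continuous G ->
  disk_continuous (fun z => H z - G z).
Proof.
move=> cH cG z0 z01 e e0; have e2 : 0 < e / 2 by rewrite divr_gt0.
have [d1 d10 h1] := cH _ z01 _ e2; have [d2 d20 h2] := cG _ z01 _ e2.
exists (Num.min d1 d2); first by rewrite lt_min d10.
move=> z; rewrite lt_min => /andP[/h1 {}h1 /h2 {}h2].
rewrite (_ : _ - _ = (H z - H z0) - (G z - G z0)); last by ring.
by rewrite (le_trans (ler_normcB _ _))// (le_trans (lerD h1 h2))// -splitr.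
Qed.

Lemma cos_lipschitz (x y : R) : `|cos x - cos y| <= `|x - y|.
Proof.
wlog xy : x y / x <= y => [H|].
  by case: (leP x y) => [/H//|/ltW/H]; rewrite distrC [`|y - x|]distrC.
have [c _] := MVT_segment xy (fun z _ => @is_derive_cos R z) (continuous_subspaceT (@continuous_cos R)).
rewrite distrC [`|x - y|]distrC => ->; rewrite normrM ler_piMl//.
by rewrite normrN ler_norml sin_geN1 sin_le1.
Qed.

Lemma sin_lipschitz (x y : R) : `|sin x - sin y| <= `|x - y|.
Proof.
wlog xy : x y / x <= y => [H|].
  by case: (leP x y) => [/H//|/ltW/H]; rewrite distrC [`|y - x|]distrC.
have [c _] := MVT_segment xy (fun z _ => @is_derive_sin R z) (continuous_subspaceT (@continuous_sin R)).
rewrite distrC [`|x - y|]distrC => ->; rewrite normrM ler_piMl//.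
by rewrite ler_norml cos_geN1 cos_le1.
Qed.

Lemma circle_exp1_lipschitz (x y : R) : nc (circle_exp 1 x - circle_exp 1 y) <= 2 * `|x - y|.
Proof.
rewrite (le_trans (normc_le_ReIm _))//= !mul1r mulr_natl mulr2n lerD//.
  exact: cos_lipschitz.
exact: sin_lipschitz.
Qed.

Variable r : R.
Hypothesis r01 : 0 <= r < 1.
(** Clamping the radius to [0, r] keeps every point inside the disk, so that the
    integrands are continuous on the whole plane of parameters. *)
Let clamp (x : R) := Num.max 0 (Num.min r x).

Let clamp_itv x : 0 <= clamp x <= r.
Proof. by case/andP: r01 => r0 r1; rewrite /clamp le_max lexx/= ge_max r0 ge_min lexx. Qed.

Let clampE x : 0 <= x <= r -> clamp x = x.
Proof. by move=> /andP[x0 xr]; rewrite /clamp (min_idPr xr) (max_idPr x0). Qed.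

Let clamp_lipschitz x y : `|clamp x - clamp y| <= `|x - y|.
Proof.
wlog xy : x y / x <= y => [H|].
  by case: (leP x y) => [/H//|/ltW/H]; rewrite distrC [`|y - x|]distrC.
case/andP: r01 => r0 _.
rewrite distrC [`|x - y|]distrC [`|y - x|]ger0_norm ?subr_ge0// ler_norml /clamp /Num.max /Num.min.
by case: ifP; case: ifP; case: ifP; case: ifP; move=> *; apply/andP; split; lra.
Qed.

Let pt x t : C := polar (clamp x) t.

Let normc_pt x t : nc (pt x t) < 1.
Proof.
have /andP[c0 cr] := clamp_itv x; rewrite normc_polar// (le_lt_trans cr)//.
by case/andP: r01.
Qed.

Let pt_lipschitz x y t s : nc (pt x t - pt y s) <= `|x - y| + 2 * `|t - s|.
Proof.
have -> : pt x t - pt y s = (clamp x - clamp y)%:C%C * circle_exp 1 t +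
    (clamp y)%:C%C * (circle_exp 1 t - circle_exp 1 s).
  by rewrite rmorphB/= /pt /polar; ring.
rewrite (le_trans (le_normcD _ _))// !Normc.normcM !normc_real normc_circle_exp mulr1.
rewrite lerD ?clamp_lipschitz// -[leRHS]mul1r ler_pM ?normc_ge0 ?circle_exp1_lipschitz//.
have /andP[c0 cr] := clamp_itv y; rewrite ger0_norm// (le_trans cr)// ltW//.
by case/andP: r01.
Qed.

Let A (H : C -> C) t := cint (fun x => H (pt x t) * circle_exp 1 t).
Let B (H : C -> C) x := cint (fun t => H (pt x t) * ('i%C * (clamp x)%:C%C * circle_exp 1 t)).
(** The integral of H z dz along the boundary of a polar rectangle. *)
Let Phi H x1 x2 t1 t2 := A H t1 x1 x2 + B H x2 t1 t2 - A H t2 x1 x2 - B H x1 t1 t2.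

Let contH_x H t : disk_continuous H -> ccontinuous (fun x => H (pt x t)).
Proof.
move=> cH; apply: ccontinuous_eps => x e e0; have [d d0 h] := cH _ (normc_pt x t) e e0.
exists d => // y yd; apply: h; apply: le_lt_trans yd.
by rewrite (le_trans (pt_lipschitz _ _ _ _))// subrr normr0 mulr0 addr0.
Qed.

Let contH_t H x : disk_continuous H -> ccontinuous (fun t => H (pt x t)).
Proof.
move=> cH; apply: ccontinuous_eps => t e e0; have [d d0 h] := cH _ (normc_pt x t) e e0.
exists (d / 2) => [|y yd]; first by rewrite divr_gt0.
apply: h; rewrite (le_lt_trans (pt_lipschitz _ _ _ _))// subrr normr0 add0r.
by rewrite mulrC -ltr_pdivlMr.
Qed.

Let contA H t : disk_continuous H -> ccontinuous (fun x => H (pt x t) * circle_exp 1 t).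
Proof. by move=> cH; apply: ccontinuousM; [exact: contH_x|exact: ccontinuous_cst]. Qed.

Let contB H x : disk_continuous H ->
  ccontinuous (fun t => H (pt x t) * ('i%C * (clamp x)%:C%C * circle_exp 1 t)).
Proof.
move=> cH; apply: ccontinuousM; first exact: contH_t.
by apply: ccontinuousM; [exact: ccontinuous_cst|exact: ccontinuous_exp].
Qed.

Let cint_circle_exp n a b : n != 0 -> a <= b ->
  cint (@circle_exp R n) a b = (circle_exp n b - circle_exp n a) / ('i%C * n%:~R).
Proof.
move=> n0 ab; have k0 : n%:~R != 0 :> R by rewrite intr_eq0.
have := cint_exp k0 ab; rewrite -/(circle_exp n b) -/(circle_exp n a) => <-.
rewrite rmorph_int [X in X / _]mulrC mulfK// mulf_neq0// ?intr_eq0//.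
by rewrite eq_complex/= oner_eq0 andbF.
Qed.

Let cint_cst (z : C) a b : a <= b -> cint (fun=> z) a b = (b - a)%:C%C * z.
Proof.
move=> ab; rewrite /cint !Rintegral_cst//= lebesgue_measure_itv/= lte_fin.
have -> : fine (if a < b then (b%:E - a%:E)%E else 0%E) = b - a.
  by case: ltP => //= ba; have -> : a = b by [apply/eqP; rewrite eq_le ab]; rewrite subrr.
by case: z => x y; apply/eqP; rewrite eq_complex/= !mul0r subr0 addr0 ![_ * (b - a)]mulrC !eqxx.
Qed.

Let cint_id (a b : R) : a <= b ->
  cint (fun x : R => x%:C%C) a b = ((b ^+ 2 - a ^+ 2) / 2)%:C%C.
Proof.
move=> ab; rewrite /cint/= Rintegral_cst// mul0r.
have dF x : is_derive x (1 : R^o) (fun t : R => 2^-1 *: (t ^+ 2 : R^o)) x.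
  by apply: is_derive_eq; rewrite /GRing.scale/=; field.
rewrite (Rintegral_FTC ab dF) => [|x]; last exact: cvg_id.
by congr Complex; rewrite /GRing.scale/=; field.
Qed.

Let i0 : 'i%C != 0 :> C.
Proof. by rewrite eq_complex/= oner_eq0 andbF. Qed.

Let circle_exp2 t : circle_exp 2 t = circle_exp 1 t * circle_exp 1 t :> C.
Proof. by rewrite -circle_expD. Qed.

Let B_1 x t1 t2 : t1 <= t2 ->
  B (fun=> 1) x t1 t2 = (clamp x)%:C%C * (circle_exp 1 t2 - circle_exp 1 t1).
Proof.
move=> t12; rewrite /B (@eq_cint _ _ (fun t => 'i%C * (clamp x)%:C%C * circle_exp 1 t)).
  by rewrite cintZ ?cint_circle_exp//; [field; exact: i0|exact: ccontinuous_exp].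
by move=> t _; rewrite mul1r.
Qed.

Let B_id x t1 t2 : t1 <= t2 ->
  B id x t1 t2 = ((clamp x) ^+ 2)%:C%C / 2 * (circle_exp 2 t2 - circle_exp 2 t1).
Proof.
move=> t12; rewrite /B (@eq_cint _ _ (fun t => 'i%C * ((clamp x) ^+ 2)%:C%C * circle_exp 2 t)).
  by rewrite cintZ ?cint_circle_exp//; [field; exact: i0|exact: ccontinuous_exp].
move=> t _; rewrite /pt /polar rmorphXn/= circle_exp2; ring.
Qed.

(** The integral along a closed path of a function with an explicit primitive. *)
Let Phi_1 x1 x2 t1 t2 : 0 <= x1 -> x1 <= x2 -> x2 <= r -> t1 <= t2 ->
  Phi (fun=> 1) x1 x2 t1 t2 = 0.
Proof.
move=> x0 x12 xr t12; rewrite /Phi !B_1// !clampE; try by apply/andP; split; lra.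
have A_1 t : A (fun=> 1) t x1 x2 = (x2 - x1)%:C%C * circle_exp 1 t.
  by rewrite /A cint_cst// mul1r.
by rewrite !A_1 rmorphB/=; ring.
Qed.

Let Phi_id x1 x2 t1 t2 : 0 <= x1 -> x1 <= x2 -> x2 <= r -> t1 <= t2 ->
  Phi id x1 x2 t1 t2 = 0.
Proof.
move=> x0 x12 xr t12; rewrite /Phi !B_id// !clampE; try by apply/andP; split; lra.
have A_id t : A id t x1 x2 = ((x2 ^+ 2 - x1 ^+ 2) / 2)%:C%C * circle_exp 2 t.
  rewrite /A (@eq_cint _ _ (fun x => circle_exp 2 t * x%:C%C)); last first.
    move=> x xx; rewrite /pt clampE; last by apply/andP; split; lra.
    by rewrite /polar circle_exp2; ring.
  by rewrite cintZ ?cint_id// 1?mulrC//; apply: ccontinuous_real => y; exact: cvg_id.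
rewrite !A_id rmorphM rmorphB fmorphV/= rmorph_nat !rmorphXn/=; ring.
Qed.

Let PhiD H G x1 x2 t1 t2 : disk_continuous H -> disk_continuous G ->
  Phi (fun z => H z + G z) x1 x2 t1 t2 = Phi H x1 x2 t1 t2 + Phi G x1 x2 t1 t2.
Proof.
move=> cH cG; rewrite /Phi /A /B.
have AD t : cint (fun x => (H (pt x t) + G (pt x t)) * circle_exp 1 t) x1 x2 =
    cint (fun x => H (pt x t) * circle_exp 1 t) x1 x2 + cint (fun x => G (pt x t) * circle_exp 1 t) x1 x2.
  rewrite -cintD; [|exact: contA|exact: contA].
  by congr cint; apply/funext => x; rewrite mulrDl.
have BD x : cint (fun t => (H (pt x t) + G (pt x t)) * ('i%C * (clamp x)%:C%C * circle_exp 1 t)) t1 t2 =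
    cint (fun t => H (pt x t) * ('i%C * (clamp x)%:C%C * circle_exp 1 t)) t1 t2 +
    cint (fun t => G (pt x t) * ('i%C * (clamp x)%:C%C * circle_exp 1 t)) t1 t2.
  rewrite -cintD; [|exact: contB|exact: contB].
  by congr cint; apply/funext => t; rewrite mulrDl.
have alg (a a' b b' c c' d d' : C) : a + a' + (b + b') - (c + c') - (d + d') =
  a + b - c - d + (a' + b' - c' - d') by ring.
by rewrite !AD !BD; exact: alg.
Qed.

Let PhiZ k H x1 x2 t1 t2 : disk_continuous H ->
  Phi (fun z => k * H z) x1 x2 t1 t2 = k * Phi H x1 x2 t1 t2.
Proof.
move=> cH; rewrite /Phi /A /B.
have AZ t : cint (fun x => k * H (pt x t) * circle_exp 1 t) x1 x2 =
    k * cint (fun x => H (pt x t) * circle_exp 1 t) x1 x2.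
  by rewrite -cintZ; [congr cint; apply/funext => x; rewrite mulrA|exact: contA].
have BZ x : cint (fun t => k * H (pt x t) * ('i%C * (clamp x)%:C%C * circle_exp 1 t)) t1 t2 =
    k * cint (fun t => H (pt x t) * ('i%C * (clamp x)%:C%C * circle_exp 1 t)) t1 t2.
  by rewrite -cintZ; [congr cint; apply/funext => t; rewrite -mulrA|exact: contB].
have alg (a b c d : C) : k * a + k * b - k * c - k * d = k * (a + b - c - d) by ring.
by rewrite !AZ !BZ; exact: alg.
Qed.

Let Phi_bound E x1 x2 t1 t2 M : disk_continuous E -> x1 <= x2 -> t1 <= t2 ->
  (forall x t, x1 <= x <= x2 -> t1 <= t <= t2 -> nc (E (pt x t)) <= M) ->
  nc (Phi E x1 x2 t1 t2) <= 4 * M * (x2 - x1 + (t2 - t1)).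
Proof.
move=> cE x12 t12 EM.
have bA t : t1 <= t <= t2 -> nc (A E t x1 x2) <= 2 * M * (x2 - x1).
  move=> tt; apply: normc_cint => //; first exact: contA.
  by move=> x xx; rewrite Normc.normcM normc_circle_exp mulr1 EM.
have bB x : x1 <= x <= x2 -> nc (B E x t1 t2) <= 2 * M * (t2 - t1).
  move=> xx; apply: normc_cint => //; first exact: contB.
  move=> t tt; rewrite !Normc.normcM normc_circle_exp mulr1.
  have -> : nc 'i%C = 1 by rewrite /Normc.normc expr0n expr1n add0r sqrtr1.
  have /andP[c0 cr] := clamp_itv x.
  rewrite mul1r normc_real ger0_norm// -[leRHS]mulr1 ler_pM ?normc_ge0 ?EM//.
  by rewrite (le_trans cr)// ltW//; case/andP: r01.
rewrite (_ : 4 * M * _ = 2 * M * (x2 - x1) + 2 * M * (t2 - t1) +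
  2 * M * (x2 - x1) + 2 * M * (t2 - t1)); last by ring.
apply: (le_trans (ler_normcB _ _)); apply: lerD; last by apply: bB; rewrite lexx.
apply: (le_trans (ler_normcB _ _)); apply: lerD; last by apply: bA; rewrite lexx andbT.
apply: (le_trans (le_normcD _ _)); apply: lerD; first by apply: bA; rewrite lexx.
by apply: bB; rewrite lexx andbT.
Qed.

(** The affine part of H contributes nothing to the boundary integral, and its
    remainder is small against the size of the rectangle. *)
Lemma polar_goursat H : (forall z, nc z < 1 -> cdifferentiable H z) ->
  Phi H 0 r 0 (2 * pi) = 0.
Proof.
move=> dH; have cH := cdifferentiable_continuous dH; case/andP: (r01) => r0 r1.
have tp := ltW (twopi_gt0 R).
apply: rectangle_bisection => //.
- move=> x1 x2 x3 t1 t2 _ x12 x23 _ _ _ _.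
  have AS t : A H t x1 x3 = A H t x1 x2 + A H t x2 x3.
    by apply: cint_split => //; exact: contA.
  have alg (a a' b b' b'' c c' : C) : a + a' + b'' - (c + c') - b =
    a + b' - c - b + (a' + b'' - c' - b') by ring.
  by rewrite /Phi !AS; exact: alg.
- move=> x1 x2 t1 t2 t3 _ _ _ _ t12 t23 _.
  have BS x : B H x t1 t3 = B H x t1 t2 + B H x t2 t3.
    by apply: cint_split => //; exact: contB.
  have alg (a a' a'' b b' d d' : C) : a + (b + b') - a'' - (d + d') =
    a + b - a' - d + (a' + b' - a'' - d') by ring.
  by rewrite /Phi !BS; exact: alg.
move=> p q e pr _ e0; have [D hD] := dH _ (normc_pt p q).
have e8 : 0 < e / 8 by rewrite divr_gt0.
have [d d0 hd] := hD _ e8.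
exists (d / 4); first by rewrite divr_gt0.
move=> x1 x2 t1 t2 x10 /andP[x1p px2] x2r t10 /andP[t1q qt2] _ xd td.
have x12 := le_trans x1p px2; have t12 := le_trans t1q qt2.
(* E is the remainder of the affine approximation of H at z0. *)
pose z0 := pt p q; pose E z := H z - (H z0 - D * z0 + D * z).
have cE : disk_continuous E.
  by apply: disk_continuousB => //; exact: disk_continuous_affine.
have c1 : disk_continuous (fun=> 1).
  by have := disk_continuous_affine 1 0; under eq_fun do rewrite mul0r addr0.
have cid : disk_continuous id.
  by have := disk_continuous_affine 0 1; under eq_fun do rewrite mul1r add0r.
have -> : Phi H x1 x2 t1 t2 = Phi E x1 x2 t1 t2.
  rewrite (_ : H = fun z => E z + ((H z0 - D * z0) * 1 + D * z)); last first.
    by apply/funext => z; rewrite mulr1 subrK.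
  have cC k : disk_continuous (fun=> k * 1).
    rewrite (_ : (fun=> _) = fun z => k * 1 + 0 * z); first exact: disk_continuous_affine.
    by apply/funext => z; rewrite mul0r addr0.
  have cD : disk_continuous (fun z => D * z).
    rewrite (_ : (fun=> _) = fun z => 0 + D * z); first exact: disk_continuous_affine.
    by apply/funext => z; rewrite add0r.
  rewrite PhiD//; last first.
    exact: (disk_continuous_affine ((H z0 - D * z0) * 1) D).
  rewrite (PhiD (H := fun=> _ * 1) (G := fun z => D * z))//.
  rewrite (PhiZ _ (H := fun=> 1))// (PhiZ _ (H := id))//.
  by rewrite Phi_1// Phi_id// !mulr0 !addr0.
pose s := x2 - x1 + (t2 - t1).
have near x t : x1 <= x <= x2 -> t1 <= t <= t2 -> nc (pt x t - z0) <= 2 * s.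
  move=> xx tt; rewrite (le_trans (pt_lipschitz _ _ _ _))//.
  have : `|x - p| <= x2 - x1 by rewrite ler_norml; lra.
  have : `|t - q| <= t2 - t1 by rewrite ler_norml; lra.
  rewrite /s; lra.
have := @Phi_bound E x1 x2 t1 t2 (e / 8 * (2 * s)) cE x12 t12.
rewrite -/s (_ : 4 * _ * s = e * s ^+ 2); last by field.
apply=> x t xx tt; rewrite /E (_ : _ - _ = H (pt x t) - H z0 - D * (pt x t - z0)); last by ring.
apply: (le_trans (hd _ _)); first by rewrite (le_lt_trans (near _ _ xx tt))// /s; lra.
by rewrite ler_wpM2l ?(ltW e8)// near.
Qed.
(** Of the four sides of the polar rectangle [0, r] x [0, 2 pi], the two radial ones
    cancel and the one at radius 0 is trivial. *)
Lemma cint_holomorphic_circle H : (forall z, nc z < 1 -> cdifferentiable H z) -> 0 < r ->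
  cint (fun t => H (polar r t) * circle_exp 1 t) 0 (2 * pi) = 0.
Proof.
move=> dH r_gt0; have := polar_goursat dH; have cH := cdifferentiable_continuous dH.
have e0 : circle_exp 1 0 = 1 :> C by apply/eqP; rewrite eq_complex/= mulr0 cos0 sin0 !eqxx.
have -> : Phi H 0 r 0 (2 * pi) = B H r 0 (2 * pi) - B H 0 0 (2 * pi).
  rewrite /Phi (_ : A H (2 * pi) = A H 0); last by rewrite /A /pt /polar circle_exp_2pi e0.
  by rewrite [A H 0 0 r + _]addrC addrK.
have -> : B H 0 0 (2 * pi) = 0.
  rewrite /B (@eq_cint _ _ (fun=> 0)); first by rewrite cint_cst ?mulr0// ltW ?twopi_gt0.
  by move=> t _; rewrite clampE ?lexx ?ltW// mulr0 mul0r mulr0.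
rewrite subr0 /B (@eq_cint _ _ (fun t => ('i%C * r%:C%C) * (H (pt r t) * circle_exp 1 t))); last first.
  by move=> t _; rewrite !clampE ?lexx ?ltW//; ring.
rewrite cintZ; last by apply: ccontinuousM; [exact: contH_t|exact: ccontinuous_exp].
move/eqP; rewrite !mulf_eq0 (negbTE i0)/= /pt clampE ?lexx ?ltW//.
by rewrite -(rmorph0 (real_complex R)) (inj_eq (@complexI R)) gt_eqF//= => /eqP.
Qed.

Lemma ccontinuous_circle H : disk_continuous H -> ccontinuous (fun t => H (polar r t)).
Proof.
move=> cH; have := contH_t r cH; rewrite /pt clampE ?lexx ?andbT//.
by case/andP: r01.
Qed.
End PolarGoursat.

(** * Fourier coefficients of radial limits *)

Section BoundaryValues.
Variable R : realType.
Local Notation C := (R[i]).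
Local Notation angle := (measurableTypeR R).
Local Notation mu := (circle_measure R).
Local Notation leb := (@lebesgue_measure R).
Local Notation nc := (@Normc.normc R).
Arguments Normc.normc : simpl never.

Lemma ccontinuous_measurable (f : R -> C) : ccontinuous f -> cmeasurable f.
Proof. by move=> [rf jf]; split; exact: continuous_measurable_fun. Qed.

Lemma circle_int_cint (f : angle -> C) : f \in circle_Lfun 1%E ->
  circle_int f = ((2 * pi)^-1)%:C%C * cint f 0 (2 * pi).
Proof.
move=> /circle_LfunP[/Lfun1_integrable rf /Lfun1_integrable jf].
rewrite /circle_int !circle_RintegralE// /cint.
by apply/eqP; rewrite eq_complex/= !mul0r subr0 addr0 !eqxx.
Qed.

Lemma gt0_complexE (e : C) : 0 < e -> exists2 r : R, 0 < r & e = r%:C%C.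
Proof.
case: e => a b; rewrite ltcE/= => /andP[/eqP -> a0]; by exists a.
Qed.

Lemma derivable_cdifferentiable (F : C -> C) (z0 : C) :
  derivable (F : C^o -> C^o) z0 1 -> cdifferentiable F z0.
Proof.
move=> /cvg_ex[D lim]; exists D => e e0.
have e0C : 0 < e%:C%C :> C by rewrite ltcR.
move/cvgrPdist_le: lim => /(_ _ e0C)[d' /= /gt0_complexE[d d0 ->] hd].
exists d => // z zd; have [->|zz0] := eqVneq z z0.
  by rewrite !subrr mulr0 subrr Normc.normc0 mulr0.
have h0 : z - z0 != 0 by rewrite subr_eq0.
have := hd (z - z0); rewrite /ball_/= sub0r normrN normr_normc ltcR => /(_ zd h0).
rewrite [(z - z0) *: _]mulr1 subrK normr_normc lecR => le_e.
have -> : F z - F z0 - D * (z - z0) = - ((D - (z - z0)^-1 *: (F z - F z0)) * (z - z0)).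
  by rewrite mulrBl [_ *: _]mulrC divfK// opprB.
by rewrite (normcN (_ * _)) Normc.normcM ler_wpM2r// normc_ge0.
Qed.

Lemma cdifferentiable_mulX (F : C -> C) z0 m : cdifferentiable F z0 ->
  cdifferentiable (fun z => F z * z ^+ m) z0.
Proof.
move=> dF; elim: m => [|m [D hD]].
  by under eq_fun do rewrite expr0 mulr1.
pose H z := F z * z ^+ m; exists (D * z0 + H z0) => e e0.
have k1 : 0 < nc z0 + 1 by rewrite ltr_wpDl ?normc_ge0.
have k2 : 0 < nc D + 1 by rewrite ltr_wpDl ?normc_ge0.
have e1 : 0 < e / 2 / (nc z0 + 1) by rewrite !divr_gt0.
have e2 : 0 < e / 2 / (nc D + 1) by rewrite !divr_gt0.
have [d d0 hd] := hD _ e1.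
exists (Num.min d (Num.min 1 (e / 2 / (nc D + 1)))).
  by rewrite !lt_min d0 ltr01.
move=> z; rewrite !lt_min => /and3P[/hd {}hd z1 z2].
have -> : F z * z ^+ m.+1 - F z0 * z0 ^+ m.+1 - (D * z0 + H z0) * (z - z0) =
    (F z * z ^+ m - F z0 * z0 ^+ m - D * (z - z0)) * z + D * (z - z0) * (z - z0).
  by rewrite /H !exprSr; ring.
rewrite (le_trans (le_normcD _ _))// !Normc.normcM (_ : e * nc (z - z0) =
  e / 2 * nc (z - z0) + e / 2 * nc (z - z0)); last by field.
apply: lerD.
  rewrite (le_trans (ler_wpM2r (normc_ge0 z) hd))// mulrAC ler_wpM2r ?normc_ge0//.
  rewrite mulrAC ler_pdivrMr// ler_wpM2l ?divr_ge0 ?(ltW e0)//.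
  by rewrite -{1}(subrK z0 z) (le_trans (le_normcD _ _))// addrC lerD2l ltW.
rewrite ler_wpM2r ?normc_ge0//; move: z2; rewrite ltr_pdivlMr// => /ltW; apply: le_trans.
by rewrite mulrC ler_wpM2l ?normc_ge0// lerDl.
Qed.

(** Up to a nonzero factor, the coefficient is the integral of F z * z ^+ m dz along
    the circle. *)
Lemma circle_int_holomorphic (F : C -> C) (r : R) (m : nat) :
  Hinfty_disk F -> 0 < r < 1 ->
  circle_int (fun t => F (polar r t) * circle_exp m.+1 t) = 0.
Proof.
move=> [dF [M FM]] /andP[r0 r1]; have r01 : 0 <= r < 1 by rewrite ltW.
have dF' z : nc z < 1 -> cdifferentiable F z.
  by move=> z1; apply/derivable_cdifferentiable/dF; rewrite normr_normc ltcR.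
pose H z := F z * z ^+ m.
have dH z : nc z < 1 -> cdifferentiable H z.
  by move=> z1; apply: cdifferentiable_mulX; exact: dF'.
have f1 : (fun t : angle => F (polar r t) * circle_exp m.+1 t) \in circle_Lfun 1%E.
  apply: circle_L1_mul_exp; apply: (@bounded_circle_L1 _ _ (complex.Re M)).
    apply: ccontinuous_measurable; apply: ccontinuous_circle => //.
    exact: cdifferentiable_continuous.
  apply: aeW => t; have := FM (polar r t); rewrite !normr_normc ltcR lecE => /(_ _)/andP[]//.
  exact: normc_polar_lt1.
rewrite circle_int_cint//.
have := cint_holomorphic_circle r01 dH r0.
have -> : (fun t => H (polar r t) * circle_exp 1 t) =
    (fun t => (r ^+ m)%:C%C * (F (polar r t) * circle_exp m.+1 t)).
  apply/funext => t; rewrite /H /polar exprMn circle_expX exprSr rmorphXn/=.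
  by rewrite [circle_exp 1 t ^+ m]lock; ring.
rewrite cintZ; last first.
  apply: ccontinuousM; last exact: ccontinuous_exp.
  apply: ccontinuous_circle => //; exact: cdifferentiable_continuous.
move/eqP; rewrite mulf_eq0 -(rmorph0 (real_complex R)) (inj_eq (@complexI R)).
by rewrite expf_eq0 (gt_eqF r0) andbF/= rmorph0 => /eqP ->; rewrite mulr0.
Qed.

Let radii (n : nat) : R := 1 - n.+2%:R^-1.

Let radii01 n : 0 < radii n < 1.
Proof.
rewrite /radii subr_gt0 gtrBl invr_gt0 ltr0n andbT invf_lt1 ?ltr0n//.
by rewrite ltr1n.
Qed.

Lemma radial_limit_radii (F : C -> C) (phi : angle -> C) k : radial_limit F phi ->
  {ae mu, forall t, nc (F (polar (radii n) t) * circle_exp k t - phi t * circle_exp k t)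
    @[n --> \oo] --> 0}.
Proof.
apply: filterS => t lim; under eq_fun do rewrite -mulrBl Normc.normcM normc_circle_exp mulr1.
apply/cvgrPdist_le => e e0.
have e0C : 0 < e%:C%C :> C by rewrite ltcR.
move/cvgrPdist_le: lim => /(_ _ e0C)[d /= d0R hd].
near=> n; rewrite sub0r normrN ger0_norm ?normc_ge0// distcC -lecR -normr_normc.
have /andP[_ n1] := radii01 n.
apply: hd => //=; rewrite /radii opprB addrC subrK gtr0_norm ?invr_gt0 ?ltr0n//.
rewrite (@lt_trans _ _ n.+1%:R^-1)//; last by near: n; exact: (near_infty_natSinv_lt (PosNum d0R)).
by rewrite ltf_pV2 ?posrE ?ltr0n// ltr_nat.
Unshelve. all: by end_near. Qed.

(** Dominated convergence along the radii 1 - 1/(n + 2), F being bounded. *)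
Lemma radial_limit_fourier (F : C -> C) (phi : angle -> C) (m : nat) :
  Hinfty_disk F -> cmeasurable phi -> radial_limit F phi ->
  circle_int (fun t => phi t * circle_exp m.+1 t) = 0.
Proof.
move=> HF mphi /(radial_limit_radii m.+1) lim; have [dF [M FM]] := HF.
have dF' z : nc z < 1 -> cdifferentiable F z.
  by move=> z1; apply/derivable_cdifferentiable/dF; rewrite normr_normc ltcR.
have r01 n : 0 <= radii n < 1 by have /andP[/ltW -> ->] := radii01 n.
have := @circle_int_dominated R
  (fun n t => F (polar (radii n) t) * circle_exp m.+1 t)
  (fun t => phi t * circle_exp m.+1 t) (fun=> complex.Re M).
case.
- move=> n; apply: cmeasurableM; last exact: circle_exp_measurable.
  apply: ccontinuous_measurable; apply: ccontinuous_circle => //.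
  exact: cdifferentiable_continuous.
- by apply: cmeasurableM => //; exact: circle_exp_measurable.
- by have /circle_LfunP[/Lfun1_integrable + _] := circle_L1_cst M.
- apply: aeW => t n; rewrite Normc.normcM normc_circle_exp mulr1.
  have := FM (polar (radii n) t); rewrite !normr_normc ltcR lecE => /(_ _)/andP[]//.
  exact: normc_polar_lt1.
- exact: lim.
move=> _; under eq_fun do rewrite circle_int_holomorphic// sub0r (normcN (circle_int _)).
move=> /(cvg_unique _ (cvg_cst _)) h; apply/eqP; rewrite -normc_eq0; apply/eqP.
exact: h.
Qed.
End BoundaryValues.

(** * Frames and synthesis operators *)

Section Synthesis.
Variable R : realType.
Local Notation C := (R[i]).
Local Notation nc := (@Normc.normc R).
Arguments Normc.normc : simpl never.

Section RealNorm.
Variable K : normedModType C.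

(** The norms of the statement have values in R[i]; this is the real number behind
    such a norm. *)
Definition rnorm (x : K) : R := complex.Re `|x|.

Lemma rnormE (x : K) : `|x| = (rnorm x)%:C%C.
Proof. by rewrite /rnorm RRe_real// ger0_real. Qed.

Lemma rnorm_ge0 (x : K) : 0 <= rnorm x.
Proof. by have := normr_ge0 x; rewrite rnormE lecR. Qed.

Lemma rnorm_eq0 (x : K) : (rnorm x == 0) = (x == 0).
Proof. by rewrite -(normr_eq0 x) rnormE -(rmorph0 (real_complex R)) (inj_eq (@complexI R)). Qed.

Lemma rnorm0 : rnorm 0 = 0.
Proof. by apply/eqP; rewrite rnorm_eq0. Qed.

Lemma rnormD (x y : K) : rnorm (x + y) <= rnorm x + rnorm y.
Proof. by have := ler_normD x y; rewrite !rnormE -rmorphD/= lecR. Qed.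

Lemma rnormN (x : K) : rnorm (- x) = rnorm x.
Proof. by rewrite /rnorm normrN. Qed.

End RealNorm.

Lemma bounded_operatorP (K H : normedModType C) (L : {linear K -> H}) :
  bounded_operator L <-> exists2 M : R, 0 < M & forall x, rnorm (L x) <= M * rnorm x.
Proof.
split=> [[M LM]|[M M0 LM]]; last first.
  by exists M%:C%C => x; rewrite !rnormE -rmorphM/= lecR.
exists (nc M + 1) => [|x]; first by rewrite ltr_wpDl ?normc_ge0.
have h := LM x; have h0 : 0 <= M * `|x| by rewrite (le_trans _ h).
rewrite mulrDl mul1r ler_wpDr ?rnorm_ge0//.
have E : M * `|x| = `|M| * `|x| by rewrite -(ger0_norm h0) normrM normr_id.
by move: h; rewrite E !rnormE normr_normc -rmorphM/= lecR.
Qed.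

(** The synthesis operator c |-> sum c_n f_n is bounded and onto, with control of
    the preimage.  Finite families suffice: in a complete space, solving up to any
    precision with a uniform bound amounts to solving exactly. *)
Definition synthesis_onto (K : normedModType C) (f : nat -> K) := exists2 A : R, 0 < A &
  (forall n (c : nat -> C), rnorm (\sum_(i < n) c i *: f i) ^+ 2 <= A * \sum_(i < n) nc (c i) ^+ 2) /\
  (forall (y : K) e, 0 < e -> exists n (c : nat -> C),
    rnorm (y - \sum_(i < n) c i *: f i) <= e /\
    \sum_(i < n) nc (c i) ^+ 2 <= A * rnorm y ^+ 2).

Lemma synthesis_onto_GL (K H : normedModType C) (L : {linear K -> H}) (L' : {linear H -> K})
    (f : nat -> K) : GL L L' -> synthesis_onto f -> synthesis_onto (fun n => L (f n)).
Proof.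
move=> [/bounded_operatorP[M M0 LM] /bounded_operatorP[M' M'0 LM'] LK L'K].
move=> [A A0 [hA hB]]; exists (A * M ^+ 2 + A * M' ^+ 2).
  by rewrite addr_gt0// mulr_gt0// exprn_gt0.
have LE n (c : nat -> C) : \sum_(i < n) c i *: L (f i) = L (\sum_(i < n) c i *: f i).
  by rewrite linear_sum; apply: eq_bigr => i _; rewrite linearZ.
split=> [n c|y e e0].
  rewrite LE (@le_trans _ _ ((M * rnorm (\sum_(i < n) c i *: f i)) ^+ 2))//.
    by rewrite ler_sqr ?nnegrE ?rnorm_ge0// mulr_ge0 ?rnorm_ge0// ltW.
  have s0 : 0 <= \sum_(i < n) nc (c i) ^+ 2 by apply: sumr_ge0 => i _; exact: sqr_ge0.
  have h1 := ler_wpM2l (sqr_ge0 M) (hA n c).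
  have h2 := mulr_ge0 (mulr_ge0 (ltW A0) (sqr_ge0 M')) s0.
  rewrite exprMn; lra.
have [n [c [h1 h2]]] := hB (L' y) (e / M) (divr_gt0 e0 M0).
exists n, c; split.
  rewrite LE -[y in leLHS]L'K -linearB (le_trans (LM _))//.
  by rewrite -ler_pdivlMl// mulrC.
have h3 : rnorm (L' y) ^+ 2 <= (M' * rnorm y) ^+ 2.
  by rewrite ler_sqr ?nnegrE ?rnorm_ge0// mulr_ge0 ?rnorm_ge0// ltW.
have h4 := ler_wpM2l (ltW A0) h3.
have h5 := mulr_ge0 (mulr_ge0 (ltW A0) (sqr_ge0 M)) (sqr_ge0 (rnorm y)).
rewrite exprMn in h4; lra.
Qed.

Section InnerProducts.
Variables (H : normedModType C) (ip : {dot H for conjC}).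
Hypothesis ip_norm : forall x : H, `|x| ^+ 2 = ip x x.

Lemma ip_rnorm x : ip x x = (rnorm x ^+ 2)%:C%C.
Proof. by rewrite -ip_norm rnormE rmorphXn. Qed.

Lemma ip_CauchySchwarz x y : nc (ip x y) <= rnorm x * rnorm y.
Proof.
rewrite -ler_sqr ?nnegrE ?normc_ge0 ?mulr_ge0 ?rnorm_ge0//.
have := dot_CauchySchwarz ip x y; rewrite !ip_rnorm normr_normc -rmorphXn -rmorphM/= lecR.
by rewrite exprMn.
Qed.

Lemma rnorm_sqrB x y : rnorm (x - y) ^+ 2 =
  rnorm x ^+ 2 + rnorm y ^+ 2 - 2 * complex.Re (ip x y).
Proof.
apply: (@complexI R); rewrite -ip_rnorm dnormB !ip_rnorm.
by case: (ip x y) => a b; apply/eqP; rewrite eq_complex/=; apply/andP; split; apply/eqP; ring.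
Qed.

Lemma ip_suml (f : nat -> H) n (c : nat -> C) y :
  ip (\sum_(i < n) c i *: f i) y = \sum_(i < n) c i * ip (f i) y.
Proof.
elim: n => [|n ih]; first by rewrite !big_ord0 linear0l.
by rewrite !big_ord_recr/= linearDl/= ih linearZl_LR.
Qed.

Lemma ip_sumr (f : nat -> H) n (c : nat -> C) y :
  ip y (\sum_(i < n) c i *: f i) = \sum_(i < n) conjC (c i) * ip y (f i).
Proof.
elim: n => [|n ih]; first by rewrite !big_ord0 linear0r.
by rewrite !big_ord_recr/= linearDr/= ih linearZr_LR.
Qed.

Lemma orthonormal_rnorm (e : nat -> H) n (c : nat -> C) :
  (forall m n, ip (e m) (e n) = (m == n)%:R) ->
  rnorm (\sum_(i < n) c i *: e i) ^+ 2 = \sum_(i < n) nc (c i) ^+ 2.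
Proof.
move=> on; apply: (@complexI R); rewrite -ip_rnorm ip_suml rmorph_sum/=.
apply: eq_bigr => i _; rewrite ip_sumr (bigD1 i)//= on eqxx mulr1.
rewrite big1 ?addr0 ?mul_conj_normc// => j ji.
by rewrite on eq_sym val_eqE (negbTE ji) mulr0.
Qed.

End InnerProducts.

Section Frames.
Variables (H : completeNormedModType C) (ip : {dot H for conjC}).
Hypothesis ip_norm : forall x : H, `|x| ^+ 2 = ip x x.

Section Sequence.
Variable f : nat -> H.

Definition analysis_sum x n := \sum_(i < n) nc (ip x (f i)) ^+ 2.

(** The extended real series of the definition is replaced by its partial sums. *)
Lemma frameP : frame ip f <-> exists C1 C2 : R, [/\ 0 < C1, C1 <= C2 &
  forall x, (forall n, analysis_sum x n <= C2 * rnorm x ^+ 2) /\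
    (forall e, 0 < e -> exists n, C1 * rnorm x ^+ 2 <= analysis_sum x n + e)].
Proof.
pose u x n : \bar R := (complex.Re (`|ip x (f n)| ^+ 2))%:E.
have uE x n : u x n = (nc (ip x (f n)) ^+ 2)%:E by rewrite /u normr_normc -rmorphXn.
have u0 x n : (0 <= u x n)%E by rewrite uE lee_fin sqr_ge0.
have nE (x : H) : complex.Re (`|x| ^+ 2) = rnorm x ^+ 2 by rewrite rnormE -rmorphXn.
have partial x n : (\sum_(0 <= i < n) u x i)%E = (analysis_sum x n)%:E.
  rewrite big_mkord /analysis_sum -sumEFin.
  by apply: eq_bigr => i _; rewrite uE.
have le_total x n : ((analysis_sum x n)%:E <= \sum_(0 <= i <oo) u x i)%E.
  by rewrite -partial; apply: nneseries_lim_ge.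
have total_le x b : (forall n, analysis_sum x n <= b) ->
    (\sum_(0 <= i <oo) u x i <= b%:E)%E.
  move=> nb; apply: lime_le; first exact: is_cvg_nneseries.
  by apply: nearW => n; rewrite partial lee_fin.
split=> -[C1 [C2 [C10 C12 hC]]]; exists C1, C2; split => // x; have [h1 h2] := hC x.
  split=> [n|e e0].
    by rewrite -lee_fin (le_trans (le_total x n))// -nE.
  apply: contrapT => /forallNP h.
  have /total_le : forall n, analysis_sum x n <= C1 * rnorm x ^+ 2 - e.
    by move=> n; have /negP := h n; rewrite -ltNge => /ltW; rewrite lerBrDr.
  move: h1; rewrite nE => /le_trans /[apply]; rewrite lee_fin; lra.
rewrite !nE; split; last exact: total_le.
apply/lee_addgt0Pr => e e0; have [n hn] := h2 e e0.
apply: (@le_trans _ _ ((analysis_sum x n)%:E + e%:E)%E); first by rewrite -EFinD lee_fin.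
exact: leeD (le_total x n) (lexx _).
Qed.

(** The Cauchy-Schwarz inequality in the form 2 x y <= t x^2 + y^2 / t. *)
Lemma normc_pairing_le n (a b : nat -> C) t : 0 < t ->
  2 * nc (\sum_(i < n) a i * b i) <=
    t * (\sum_(i < n) nc (a i) ^+ 2) + t^-1 * (\sum_(i < n) nc (b i) ^+ 2).
Proof.
move=> t0; apply: (@le_trans _ _ (2 * \sum_(i < n) nc (a i) * nc (b i))).
  rewrite ler_wpM2l// (le_trans (normc_sum _ _ _))// le_eqVlt; apply/orP; left.
  by apply/eqP/eq_bigr => i _; rewrite Normc.normcM.
rewrite !mulr_sumr -big_split/=; apply: ler_sum => i _.
move: (nc (a i)) (nc (b i)) => x y.
have : 0 <= t^-1 * (t * x - y) ^+ 2 by rewrite mulr_ge0 ?sqr_ge0// invr_ge0 ltW.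
rewrite (_ : t^-1 * (t * x - y) ^+ 2 = t * x ^+ 2 + t^-1 * y ^+ 2 - 2 * (x * y)); last by field; rewrite gt_eqF.
by rewrite subr_ge0.
Qed.

Lemma ip_sum_bound n (c : nat -> C) x t : 0 < t ->
  2 * nc (ip x (\sum_(i < n) c i *: f i)) <=
    t * (\sum_(i < n) nc (c i) ^+ 2) + t^-1 * analysis_sum x n.
Proof.
move=> t0; rewrite ip_sumr (le_trans (@normc_pairing_le n (fun i => conjC (c i)) (fun i => ip x (f i)) t t0))//.
by under eq_bigr do rewrite normc_conj.
Qed.

(** Upper bound: apply the synthesis operator to the coefficients of x.  Lower bound:
    x is nearly a synthesis of controlled coefficients c, so |x|^2 is at most a
    pairing of c with the coefficients of x. *)
Lemma synthesis_onto_frame : synthesis_onto f -> frame ip f.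
Proof.
(* The natural bounds A^-1 and A are enlarged so as to be in order. *)
move=> [A A0 [hA hB]]; apply/frameP; exists (A + A^-1)^-1, (A + A^-1).
have A1 : 1 <= A + A^-1.
  have : 0 <= A^-1 * ((A - 1) ^+ 2 + A) by rewrite mulr_ge0 ?addr_ge0 ?sqr_ge0 ?invr_ge0 ?(ltW A0).
  rewrite (_ : A^-1 * _ = A + A^-1 - 1) ?subr_ge0//; field; by rewrite gt_eqF.
have AA0 : 0 < A + A^-1 by rewrite (lt_le_trans _ A1).
split; first by rewrite invr_gt0.
  by rewrite (@le_trans _ _ 1)// invf_le1.
move=> x; split=> [n|e e0].
  apply: (@le_trans _ _ (A * rnorm x ^+ 2)); last first.
    by rewrite ler_wpM2r ?sqr_ge0// lerDl invr_ge0 ltW.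
  pose y := \sum_(i < n) ip x (f i) *: f i.
  have xy : ip x y = (analysis_sum x n)%:C%C.
    rewrite (ip_sumr ip f n (fun i => ip x (f i)) x) /analysis_sum rmorph_sum/=; apply: eq_bigr => i _.
    by rewrite mulrC mul_conj_normc.
  have := ip_CauchySchwarz ip_norm x y; rewrite xy normc_real ger0_norm; last first.
    by apply: sumr_ge0 => i _; exact: sqr_ge0.
  have := hA n (fun i => ip x (f i)); rewrite -/y -/(analysis_sum x n).
  move: (analysis_sum x n) (rnorm_ge0 x) (rnorm_ge0 y) => s x0 y0 h1 h2.
  have [s0|s0] := leP s 0; first by rewrite (le_trans s0)// mulr_ge0 ?sqr_ge0// ltW.
  rewrite -(ler_pM2l s0) -expr2 (le_trans (_ : _ <= (rnorm x * rnorm y) ^+ 2))//.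
    by rewrite ler_sqr ?nnegrE ?mulr_ge0// ltW.
  have := ler_wpM2l (sqr_ge0 (rnorm x)) h1; rewrite exprMn; lra.
have x1 : 0 < rnorm x + 1 by rewrite ltr_wpDl ?rnorm_ge0.
have [n [c [h1 h2]]] := hB x (A * e / (2 * (rnorm x + 1))) ltac:(by rewrite divr_gt0// mulr_gt0).
exists n; apply: (@le_trans _ _ (A^-1 * rnorm x ^+ 2)).
  by rewrite ler_wpM2r ?sqr_ge0// lef_pV2 ?posrE// lerDl invr_ge0 ltW.
rewrite ler_pdivrMl//.
set y := \sum_(i < n) c i *: f i in h1.
have hx : rnorm x ^+ 2 <= nc (ip x (x - y)) + nc (ip x y).
  have -> : rnorm x ^+ 2 = nc (ip x x) by rewrite (ip_rnorm ip_norm) normc_real ger0_norm ?sqr_ge0.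
  by rewrite -{2}(subrK y x) linearD/= le_normcD.
have h3 := ip_CauchySchwarz ip_norm x (x - y).
have := @ip_sum_bound n c x A^-1; rewrite invr_gt0 invrK => /(_ A0) h4.
have h5 : A^-1 * \sum_(i < n) nc (c i) ^+ 2 <= rnorm x ^+ 2 by rewrite ler_pdivrMl.
have h6 : 2 * (rnorm x * rnorm (x - y)) <= A * e.
  move: h1; rewrite ler_pdivlMr ?mulr_gt0// => h1; apply: le_trans h1.
  have := rnorm_ge0 (x - y); have := rnorm_ge0 x; nra.
move: h4; rewrite -/y => h4; lra.
Qed.

Let trunc n (c : nat -> C) i := if (i < n)%N then c i else 0.

Let trunc_sum n m (c : nat -> C) : (n <= m)%N ->
  \sum_(i < m) trunc n c i *: f i = \sum_(i < n) c i *: f i.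
Proof.
move=> nm; rewrite (big_ord_widen m (fun i => c i *: f i) nm) [RHS]big_mkcond/=.
by apply: eq_bigr => i _; rewrite /trunc; case: ifP => // _; rewrite scale0r.
Qed.

Let trunc_sqr n m (c : nat -> C) : (n <= m)%N ->
  \sum_(i < m) nc (trunc n c i) ^+ 2 = \sum_(i < n) nc (c i) ^+ 2.
Proof.
move=> nm; rewrite (big_ord_widen m (fun i => nc (c i) ^+ 2) nm) [RHS]big_mkcond/=.
by apply: eq_bigr => i _; rewrite /trunc; case: ifP => // _; rewrite Normc.normc0 expr0n.
Qed.

(** One Richardson step x - C2^-1 S x shrinks the residual by a fixed factor, S
    being the frame operator; iterating it inverts S up to any precision. *)
Lemma frame_synthesis_onto : frame ip f -> synthesis_onto f.
Proof.
move=> /frameP[C1 [C2 [C10 C12 hC]]]; have C20 := lt_le_trans C10 C12.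
have bound n (c : nat -> C) :
    rnorm (\sum_(i < n) c i *: f i) ^+ 2 <= C2 * \sum_(i < n) nc (c i) ^+ 2.
  set y := \sum_(i < n) _; have [hy _] := hC y.
  have := @ip_sum_bound n c y C2 C20; rewrite -/y (ip_rnorm ip_norm) normc_real ger0_norm ?sqr_ge0//.
  have := hy n; rewrite -ler_pdivrMl//; lra.
(* Each step multiplies the squared residual by 1 - q; the 2 pays for replacing
   the frame operator by a finite sum. *)
pose q := C1 / (2 * C2).
have q0 : 0 < q by rewrite divr_gt0// mulr_gt0.
have q12 : q <= 2^-1.
  by rewrite ler_pdivrMr ?mulr_gt0// mulrA mulVf ?mul1r ?pnatr_eq0.
have step y : exists n (c : nat -> C),
    rnorm (y - \sum_(i < n) c i *: f i) ^+ 2 <= (1 - q) * rnorm y ^+ 2 /\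
    \sum_(i < n) nc (c i) ^+ 2 <= C2^-1 * rnorm y ^+ 2.
  have [->|y0] := eqVneq y 0.
    exists 0%N, (fun=> 0); rewrite !big_ord0 subr0 rnorm0 expr0n/= !mulr0; split; exact: lexx.
  have ny : 0 < rnorm y by rewrite lt_neqAle eq_sym rnorm_eq0 y0 rnorm_ge0.
  have [hy hn] := hC y.
  have [n {}hn] := hn (C1 * rnorm y ^+ 2 / 2) ltac:(by rewrite divr_gt0// mulr_gt0// exprn_gt0).
  pose c i := (C2^-1)%:C%C * ip y (f i); exists n, c.
  have S0 : 0 <= analysis_sum y n by apply: sumr_ge0 => i _; exact: sqr_ge0.
  have cE : \sum_(i < n) nc (c i) ^+ 2 = C2^-1 ^+ 2 * analysis_sum y n.
    rewrite /analysis_sum mulr_sumr; apply: eq_bigr => i _.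
    by rewrite Normc.normcM exprMn normc_real real_normK ?num_real.
  have zE : ip y (\sum_(i < n) c i *: f i) = (C2^-1 * analysis_sum y n)%:C%C.
    rewrite ip_sumr rmorphM rmorph_sum/= mulr_sumr; apply: eq_bigr => i _.
    rewrite rmorphM/= -mulrA [conjC (ip _ _) * _]mulrC mul_conj_normc.
    by congr (_ * _); apply/eqP; rewrite eq_complex/= oppr0 !eqxx.
  have hz := bound n c; rewrite cE in hz *.
  have hS : C1 * rnorm y ^+ 2 / 2 <= analysis_sum y n by lra.
  split.
    rewrite (rnorm_sqrB ip_norm) zE /=.
    have -> : (1 - q) * rnorm y ^+ 2 = rnorm y ^+ 2 - C2^-1 * (C1 * rnorm y ^+ 2 / 2).
      by rewrite /q; field; rewrite gt_eqF.
    have h1 : C2 * (C2^-1 ^+ 2 * analysis_sum y n) = C2^-1 * analysis_sum y n.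
      by field; rewrite gt_eqF.
    have h2 : C2^-1 * (C1 * rnorm y ^+ 2 / 2) <= C2^-1 * analysis_sum y n.
      by rewrite ler_wpM2l// invr_ge0 ltW.
    rewrite h1 in hz; lra.
  rewrite expr2 -mulrA ler_wpM2l ?invr_ge0 ?(ltW C20)//.
  by rewrite ler_pdivrMl.
(* K solves K = (1 + q^-1) / C2 + (1 + q) (1 - q) K, the recursion for the
   coefficients accumulated by the steps. *)
pose K := (1 + q^-1) / (C2 * q ^+ 2).
have K0 : 0 <= K.
  rewrite divr_ge0//; first by rewrite addr_ge0// invr_ge0 ltW.
  by rewrite mulr_ge0 ?sqr_ge0// ltW.
have iterate k y : exists n (c : nat -> C),
    rnorm (y - \sum_(i < n) c i *: f i) ^+ 2 <= (1 - q) ^+ k * rnorm y ^+ 2 /\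
    \sum_(i < n) nc (c i) ^+ 2 <= K * rnorm y ^+ 2.
  elim: k y => [|k ih] y.
    exists 0%N, (fun=> 0); rewrite !big_ord0 subr0 expr0 mul1r; split; first exact: lexx.
    by rewrite mulr_ge0 ?sqr_ge0.
  have [n0 [c0 [h1 h2]]] := step y.
  have [n1 [c1 [h3 h4]]] := ih (y - \sum_(i < n0) c0 i *: f i).
  exists (maxn n0 n1), (fun i => trunc n0 c0 i + trunc n1 c1 i); split.
    under eq_bigr do rewrite scalerDl.
    rewrite big_split/= !trunc_sum ?leq_maxl ?leq_maxr// opprD addrA.
    rewrite (le_trans h3)// [_ ^+ k.+1]exprSr -[leRHS]mulrA ler_wpM2l// exprn_ge0//; lra.
  apply: (@le_trans _ _ ((1 + q^-1) * (\sum_(i < n0) nc (c0 i) ^+ 2) +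
      (1 + q) * (\sum_(i < n1) nc (c1 i) ^+ 2))).
    rewrite -(@trunc_sqr n0 (maxn n0 n1)) ?leq_maxl// -(@trunc_sqr n1 (maxn n0 n1)) ?leq_maxr//.
    rewrite !mulr_sumr -big_split/=; apply: ler_sum => i _.
    move: (trunc n0 c0 i) (trunc n1 c1 i) => a b.
    apply: (@le_trans _ _ ((nc a + nc b) ^+ 2)).
      by rewrite ler_sqr ?nnegrE ?addr_ge0 ?normc_ge0// le_normcD.
    move: (nc a) (nc b) => u v.
    have : 0 <= q^-1 * (u - q * v) ^+ 2 by rewrite mulr_ge0 ?sqr_ge0// invr_ge0 ltW.
    rewrite (_ : q^-1 * (u - q * v) ^+ 2 = (1 + q^-1) * u ^+ 2 + (1 + q) * v ^+ 2 - (u + v) ^+ 2).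
      by rewrite subr_ge0.
    by field; rewrite gt_eqF.
  have h5 : \sum_(i < n1) nc (c1 i) ^+ 2 <= K * ((1 - q) * rnorm y ^+ 2).
    by rewrite (le_trans h4)// ler_wpM2l.
  have -> : K * rnorm y ^+ 2 = (1 + q^-1) * (C2^-1 * rnorm y ^+ 2) +
      (1 + q) * (K * ((1 - q) * rnorm y ^+ 2)).
    by rewrite /K; field; rewrite !gt_eqF.
  by apply: lerD; rewrite ler_wpM2l// addr_ge0// ?invr_ge0 ltW.
exists (C2 + K); first by rewrite ltr_wpDr.
split=> [n c|y e e0].
  rewrite (le_trans (bound n c))// ler_wpM2r ?lerDl//.
  by apply: sumr_ge0 => i _; exact: sqr_ge0.
have [k hk] : exists k, (1 - q) ^+ k * rnorm y ^+ 2 <= e ^+ 2.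
  have e2 : 0 < e ^+ 2 by rewrite exprn_gt0.
  have : ((1 - q) ^+ k * rnorm y ^+ 2) @[k --> \oo] --> 0 * rnorm y ^+ 2.
    by apply: cvgM; [apply: cvg_expr; rewrite ger0_norm; lra|exact: cvg_cst].
  rewrite mul0r => /cvgrPdist_le/(_ _ e2)[k _ /(_ k (leqnn k))] /=.
  by rewrite sub0r normrN => /ler_normlW; exists k.
have [n [c [h1 h2]]] := iterate k y; exists n, c; split.
  by rewrite -ler_sqr ?nnegrE ?rnorm_ge0 ?(ltW e0)// (le_trans h1).
by rewrite (le_trans h2)// ler_wpM2r ?sqr_ge0// lerDr ltW.
Qed.
End Sequence.

(** Coefficients of an approximant within |y| of y have norm at most 2 |y|. *)
Lemma orthonormal_synthesis_onto (e : nat -> H) : orthonormal_basis ip e -> synthesis_onto e.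
Proof.
move=> [on dense_e].
exists 4; first by [].
split=> [n c|y d d0].
  rewrite (orthonormal_rnorm ip_norm _ _ on) ler_peMl//; last by rewrite ler1n.
  by apply: sumr_ge0 => i _; exact: sqr_ge0.
have [->|y0] := eqVneq y 0.
  exists 0%N, (fun=> 0); rewrite !big_ord0 subr0 rnorm0; split; first exact: ltW.
  by rewrite mulr_ge0 ?sqr_ge0.
have ny : 0 < rnorm y by rewrite lt_neqAle eq_sym rnorm_eq0 y0 rnorm_ge0.
pose d' := Num.min d (rnorm y); have d'0 : 0 < d' by rewrite lt_min d0.
have : closure (linear_span e) y by rewrite dense_e.
move=> /(_ (ball y (d'%:C%C : C))) [].
  by apply: nbhsx_ballx; rewrite ltcR.
move=> z [[n [c ->]]]; rewrite -ball_normE/= rnormE ltcR => /ltW yz.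
exists n, c; split; first by rewrite (le_trans yz)// ge_min lexx.
rewrite -(orthonormal_rnorm ip_norm n c on) (_ : 4 * _ = (2 * rnorm y) ^+ 2); last by ring.
rewrite ler_sqr ?nnegrE ?rnorm_ge0 ?mulr_ge0 ?rnorm_ge0//.
rewrite -[X in rnorm X](subKr y) (le_trans (rnormD _ _))// rnormN mulr_natl mulr2n lerD2l.
by rewrite (le_trans yz)// ge_min lexx orbT.
Qed.

Lemma riesz_synthesis_onto (f : nat -> H) : riesz_basis ip f -> synthesis_onto f.
Proof.
move=> [e [U [U' [/orthonormal_synthesis_onto e_onto GLU fE]]]].
move: (synthesis_onto_GL GLU e_onto).
by congr synthesis_onto; apply/funext => n; rewrite fE.
Qed.
End Frames.
End Synthesis.

(** * Functions representing the elements of L^2 and H^2 *)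

Section Classes.
Local Open Scope quotient_scope.
Variable R : realType.
Local Notation C := (R[i]).
Local Notation angle := (measurableTypeR R).
Local Notation mu := (circle_measure R).
Local Notation nc := (@Normc.normc R).
Arguments Normc.normc : simpl never.

(** The squared norm of L^2. *)
Definition sqint (f : angle -> C) : R := \int[mu]_t (nc (f t) ^+ 2).

Lemma sqint_ge0 f : 0 <= sqint f.
Proof. by apply: Rintegral_ge0 => t _; exact: sqr_ge0. Qed.

Lemma circle_int_sqint (f : angle -> C) :
  circle_int (fun t => f t * conjC (f t)) = (sqint f)%:C%C.
Proof.
under eq_fun do rewrite mul_conj_normc.
by rewrite /circle_int/= Rintegral_cst// mul0r.
Qed.

Lemma L2_of_val (f : angle -> C) : f \in circle_Lfun 2%:E ->
  exists f2 : L2fun R, L2fun_val f2 = f /\ L2_of f = \pi_(L2 R) f2.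
Proof.
move=> f2; exists (MkL2fun f2); split => //; rewrite /L2_of.
by congr (\pi_(L2 R) _); apply: val_inj; rewrite insubdK.
Qed.

Lemma L2_of_repr (x : L2 R) : L2_of (repr x : L2fun R) = x.
Proof. by rewrite /L2_of valKd reprK. Qed.

Lemma repr_L2 (x : L2 R) : L2fun_val (repr x) \in circle_Lfun 2%:E.
Proof. exact: valP. Qed.

Lemma L2_of_ae (f g : angle -> C) : f \in circle_Lfun 2%:E -> g \in circle_Lfun 2%:E ->
  (L2_of f = L2_of g <-> {ae mu, forall t, f t = g t}).
Proof.
move=> /L2_of_val[f2 [fE ->]] /L2_of_val[g2 [gE ->]].
by rewrite -fE -gE; exact: L2_eqP.
Qed.

Lemma circle_L2_lin a (f g : angle -> C) : f \in circle_Lfun 2%:E -> g \in circle_Lfun 2%:E ->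
  (fun t => a * f t + g t) \in circle_Lfun 2%:E.
Proof. by move=> f2 g2; have [_ H] := @circle_Lfun_submod_closed R _ (lee1n 2); exact: (H a f g f2 g2). Qed.

Lemma L2_of_lin a (f g : angle -> C) : f \in circle_Lfun 2%:E -> g \in circle_Lfun 2%:E ->
  L2_of (fun t => a * f t + g t) = a *: L2_of f + L2_of g.
Proof.
move=> f2 g2; have [h [hE ->]] := L2_of_val (circle_L2_lin a f2 g2).
have [f' [fE ->]] := L2_of_val f2; have [g' [gE ->]] := L2_of_val g2.
rewrite -[a *: _]/(L2_scale a _) L2_pi_scale -(raddfD \pi_(L2 R)).
by congr (\pi_(L2 R) _); apply: val_inj; rewrite /= hE; apply/funext => t; rewrite !fctE -fE -gE.
Qed.

Lemma L2_dot_of (f g : angle -> C) : f \in circle_Lfun 2%:E -> g \in circle_Lfun 2%:E ->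
  L2_dot (L2_of f) (L2_of g) = circle_int (fun t => f t * conjC (g t)).
Proof. by move=> /L2_of_val[f2 [fE ->]] /L2_of_val[g2 [gE ->]]; rewrite L2_dot_pi fE gE. Qed.

Lemma rnorm_L2_of (f : angle -> C) : f \in circle_Lfun 2%:E ->
  rnorm (L2_of f) ^+ 2 = sqint f.
Proof.
move=> f2; apply: (@complexI R); rewrite -circle_int_sqint -L2_dot_of// -L2_normE.
by rewrite rnormE rmorphXn.
Qed.

Lemma fourier_L2_of (f : angle -> C) n : f \in circle_Lfun 2%:E ->
  fourier (L2_of f) n = circle_int (fun t => f t * circle_exp (- n) t).
Proof.
move=> /L2_of_val[f2 [fE ->]]; rewrite fourier_pi fE.
by congr circle_int; apply/funext => t; rewrite circle_expN.
Qed.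

(** Square-integrable functions whose Fourier coefficients of negative index
    vanish: the representatives of the elements of the Hardy space. *)
Definition analytic (f : angle -> C) := f \in circle_Lfun 2%:E /\
  forall m : nat, circle_int (fun t => f t * circle_exp m.+1 t) = 0.

Lemma analytic_L2 f : analytic f -> f \in circle_Lfun 2%:E. Proof. by case. Qed.

Lemma analytic_hardy2 f : analytic f -> L2_of f \in @hardy2 R.
Proof.
move=> [f2 f0]; apply/asboolP => -[n|n] // _.
by rewrite fourier_L2_of// NegzE opprK f0.
Qed.

Definition H2_of (f : angle -> C) : H2 R := insubd 0 (L2_of f).

Lemma H2_ofE f : analytic f -> H2_val (H2_of f) = L2_of f.
Proof. by move=> /analytic_hardy2 fh; rewrite /H2_of insubdK. Qed.

Definition H2_fun (x : H2 R) : angle -> C := repr (H2_val x) : L2fun R.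

Lemma H2_fun_analytic x : analytic (H2_fun x).
Proof.
split=> [|m]; first exact: repr_L2.
have /asboolP/(_ (Negz m) isT) := valP x.
by rewrite -{1}[val x]L2_of_repr fourier_L2_of ?repr_L2// NegzE opprK.
Qed.

Lemma H2_of_fun x : H2_of (H2_fun x) = x.
Proof. by apply: val_inj; rewrite /= H2_ofE ?L2_of_repr//; exact: H2_fun_analytic. Qed.

Lemma H2_of_ae f g : analytic f -> analytic g ->
  (H2_of f = H2_of g <-> {ae mu, forall t, f t = g t}).
Proof.
move=> af ag; have E := L2_of_ae (analytic_L2 af) (analytic_L2 ag).
split=> [fg|/E fg]; first by apply/E; rewrite -(H2_ofE af) -(H2_ofE ag) fg.
by apply: val_inj; apply: (etrans (H2_ofE af)); apply: (etrans fg); exact: esym (H2_ofE ag).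
Qed.

Lemma circle_int_lin a (f g : angle -> C) : f \in circle_Lfun 1%E -> g \in circle_Lfun 1%E ->
  circle_int (fun t => a * f t + g t) = a * circle_int f + circle_int g.
Proof. by move=> f1 g1; rewrite circle_intD ?circle_intZ//; exact: circle_L1Z. Qed.

Lemma analytic_lin a f g : analytic f -> analytic g -> analytic (fun t => a * f t + g t).
Proof.
move=> [f2 f0] [g2 g0]; split; first exact: circle_L2_lin.
move=> m; rewrite (_ : (fun t => _) =
    fun t => a * (f t * circle_exp m.+1 t) + g t * circle_exp m.+1 t).
  by rewrite circle_int_lin ?f0 ?g0 ?mulr0 ?addr0//; apply: circle_L1_mul_exp; exact: circle_L2_L1.
by apply/funext => t; rewrite mulrDl mulrA.
Qed.

Lemma H2_of_lin a f g : analytic f -> analytic g ->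
  H2_of (fun t => a * f t + g t) = a *: H2_of f + H2_of g.
Proof.
move=> af ag; apply: val_inj; apply: (etrans (H2_ofE (analytic_lin a af ag))).
by rewrite (L2_of_lin a (analytic_L2 af) (analytic_L2 ag)) -(H2_ofE af) -(H2_ofE ag).
Qed.

Lemma rnorm_H2_of f : analytic f -> rnorm (H2_of f) ^+ 2 = sqint f.
Proof. by move=> af; rewrite -rnorm_L2_of ?analytic_L2// -H2_ofE. Qed.

Lemma circle_exp_mul_analytic (n : nat) f : analytic f ->
  analytic (fun t => circle_exp n%:Z t * f t).
Proof.
move=> [f2 f0]; split; first exact: circle_exp_mul_L2.
move=> m; rewrite -[RHS](f0 (m + n)%N); congr circle_int; apply/funext => t.
by rewrite mulrAC -circle_expD -PoszD addnS addnC mulrC.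
Qed.

Lemma shift_H2_of f : analytic f -> shift (H2_of f) = H2_of (fun t => circle_exp 1 t * f t).
Proof.
move=> af; have ae := circle_exp_mul_analytic 1 af.
apply: val_inj; rewrite /= (H2_ofE af) (H2_ofE ae).
have [g [gE ->]] := L2_of_val (analytic_L2 ae).
apply/L2_eqP; rewrite gE /=.
have : {ae mu, forall t, L2fun_val (repr (L2_of f)) t = f t}.
  by have [f' [fE ->]] := L2_of_val (analytic_L2 af); rewrite -fE; exact: L2_repr_pi.
by apply: filterS => t ->.
Qed.

Lemma iter_shift_H2_of n f : analytic f ->
  iter n (@shift R) (H2_of f) = H2_of (fun t => circle_exp n%:Z t * f t).
Proof.
move=> af; elim: n => [|n ih] /=.
  by congr H2_of; apply/funext => t; rewrite circle_exp0 mul1r.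
rewrite ih shift_H2_of; last exact: circle_exp_mul_analytic.
by congr H2_of; apply/funext => t; rewrite mulrA -circle_expD -intS.
Qed.

(** The polynomial with coefficients c, seen on the circle. *)
Definition cpoly n (c : nat -> C) (t : angle) := \sum_(i < n) c i * circle_exp i%:Z t.

Lemma analytic0 : analytic (fun=> 0).
Proof.
split; first by have [] := @circle_Lfun_submod_closed R _ (lee1n 2).
by move=> m; under eq_fun do rewrite mul0r; rewrite circle_int_cst.
Qed.

Lemma cpolyS n c : cpoly n.+1 c = fun t => c n * circle_exp n t + cpoly n c t.
Proof. by apply/funext => t; rewrite /cpoly big_ord_recr/= addrC. Qed.

Lemma cpoly_mul_analytic n c f : analytic f -> analytic (fun t => cpoly n c t * f t).
Proof.
move=> af; elim: n => [|n ih].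
  by rewrite (_ : (fun t => _) = fun=> 0); [exact: analytic0|apply/funext => t; rewrite /cpoly big_ord0 mul0r].
rewrite cpolyS (_ : (fun t => _) = fun t => c n * (circle_exp n t * f t) + cpoly n c t * f t).
  by apply: analytic_lin => //; exact: circle_exp_mul_analytic.
by apply/funext => t; rewrite mulrDl mulrA.
Qed.

Lemma H2_of0 : H2_of (fun=> 0) = 0.
Proof.
have := H2_of_lin (-1) analytic0 analytic0; rewrite scaleN1r addNr.
have -> // : (fun=> -1 * 0 + 0 : C) = (fun=> 0 : C) :> (angle -> C).
by apply/funext => t; rewrite mulr0 addr0.
Qed.

Lemma sum_iter_shift n (c : nat -> C) f : analytic f ->
  \sum_(i < n) c i *: iter i (@shift R) (H2_of f) = H2_of (fun t => cpoly n c t * f t).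
Proof.
move=> af; transitivity (\sum_(i < n) c i *: H2_of (fun t => circle_exp i%:Z t * f t)).
  by apply: eq_bigr => i _; rewrite iter_shift_H2_of.
elim: n => [|n ih].
  by rewrite big_ord0 -H2_of0; congr H2_of; apply/funext => t; rewrite /cpoly big_ord0 mul0r.
rewrite big_ord_recr [LHS]addrC [X in _ + X]ih -H2_of_lin.
- by congr H2_of; apply/funext => t; rewrite cpolyS mulrDl mulrA.
- exact: circle_exp_mul_analytic.
- exact: cpoly_mul_analytic.
Qed.

Lemma analytic1 : analytic (fun=> 1).
Proof.
split=> [|m]; last first.
  by under eq_fun do rewrite mul1r; rewrite circle_int_exp.
rewrite (_ : (fun=> _) = circle_exp 0); first exact: circle_exp_L2.
by apply/funext => t; rewrite circle_exp0.
Qed.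

Lemma cpoly_analytic n c : analytic (cpoly n c).
Proof. by have := cpoly_mul_analytic n c analytic1; under eq_fun do rewrite mulr1. Qed.

(** The Toeplitz operator of an analytic symbol is the multiplication by it, the
    product staying in the Hardy space. *)
Lemma toeplitz_H2_of phi f : phi \in circle_Lfun +oo%E -> analytic f ->
  analytic (fun t => phi t * f t) -> toeplitz phi (H2_of f) = H2_of (fun t => phi t * f t).
Proof.
move=> phioo af apf; pose p := H2_of (fun t => phi t * f t); rewrite -/p.
have pE : L2_of (fun t => phi t * (repr (H2_val (H2_of f)) : L2fun R) t) = H2_val p.
  apply: etrans (esym (H2_ofE apf)).
  have h2 : (fun t => phi t * (repr (H2_val (H2_of f)) : L2fun R) t) \in circle_Lfun 2%:E.
    exact: circle_Lfuny_mul phioo (repr_L2 _).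
  apply: (L2_of_ae h2 (analytic_L2 apf)).2.
  have : {ae mu, forall t, L2fun_val (repr (L2_of f)) t = f t}.
    by have [f' [fE ->]] := L2_of_val (analytic_L2 af); rewrite -fE; exact: L2_repr_pi.
  by apply: filterS => t; rewrite (H2_ofE af) => ->.
rewrite /toeplitz pE /H2_proj; apply: xget_unique => [h|q hq]; first by rewrite subrr linear0l.
apply: val_inj => /=; apply/eqP; rewrite eq_sym -subr_eq0 -(dnorm_eq0 (@L2_dot R)).
apply/eqP; apply: etrans (hq (p - q)); congr (L2_dot _ _); exact: esym (raddfB val p q).
Qed.
End Classes.

(** * The Riesz-Fischer theorem *)

Section RieszFischer.
Variable R : realType.
Local Notation C := (R[i]).
Local Notation angle := (measurableTypeR R).
Local Notation mu := (circle_measure R).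
Local Notation nc := (@Normc.normc R).
Arguments Normc.normc : simpl never.

Lemma circle_L2_mul_conj (f g : angle -> C) : f \in circle_Lfun 2%:E ->
  g \in circle_Lfun 2%:E -> (fun t => f t * conjC (g t)) \in circle_Lfun 1%E.
Proof.
move=> f2 g2; apply: circle_Lfun_mul => //.
by apply: circle_Lfun_conj => //; exact: lee1n.
Qed.

Lemma circle_int_mul_cpoly_conj (f : angle -> C) n (c : nat -> C) : f \in circle_Lfun 1%E ->
  circle_int (fun t => f t * conjC (cpoly n c t)) =
  \sum_(i < n) conjC (c i) * circle_int (fun t => f t * circle_exp (- i%:Z) t).
Proof.
move=> f1; rewrite (_ : (fun t => _) =
    fun t => \sum_(i < n) conjC (c i) * (f t * circle_exp (- i%:Z) t)).
  rewrite circle_int_sum; last by move=> i; apply: circle_L1Z; exact: circle_L1_mul_exp.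
  by apply: eq_bigr => i _; rewrite circle_intZ//; exact: circle_L1_mul_exp.
apply/funext => t; rewrite /cpoly rmorph_sum mulr_sumr/=; apply: eq_bigr => i _.
by rewrite rmorphM/= circle_expN mulrCA.
Qed.

Lemma cpoly_coef n (c : nat -> C) (k : nat) :
  circle_int (fun t => cpoly n c t * circle_exp (- k%:Z) t) = if (k < n)%N then c k else 0.
Proof.
have e1 j : @circle_exp R j \in circle_Lfun 1%E.
  by apply: circle_L2_L1; exact: circle_exp_L2.
rewrite (_ : (fun t => _) = fun t => \sum_(i < n) c i * circle_exp (i%:Z - k%:Z) t); last first.
  by apply/funext => t; rewrite /cpoly mulr_suml; apply: eq_bigr => i _; rewrite -mulrA -circle_expD.
rewrite circle_int_sum; last by move=> i; exact: circle_L1Z.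
under eq_bigr do rewrite circle_intZ// circle_int_exp subr_eq0 eqz_nat.
case: ltnP => kn.
  rewrite (bigD1 (Ordinal kn))//= eqxx mulr1 big1 ?addr0// => i ik.
  by rewrite (_ : (_ == k)%N = false) ?mulr0//; apply/negbTE; apply: contra ik => /eqP ik; apply/eqP/val_inj.
by rewrite big1// => i _; rewrite ltn_eqF ?mulr0// (leq_trans _ kn).
Qed.

Lemma sqint_cpoly n (c : nat -> C) : sqint (cpoly n c) = \sum_(i < n) nc (c i) ^+ 2.
Proof.
apply: (@complexI R); rewrite -circle_int_sqint circle_int_mul_cpoly_conj; last first.
  by apply: circle_L2_L1; apply: analytic_L2; exact: cpoly_analytic.
rewrite rmorph_sum; apply: eq_bigr => i _.
by rewrite cpoly_coef ltn_ord mulrC mul_conj_normc.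
Qed.

(** The polynomial formed with the first coefficients of f is orthogonal to the
    remainder. *)
Lemma sqint_sub_cpoly (f : angle -> C) n (c : nat -> C) : f \in circle_Lfun 2%:E ->
  (forall i, (i < n)%N -> circle_int (fun t => f t * circle_exp (- i%:Z) t) = c i) ->
  sqint (fun t => f t - cpoly n c t) = sqint f - \sum_(i < n) nc (c i) ^+ 2.
Proof.
move=> f2 fc; set S := \sum_(i < n) _; have p2 := analytic_L2 (cpoly_analytic n c).
have fp : circle_int (fun t => f t * conjC (cpoly n c t)) = S%:C%C.
  rewrite circle_int_mul_cpoly_conj ?circle_L2_L1// rmorph_sum.
  by apply: eq_bigr => i _; rewrite fc// mulrC mul_conj_normc.
have ff := circle_L2_mul_conj f2 f2; have pp := circle_L2_mul_conj p2 p2.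
have f1 := circle_L2_mul_conj f2 p2; have f1' := circle_L2_mul_conj p2 f2.
apply: (@complexI R); rewrite -circle_int_sqint rmorphB/=.
rewrite (_ : (fun t => _) = fun t => (f t * conjC (f t) - f t * conjC (cpoly n c t)) -
    (cpoly n c t * conjC (f t) - cpoly n c t * conjC (cpoly n c t))); last first.
  by apply/funext => t; rewrite rmorphB/=; ring.
rewrite circle_intB ?circle_L1B// !circle_intB// fp !circle_int_sqint sqint_cpoly -/S.
have -> : circle_int (fun t => cpoly n c t * conjC (f t)) = S%:C%C.
  rewrite (_ : (fun t => _) = fun t => conjC (f t * conjC (cpoly n c t))).
    by rewrite circle_int_conj// fp; apply/eqP; rewrite eq_complex/= oppr0 !eqxx.
  by apply/funext => t; rewrite rmorphM/= conjCK mulrC.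
by rewrite subrr subr0.
Qed.

(** Nested segments around u k give the limit. *)
Lemma geometric_cvg (u : nat -> R) (w : R) : 0 <= w ->
  (forall k, `|u k.+1 - u k| <= 2^-1 ^+ k * w) ->
  exists l, forall k, `|u k - l| <= 2 * (2^-1 ^+ k * w).
Proof.
move=> w0 hu; have h0 k : 0 <= 2^-1 ^+ k * w by rewrite mulr_ge0// exprn_ge0.
have [|k|p hp] := @nested_segments R (fun k => u k - 2 * (2^-1 ^+ k * w)) (fun k => 4 * (2^-1 ^+ k * w)).
- by move=> k; rewrite mulr_ge0.
- have := hu k; rewrite ler_norml exprS => /andP[h1 h2].
  by split; lra.
exists p => k; have /andP[h1 h2] := hp k.
by rewrite ler_norml; lra.
Qed.

(** Superior limits are measurable without any discussion of convergence. *)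
Let limsup (u : nat -> R) := fine (limn_esup (fun k => (u k)%:E)).

Let limsupE (u : nat -> R) l : u k @[k --> \oo] --> l -> limsup u = l.
Proof.
move=> ul; rewrite /limsup; have : (u k)%:E @[k --> \oo] --> l%:E by exact: cvg_EFin (nearW _ _) ul.
by move=> /cvg_limn_einf_sup[_ ->].
Qed.

Let cvg_normc_eq (u : nat -> C) (x c : C) : nc (u k - x) @[k --> \oo] --> 0 ->
  (\forall k \near \oo, u k = c) -> x = c.
Proof.
move=> ux uc; apply/eqP; rewrite eq_sym -subr_eq0 -normc_eq0; apply/eqP.
have h : nc (u k - x) @[k --> \oo] --> nc (c - x).
  by apply: cvg_near_cst; apply: filterS uc => k ->.
exact: (cvg_unique _ h ux).
Qed.

Lemma cvg_sqr_normc (u : nat -> C) x : nc (u k - x) @[k --> \oo] --> 0 ->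
  nc (u k) ^+ 2 @[k --> \oo] --> nc x ^+ 2.
Proof.
move=> ux; have hn : nc (u k) @[k --> \oo] --> nc x.
  apply/cvgrPdist_le => e e0; have /cvgrPdist_le/(_ e e0) := ux; apply: filterS => k.
  rewrite sub0r normrN ger0_norm ?normc_ge0// => hk; apply: le_trans hk.
  have h1 : nc x <= nc (u k) + nc (u k - x).
    by rewrite -[in leLHS](subKr (u k) x) ler_normcB.
  have h2 : nc (u k) <= nc (u k - x) + nc x.
    by rewrite -[in leLHS](subrK x (u k)) le_normcD.
  by rewrite ler_norml; lra.
exact: cvgM.
Qed.

(** Along a fast subsequence the partial sums converge pointwise almost
    everywhere and are dominated in square mean. *)
Theorem riesz_fischer (a : nat -> C) (B : R) :
  (forall n, \sum_(i < n) nc (a i) ^+ 2 <= B) ->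
  exists f, [/\ analytic f, forall k : nat, circle_int (fun t => f t * circle_exp (- k%:Z) t) = a k &
    sqint f <= B].
Proof.
pose S n := \sum_(i < n) nc (a i) ^+ 2; move=> SB.
have Smono n m : (n <= m)%N -> S n <= S m.
  move=> nm; rewrite /S (big_ord_widen m (fun i => nc (a i) ^+ 2) nm) big_mkcond/=.
  by apply: ler_sum => i _; case: ifP => // _; exact: sqr_ge0.
have hs : has_sup (range S) by split; [exists (S 0%N), 0%N|exists B => _ [n _ <-]; exact: SB].
have /boolp.choice[N0 hN0] : forall k, exists n, forall m, (n <= m)%N -> S m - S n <= 8^-1 ^+ k.
  move=> k.
  have e0 : 0 < 8^-1 ^+ k :> R by rewrite exprn_gt0 ?invr_gt0.
  have [_ [n _ <-] hn] := sup_adherent e0 hs.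
  exists n => m _; have := ub_le_sup hs.2 (ex_intro2 _ _ m I erefl : range S (S m)); lra.
(* The summand k.+1 makes N tend to infinity even if the series is finite. *)
pose N k := (k.+1 + \sum_(j < k.+1) N0 j)%N.
have NS k : (N k <= N k.+1)%N by rewrite /N leq_add// [leqRHS]big_ord_recr/= leq_addr.
have N0N k : (N0 k <= N k)%N by rewrite /N big_ord_recr/= addnA leq_addl.
have SN k : S (N k.+1) - S (N k) <= 8^-1 ^+ k.
  have := hN0 k (N k.+1) (leq_trans (N0N k) (NS k)); have := Smono _ _ (N0N k); lra.
pose F k := cpoly (N k) a; pose d k t := F k.+1 t - F k t.
have F2 k : F k \in circle_Lfun 2%:E := analytic_L2 (cpoly_analytic (N k) a).
have mF k : cmeasurable (F k) by have /circle_L2P[] := F2 k.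
have md k : cmeasurable (d k) by exact: cmeasurableB.
have sqd k : sqint (d k) <= 8^-1 ^+ k.
  rewrite /d sqint_sub_cpoly ?F2//; first by rewrite sqint_cpoly; exact: SN.
  by move=> i iN; rewrite cpoly_coef (leq_trans iN (NS k)).
(* The weight 4 ^+ k is affordable since sqd decays like 8^-1 ^+ k, and it makes
   the increments d k t summable wherever G t is finite. *)
pose g k t : \bar R := (4 ^+ k * nc (d k t) ^+ 2)%:E.
have g0 k t : (0 <= g k t)%E by rewrite lee_fin mulr_ge0 ?sqr_ge0 ?exprn_ge0.
have mg k : measurable_fun setT (g k).
  apply/measurable_EFinP; apply: measurable_funM => //.
  by apply: measurable_funX; exact: measurable_normc.
pose G t := (\sum_(0 <= k <oo) g k t)%E.
have G0 t : (0 <= G t)%E by apply: nneseries_ge0.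
have mG : measurable_fun setT G by apply: ge0_emeasurable_sum.
have intg k : (\int[mu]_t g k t <= (2^-1 ^+ k)%:E)%E.
  rewrite /g; under eq_integral do rewrite EFinM.
  have /circle_L2P[_ id2] : d k \in circle_Lfun 2%:E.
    rewrite (_ : d k = fun t => (-1) * F k t + F k.+1 t).
      exact: circle_L2_lin.
    by apply/funext => t; rewrite mulN1r addrC.
  rewrite ge0_integralZl_EFin ?exprn_ge0//; first last.
  - by apply/measurable_EFinP; apply: measurable_funX; exact: measurable_normc.
  - by move=> t _; rewrite lee_fin sqr_ge0.
  rewrite -[integral _ _ _]fineK; last exact: (integrable_fin_num measurableT id2).
  rewrite -EFinM lee_fin -[fine _]/(sqint (d k)).
  rewrite (le_trans (ler_wpM2l (exprn_ge0 _ _) (sqd k)))// -exprMn.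
  by rewrite (_ : 4 * 8^-1 = 2^-1 :> R)//; field.
have iG : mu.-integrable setT G.
  apply/integrableP; split => //.
  under eq_integral do rewrite gee0_abs//.
  rewrite /G integral_nneseries//; apply: (@le_lt_trans _ _ 2%:E); last exact: ltry.
  apply: lime_le; first by apply: is_cvg_nneseries => n _ _; exact: integral_ge0.
  apply: nearW => n; rewrite big_mkord (le_trans (lee_sum _ (fun (k : 'I_n) _ => intg k)))//.
  by rewrite sumEFin lee_fin geometric_half_le2.
pose f t : C := Complex (limsup (fun k => complex.Re (F k t))) (limsup (fun k => complex.Im (F k t))).
have mf : cmeasurable f.
  split; apply: measurableT_comp => //; apply: measurable_fun_limn_esup => k;
    apply/measurable_EFinP; [exact: (mF k).1|exact: (mF k).2].
have fF : {ae mu, forall t, G t \is a fin_num ->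
    forall k, nc (F k t - f t) ^+ 2 <= 16 * (4^-1 ^+ k * fine (G t))}.
  apply: aeW => t Gfin; pose w := Num.sqrt (fine (G t)).
  have w0 : 0 <= w by exact: sqrtr_ge0.
  have w2 : w ^+ 2 = fine (G t) by rewrite sqr_sqrtr// fine_ge0.
  have dw k : nc (d k t) <= 2^-1 ^+ k * w.
    have : (g k t <= G t)%E.
      rewrite /G (nneseries_split 0 k.+1)//=.
      rewrite add0n; apply: (le_trans _ (leeDl _ _)); last exact: nneseries_ge0.
      by rewrite big_nat_recr//=; apply: leeDr; exact: sume_ge0.
    rewrite -(fineK Gfin) lee_fin -w2 => h.
    rewrite -ler_sqr ?nnegrE ?normc_ge0 ?mulr_ge0 ?exprn_ge0// exprMn -exprM mulnC exprM.
    rewrite (_ : 2^-1 ^+ 2 = 4^-1 :> R); last by field.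
    by rewrite exprVn ler_pdivlMl ?exprn_gt0.
  have [l1 h1] : exists l, forall k, `|complex.Re (F k t) - l| <= 2 * (2^-1 ^+ k * w).
    apply: geometric_cvg => // k; apply: le_trans (dw k).
    by rewrite (le_trans _ (ler_Re_normc _))// /d; case: (F k.+1 t) (F k t) => ? ? [].
  have [l2 h2] : exists l, forall k, `|complex.Im (F k t) - l| <= 2 * (2^-1 ^+ k * w).
    apply: geometric_cvg => // k; apply: le_trans (dw k).
    by rewrite (le_trans _ (ler_Im_normc _))// /d; case: (F k.+1 t) (F k t) => ? ? [].
  have lim0 : (2 * (2^-1 ^+ k * w)) @[k --> \oo] --> 0.
    rewrite -(mulr0 2) -(mul0r w); apply: cvgM; first exact: cvg_cst.
    apply: cvgM; last exact: cvg_cst.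
    by apply: cvg_expr; rewrite ger0_norm// invf_lt1// ltr1n.
  have cvgl (u : nat -> R) l : (forall k, `|u k - l| <= 2 * (2^-1 ^+ k * w)) -> u k @[k --> \oo] --> l.
    move=> hu; apply/cvgrPdist_le => e e0.
    have /cvgrPdist_le/(_ e e0) := lim0; apply: filterS => k; rewrite sub0r normrN => h.
    by rewrite distrC (le_trans (hu k))// (le_trans (ler_norm _)).
  have -> : f t = Complex l1 l2 by rewrite /f (limsupE (cvgl _ _ h1)) (limsupE (cvgl _ _ h2)).
  move=> k; have : nc (F k t - Complex l1 l2) <= 4 * (2^-1 ^+ k * w).
    apply: (le_trans (normc_le_ReIm _)).
    by move: (h1 k) (h2 k); case: (F k t) => x y /= *; lra.
  move: (normc_ge0 (F k t - Complex l1 l2)); move: (nc _) => A A0 AB.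
  have {AB} : A ^+ 2 <= (4 * (2^-1 ^+ k * w)) ^+ 2 by rewrite !expr2 ler_pM.
  move=> /le_trans; apply.
  rewrite !exprMn -exprM mulnC exprM w2 (_ : 2^-1 ^+ 2 = 4^-1 :> R); last by field.
  by rewrite (_ : 4 ^+ 2 = 16 :> R)//; ring.
have {}fF : {ae mu, forall t, forall k, nc (F k t - f t) ^+ 2 <= 16 * (4^-1 ^+ k * fine (G t))}.
  by move: fF (integrable_ae measurableT iG); apply: filterS2 => t h /(_ I) /h.
(* Both nc (F k t) and nc (f t) are at most nc (F 0%N t) plus 8 times the square
   root of G t. *)
pose h t := 2 * nc (F 0%N t) ^+ 2 + 128 * fine (G t).
have ih : mu.-integrable setT (EFin \o h).
  have /circle_L2P[_ iF0] := F2 0%N.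
  have iG' : mu.-integrable setT (fun t => (fine (G t))%:E).
    apply: (le_integrable measurableT _ _ iG).
      exact/measurable_EFinP/measurableT_comp.
    by move=> t _; case: (G t) => [r| |] //=; rewrite ?normr0 ?leey.
  rewrite (_ : _ \o _ = (fun t => 2%:E * (nc (F 0%N t) ^+ 2)%:E) \+ (fun t => 128%:E * (fine (G t))%:E))%E.
    by apply: integrableD => //; exact: integrableZl.
  by apply/funext.
have Fh : {ae mu, forall t, forall k, nc (F k t) ^+ 2 <= h t}.
  apply: filterS fF => t hF k; rewrite /h.
  have G0' : 0 <= fine (G t) by rewrite fine_ge0.
  have k1 : 4^-1 ^+ k <= 1 :> R by rewrite exprn_ile1 ?invr_ge0// invf_le1// ler1n.
  have h0 := hF 0%N; have hk := hF k; rewrite expr0 mul1r in h0.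
  have {}hk : nc (F k t - f t) ^+ 2 <= 16 * fine (G t).
    by apply: (le_trans hk); rewrite ler_pM2l// ler_piMl.
  have : nc (F k t) <= nc (F 0%N t) + (nc (F k t - f t) + nc (F 0%N t - f t)).
    rewrite -[in leLHS](subrK (F 0%N t) (F k t)) addrC (le_trans (le_normcD _ _))// lerD2l.
    by rewrite (_ : F k t - F 0%N t = (F k t - f t) - (F 0%N t - f t)) ?ler_normcB//; ring.
  move: (normc_ge0 (F k t)) (normc_ge0 (F 0%N t)) (normc_ge0 (F k t - f t)) (normc_ge0 (F 0%N t - f t)) hk h0 G0'.
  move: (nc (F k t)) (nc (F 0%N t)) (nc (F k t - f t)) (nc (F 0%N t - f t)) (fine (G t)) => A B' P Q g' *.
  have : A ^+ 2 <= (B' + (P + Q)) ^+ 2 by rewrite !expr2 ler_pM.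
  have := sqr_ge0 (B' - (P + Q)); have := sqr_ge0 (P - Q); nra.
have fh : {ae mu, forall t, nc (f t) ^+ 2 <= h t}.
  apply: filterS fF => t hF; rewrite /h.
  have G0' : 0 <= fine (G t) by rewrite fine_ge0.
  have h0 := hF 0%N; rewrite expr0 mul1r in h0.
  have : nc (f t) <= nc (F 0%N t) + nc (F 0%N t - f t).
    by rewrite -[in leLHS](subKr (F 0%N t) (f t)) ler_normcB.
  move: (normc_ge0 (f t)) (normc_ge0 (F 0%N t)) (normc_ge0 (F 0%N t - f t)) h0 G0'.
  move: (nc (f t)) (nc (F 0%N t)) (nc (F 0%N t - f t)) (fine (G t)) => A B' P g' *.
  have : A ^+ 2 <= (B' + P) ^+ 2 by rewrite !expr2 ler_pM.
  have := sqr_ge0 (B' - P); nra.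
have Fcvg : {ae mu, forall t, nc (F k t - f t) @[k --> \oo] --> 0}.
  apply: filterS fF => t hF; set w := Num.sqrt (16 * fine (G t)).
  have hk k : nc (F k t - f t) <= 2^-1 ^+ k * w.
    rewrite -ler_sqr ?nnegrE ?normc_ge0 ?mulr_ge0 ?exprn_ge0 ?sqrtr_ge0//.
    rewrite exprMn sqr_sqrtr ?mulr_ge0 ?fine_ge0// (le_trans (hF k))//.
    by rewrite mulrCA -exprM mulnC exprM (_ : 2^-1 ^+ 2 = 4^-1 :> R)//; field.
  have lim0 : 2^-1 ^+ k * w @[k --> \oo] --> 0.
    rewrite -(mul0r w); apply: cvgM; last exact: cvg_cst.
    by apply: cvg_expr; rewrite ger0_norm// invf_lt1// ltr1n.
  apply: (squeeze_cvgr _ (cvg_cst 0) lim0).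
  by apply: nearW => k; rewrite normc_ge0 hk.
have le1 (x : R) : 0 <= x -> x <= 1 + x ^+ 2 by move=> x0; nra.
have ih1 : mu.-integrable setT (EFin \o (fun t => 1 + h t)).
  rewrite (_ : _ \o _ = (fun t => (1%:E + (h t)%:E)%E)); last by apply/funext.
  by apply: integrableD => //; apply/Lfun1_integrable; have /circle_LfunP[] := circle_L1_cst (1 : C).
have f2 : f \in circle_Lfun 2%:E.
  apply/circle_L2P; split => //; apply: (integrable_ae_le _ ih).
    by apply: measurable_funX; exact: measurable_normc.
  by apply: filterS fh => t; rewrite ger0_norm// sqr_ge0.
have fcoef n : nc (circle_int (fun t => F k t * circle_exp n t) - circle_int (fun t => f t * circle_exp n t)) @[k --> \oo] --> 0.
  have [|||||_ //] := @circle_int_dominated R (fun k t => F k t * circle_exp n t)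
    (fun t => f t * circle_exp n t) (fun t => 1 + h t).
  - by move=> k; apply: cmeasurableM => //; exact: circle_exp_measurable.
  - by apply: cmeasurableM => //; exact: circle_exp_measurable.
  - by [].
  - apply: filterS Fh => t hF k; rewrite Normc.normcM normc_circle_exp mulr1.
    by rewrite (le_trans (le1 _ (normc_ge0 _)))// lerD2l.
  - apply: filterS Fcvg => t; rewrite [X in X @ _ --> _ -> _](_ : _ =
        fun k => nc (F k t * circle_exp n t - f t * circle_exp n t)) //; apply/funext => k.
    by rewrite -mulrBl Normc.normcM normc_circle_exp mulr1.
exists f; split.
- split=> // m; apply: (cvg_normc_eq (fcoef m.+1)).
  by apply: nearW => k; have [_ ->] := cpoly_analytic (N k) a.
- move=> k; apply: (cvg_normc_eq (fcoef (- k%:Z))).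
  by exists k => // j /= kj; rewrite cpoly_coef (leq_trans _ (leq_addr _ _)).
- have sqintE (g' : angle -> C) : circle_int (fun t => (nc (g' t) ^+ 2)%:C%C) = (sqint g')%:C%C.
    by rewrite -circle_int_sqint; under [in RHS]eq_fun do rewrite mul_conj_normc.
  have [|||||_] := @circle_int_dominated R (fun k t => (nc (F k t) ^+ 2)%:C%C)
    (fun t => (nc (f t) ^+ 2)%:C%C) h.
  + by move=> k; apply: cmeasurable_real; apply: measurable_funX; exact: measurable_normc.
  + by apply: cmeasurable_real; apply: measurable_funX; exact: measurable_normc.
  + by [].
  + by apply: filterS Fh => t hF k; rewrite normc_real ger0_norm ?sqr_ge0.
  + apply: filterS Fcvg => t hF.
    have := cvg_sqr_normc hF.
    move=> /cvgrPdist_le hn2; apply/cvgrPdist_le => e e0.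
    apply: filterS (hn2 e e0) => k; rewrite sub0r normrN -rmorphB normc_real normr_id.
    by rewrite distrC.
  rewrite sqintE => hc; apply/ler_addgt0Pl => e e0.
  move/cvgrPdist_le : hc => /(_ e e0) [k _ /(_ k (leqnn k))] /=.
  rewrite sqintE sub0r normrN ger0_norm ?normc_ge0// -rmorphB normc_real ler_norml => /andP[+ _].
  by have := SB (N k); rewrite -sqint_cpoly -/(F k); lra.
Qed.
End RieszFischer.

(** * Approximation by polynomials in H^2 *)

Section HardyApproximation.
Variable R : realType.
Local Notation C := (R[i]).
Local Notation angle := (measurableTypeR R).
Local Notation mu := (circle_measure R).
Local Notation nc := (@Normc.normc R).
Arguments Normc.normc : simpl never.

Definition coef (f : angle -> C) (k : nat) := circle_int (fun t => f t * circle_exp (- k%:Z) t).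

Lemma sqint_le f g M : f \in circle_Lfun 2%:E -> g \in circle_Lfun 2%:E ->
  {ae mu, forall t, nc (f t) <= M * nc (g t)} -> sqint f <= M ^+ 2 * sqint g.
Proof.
move=> /circle_L2P[mf if2] /circle_L2P[mg ig2] fg.
have mM : mu.-integrable setT (fun t => (M ^+ 2 * nc (g t) ^+ 2)%:E).
  by under eq_fun do rewrite EFinM; exact: integrableZl.
rewrite /sqint -RintegralZl// /Rintegral fine_le ?integrable_fin_num//.
apply: ae_ge0_le_integral => //.
- by move=> t _; rewrite lee_fin sqr_ge0.
- exact: measurable_int if2.
- by move=> t _; rewrite lee_fin mulr_ge0 ?sqr_ge0.
- exact: measurable_int mM.
apply: filterS fg => t fg _; rewrite lee_fin -exprMn.
by rewrite !expr2 ler_pM ?normc_ge0.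
Qed.

Lemma sqint_ae f g : f \in circle_Lfun 2%:E -> g \in circle_Lfun 2%:E ->
  {ae mu, forall t, f t = g t} -> sqint f = sqint g.
Proof. by move=> f2 g2 fg; rewrite -(rnorm_L2_of f2) -(rnorm_L2_of g2) (proj2 (L2_of_ae f2 g2) fg). Qed.

Lemma circle_L2B (f g : angle -> C) : f \in circle_Lfun 2%:E -> g \in circle_Lfun 2%:E ->
  (fun t => f t - g t) \in circle_Lfun 2%:E.
Proof.
move=> f2 g2; rewrite (_ : (fun t => _) = fun t => -1 * g t + f t); first exact: circle_L2_lin.
by apply/funext => t; rewrite mulN1r addrC.
Qed.

Lemma analyticB f g : analytic f -> analytic g -> analytic (fun t => f t - g t : C).
Proof.
move=> f2 g2; rewrite (_ : (fun t => _) = fun t => -1 * g t + f t); first exact: analytic_lin.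
by apply/funext => t; rewrite mulN1r addrC.
Qed.

Lemma coefB f g k : f \in circle_Lfun 2%:E -> g \in circle_Lfun 2%:E ->
  coef (fun t => f t - g t) k = coef f k - coef g k.
Proof.
move=> /circle_L2_L1 f1 /circle_L2_L1 g1; rewrite /coef -circle_intB; try exact: circle_L1_mul_exp.
by congr circle_int; apply/funext => t; rewrite mulrBl.
Qed.

Lemma bessel (f : angle -> C) n : f \in circle_Lfun 2%:E ->
  \sum_(i < n) nc (coef f i) ^+ 2 <= sqint f.
Proof.
move=> f2; rewrite -subr_ge0 -(@sqint_sub_cpoly _ f n (coef f))//.
exact: sqint_ge0.
Qed.

(** Bessel's inequality for the coefficient of index 0 of a rotated function. *)
Lemma normc_fourier_le (f : angle -> C) n : f \in circle_Lfun 2%:E ->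
  nc (circle_int (fun t => f t * circle_exp n t)) ^+ 2 <= sqint f.
Proof.
move=> f2; have g2 := circle_exp_mul_L2 n f2.
have := bessel 1 g2; rewrite big_ord1 /coef.
under eq_fun do rewrite oppr0 circle_exp0 mulr1 mulrC.
move=> /le_trans; apply; rewrite -[leRHS]mul1r -[X in X * _](expr1n _ 2).
apply: sqint_le => //; apply: aeW => t.
by rewrite Normc.normcM normc_circle_exp.
Qed.

Lemma analytic_unique f g : analytic f -> analytic g -> (forall k, coef f k = coef g k) ->
  {ae mu, forall t, f t = g t}.
Proof.
move=> af ag fg; have ah := analyticB af ag.
have : {ae mu, forall t, f t - g t = 0}.
  apply: circle_fourier_unique => [|[n|n]]; first exact/circle_L2_L1/analytic_L2.
  - case: n => [|n]; last by have [_ ->] := ah.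
    by rewrite -[0]oppr0 -[LHS]/(coef _ 0%N) coefB ?fg ?subrr ?oppr0//; exact: analytic_L2.
  - rewrite NegzE -[LHS]/(coef _ n.+1) coefB ?fg ?subrr//; exact: analytic_L2.
by apply: filterS => t /eqP; rewrite subr_eq0 => /eqP.
Qed.

(** The Fourier series of an analytic function converges to it in square mean,
    because the Riesz-Fischer sum has the same coefficients and no larger norm than
    Bessel's inequality allows. *)
Lemma analytic_approx f e : analytic f -> 0 < e ->
  exists n, sqint (fun t => f t - cpoly n (coef f) t) <= e.
Proof.
move=> af e0; have f2 := analytic_L2 af.
pose S n := \sum_(i < n) nc (coef f i) ^+ 2.
have hs : has_sup (range S).
  by split; [exists (S 0%N), 0%N|exists (sqint f) => _ [n _ <-]; exact: bessel].
have [|g [ag gc gB]] := @riesz_fischer R (coef f) (sup (range S)).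
  by move=> n; apply: ub_le_sup; [exact: hs.2|exists n].
have fg := analytic_unique af ag (fun k => esym (gc k)).
have [_ [n _ <-] hn] := sup_adherent e0 hs; exists n.
rewrite sqint_sub_cpoly// (sqint_ae f2 (analytic_L2 ag) fg) -/(S n); lra.
Qed.

Lemma analytic_closed (f : angle -> C) : f \in circle_Lfun 2%:E ->
  (forall e, 0 < e -> exists2 g, analytic g & sqint (fun t => f t - g t) <= e) -> analytic f.
Proof.
move=> f2 hf; split=> // m; apply/eqP; rewrite -normc_eq0 -sqrf_eq0 eq_le sqr_ge0 andbT.
apply/ler_addgt0Pl => e e0; rewrite addr0; have [g [g2 g0] fg] := hf e e0.
apply: le_trans fg; apply: le_trans (normc_fourier_le m.+1 (circle_L2B f2 g2)).
rewrite (_ : circle_int (fun t => (f t - g t) * _) = circle_int (fun t => f t * circle_exp m.+1 t))//.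
under eq_fun do rewrite mulrBl.
by rewrite circle_intB ?g0 ?subr0//; apply: circle_L1_mul_exp; exact: circle_L2_L1.
Qed.

(** Clear for polynomials f, and the analytic functions are closed in L^2. *)
Lemma bounded_mul_analytic phi f M : analytic phi -> {ae mu, forall t, nc (phi t) <= M} ->
  analytic f -> analytic (fun t => phi t * f t).
Proof.
move=> aphi phiM af; have mphi : cmeasurable phi by have /analytic_L2/circle_L2P[] := aphi.
have mul2 g : g \in circle_Lfun 2%:E -> (fun t => phi t * g t) \in circle_Lfun 2%:E.
  by move=> g2; under eq_fun do rewrite mulrC; exact: circle_L2_mul_bounded phiM.
apply: analytic_closed => [|e e0]; first exact/mul2/analytic_L2.
have e1 : 0 < e / (M ^+ 2 + 1) by rewrite divr_gt0 ?ltr_wpDl ?sqr_ge0.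
have [n hn] := analytic_approx af e1.
exists (fun t => cpoly n (coef f) t * phi t); first exact: cpoly_mul_analytic.
have p2 := analytic_L2 (cpoly_analytic n (coef f)).
have d2 := circle_L2B (analytic_L2 af) p2.
apply: (@le_trans _ _ (M ^+ 2 * sqint (fun t => f t - cpoly n (coef f) t))).
  rewrite (_ : (fun t => phi t * _ - _) = fun t => phi t * (f t - cpoly n (coef f) t)).
    apply: sqint_le => //; first exact: mul2.
    by apply: filterS phiM => t h; rewrite Normc.normcM ler_wpM2r ?normc_ge0.
  by apply/funext => t; rewrite mulrBr [cpoly _ _ _ * _]mulrC.
apply: (le_trans (ler_wpM2l (sqr_ge0 M) hn)).
rewrite mulrA ler_pdivrMr ?ltr_wpDl ?sqr_ge0//.
by rewrite mulrC ler_pM2l// lerDl.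
Qed.
End HardyApproximation.

(** * Orbits of the shift and units *)

Section HardyUnits.
Variable R : realType.
Local Notation C := (R[i]).
Local Notation angle := (measurableTypeR R).
Local Notation mu := (circle_measure R).
Local Notation nc := (@Normc.normc R).
Arguments Normc.normc : simpl never.

(** Testing against the partial sums of the Cauchy kernel bounds the Poisson
    integrals of h from below, hence its radial limits. *)
Lemma ae_ge0_of_polynomials (h : angle -> R) :
  (fun t => (h t)%:C%C) \in circle_Lfun 1%E ->
  (forall n c, 0 <= \int[mu]_t (nc (cpoly n c t) ^+ 2 * h t)) ->
  {ae mu, forall t, 0 <= h t}.
Proof.
move=> h1 hp; have /circle_L1P[mh ih] := h1.
have mhR : measurable_fun setT h by case: mh.
have poisson_Re_ge0 r x : 0 <= r < 1 -> 0 <= complex.Re (poisson_int (fun t => (h t)%:C%C) r x).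
  move=> r01; set z := polar r x; have z1 : nc z < 1 := normc_polar_lt1 x r01.
  set K := cauchy_kernel z; pose p N := cpoly N (fun i => conjC (z ^+ i)).
  have K1 t : nc (K t) <= (1 - nc z)^-1 by exact: cauchy_kernel_bound.
  have pE N t : conjC (p N t) = K t - z ^+ N * circle_exp (- N%:Z) t * K t.
    rewrite /K {1}(cauchy_kernel_expansion t N z1) addrK /p /cpoly rmorph_sum.
    by apply: eq_bigr => i _; rewrite rmorphM/= conjCK circle_expN.
  have pK N t : nc (conjC (p N t) - K t) = nc (z ^+ N) * nc (K t).
    by rewrite pE addrAC subrr add0r -normcN opprK !Normc.normcM normc_circle_exp mulr1.
  have pB N t : nc (p N t) <= 2 * (1 - nc z)^-1.
    rewrite -normc_conj -[X in nc X](subrK (K t)) (le_trans (le_normcD _ _))// pK.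
    rewrite mulr_natl mulr2n lerD// (le_trans _ (K1 t))// ler_piMl ?normc_ge0//.
    by rewrite normcX exprn_ile1 ?normc_ge0// ltW.
  have mp N : cmeasurable (p N) by have /analytic_L2/circle_L2P[] := cpoly_analytic N (fun i => conjC (z ^+ i)).
  have mK : cmeasurable K by exact: cauchy_kernel_measurable.
  have [|||||f1 hc] := @circle_int_dominated R (fun N t => (nc (p N t) ^+ 2 * h t)%:C%C)
    (fun t => (nc (K t) ^+ 2 * h t)%:C%C) (fun t => (2 * (1 - nc z)^-1) ^+ 2 * `|h t|).
  - move=> N; apply: cmeasurable_real; apply: measurable_funM => //.
    by apply: measurable_funX; exact: measurable_normc.
  - apply: cmeasurable_real; apply: measurable_funM => //.
    by apply: measurable_funX; exact: measurable_normc.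
  - rewrite (_ : _ \o _ = fun t => ((2 * (1 - nc z)^-1) ^+ 2)%:E * (nc (h t)%:C%C)%:E)%E.
      exact: integrableZl.
    by apply/funext => t; rewrite /= normc_real.
  - apply: aeW => t N; rewrite normc_real normrM ler_wpM2r// ger0_norm ?sqr_ge0//.
    by rewrite !expr2 ler_pM ?normc_ge0.
  - apply: aeW => t; have : nc (conjC (p N t) - K t) @[N --> \oo] --> 0.
      under eq_fun do rewrite pK; rewrite -(mul0r (nc (K t))).
      by apply: cvgM; [exact: cvg_exprn_normc|exact: cvg_cst].
    move=> /cvg_sqr_normc hs; have : (nc (p N t) ^+ 2 - nc (K t) ^+ 2) * h t @[N --> \oo] --> 0.
      rewrite -(mul0r (h t)) -(subrr (nc (K t) ^+ 2)); apply: cvgM; last exact: cvg_cst.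
      apply: cvgB; last exact: cvg_cst.
      by move: hs; under eq_fun do rewrite normc_conj.
    move=> /cvgrPdist_le hl; apply/cvgrPdist_le => e e0; apply: filterS (hl e e0) => N.
    by rewrite !sub0r !normrN -rmorphB -mulrBl normc_real normr_id.
  rewrite (_ : poisson_int _ _ _ = (1 - r ^+ 2)%:C%C * circle_int (fun t => (nc (K t) ^+ 2 * h t)%:C%C)).
    have : 0 <= complex.Re (circle_int (fun t => (nc (K t) ^+ 2 * h t)%:C%C)).
      apply/ler_addgt0Pl => e e0.
      move/cvgrPdist_le : hc => /(_ e e0) [N _ /(_ N (leqnn N))] /=.
      rewrite sub0r normrN ger0_norm ?normc_ge0// => /(le_trans (ler_Re_normc _)) /=.
      by rewrite ler_norml => /andP[_]; have := hp N (fun i => conjC (z ^+ i)); rewrite -/(p N); lra.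
    case: (circle_int _) => a b /= a0; rewrite mul0r subr0 mulr_ge0//.
    by move: r01 => /andP[? ?]; nra.
  rewrite -circle_intZ//; congr circle_int; apply/funext => t.
  by rewrite poisson_normc_cauchy -/z -/K; set A := 1 - _; move: (_ ^+ 2) => B; rewrite -!(rmorphM (real_complex R)) mulrA.
apply: filterS (poisson_radial_limit h1) => x hx; apply/ler_addgt0Pl => e e0.
have [d d0 hd] := hx e e0; pose r := Num.max (1 - d / 2) 0.
have r01 : 0 <= r < 1 by rewrite le_max lexx orbT gt_max ltr01; lra.
have rd : 1 - d < r < 1 by rewrite (andP r01).2 andbT lt_max; apply/orP; left; lra.
have := le_trans (ler_Re_normc _) (hd r rd); rewrite ler_norml => /andP[_].
have := poisson_Re_ge0 r x r01; case: (poisson_int _ _ _) => a b /=; lra.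
Qed.

(** The units of the algebra of bounded analytic functions, seen on the circle. *)
Definition analytic_unit (u : angle -> C) := [/\ analytic u,
  exists d M, 0 < d /\ {ae mu, forall t, d <= nc (u t) <= M} & analytic (fun t => (u t)^-1)].

Lemma cpoly_mul_L2 n c (u : angle -> C) : u \in circle_Lfun 2%:E ->
  (fun t => cpoly n c t * u t) \in circle_Lfun 2%:E.
Proof.
move=> u2; under eq_fun do rewrite mulrC.
apply: (@circle_L2_mul_bounded _ _ _ (\sum_(i < n) nc (c i))) => //.
  by have /analytic_L2/circle_L2P[] := cpoly_analytic n c.
apply: aeW => t; rewrite (le_trans (normc_sum _ _ _))//.
by apply: ler_sum => i _; rewrite Normc.normcM normc_circle_exp mulr1.
Qed.

Lemma cpoly_L2 n c : @cpoly R n c \in circle_Lfun 2%:E.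
Proof. exact/analytic_L2/cpoly_analytic. Qed.

Lemma sqr_normc_integrable (f : angle -> C) : f \in circle_Lfun 2%:E ->
  mu.-integrable setT (EFin \o (fun t => nc (f t) ^+ 2)).
Proof. by case/circle_L2P. Qed.

Lemma sqr_normc_L1 (f : angle -> C) : f \in circle_Lfun 2%:E ->
  (fun t => (nc (f t) ^+ 2)%:C%C) \in circle_Lfun 1%E.
Proof. by move=> f2; have := circle_L2_mul_conj f2 f2; under eq_fun do rewrite mul_conj_normc. Qed.

Lemma multiplier_upper (u : angle -> C) A : u \in circle_Lfun 2%:E ->
  (forall n c, sqint (fun t => cpoly n c t * u t) <= A * sqint (cpoly n c)) ->
  {ae mu, forall t, nc (u t) ^+ 2 <= A}.
Proof.
move=> u2 hA; suff : {ae mu, forall t, 0 <= A - nc (u t) ^+ 2}.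
  by apply: filterS => t; rewrite subr_ge0.
apply: ae_ge0_of_polynomials.
  by under eq_fun do rewrite rmorphB; apply: circle_L1B (circle_L1_cst _) (sqr_normc_L1 u2).
move=> n c; have := hA n c; rewrite /sqint -RintegralZl//; last first.
  exact: sqr_normc_integrable (cpoly_L2 n c).
rewrite -subr_ge0 -RintegralB//.
- rewrite (_ : (fun x => _) = (fun t => nc (cpoly n c t) ^+ 2 * (A - nc (u t) ^+ 2)))//.
  by apply/funext => t; rewrite Normc.normcM exprMn; ring.
- rewrite (_ : _ \o _ = fun t => A%:E * (nc (cpoly n c t) ^+ 2)%:E)%E; last by apply/funext.
  by apply: integrableZl => //; exact: sqr_normc_integrable (cpoly_L2 n c).
- exact: sqr_normc_integrable (cpoly_mul_L2 n c u2).
Qed.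

Lemma multiplier_lower (u : angle -> C) A : 0 < A -> u \in circle_Lfun 2%:E ->
  (forall n c, sqint (cpoly n c) <= A * sqint (fun t => cpoly n c t * u t)) ->
  {ae mu, forall t, A^-1 <= nc (u t) ^+ 2}.
Proof.
move=> A0 u2 hA; suff : {ae mu, forall t, 0 <= A * nc (u t) ^+ 2 - 1}.
  by apply: filterS => t; rewrite subr_ge0 -ler_pdivrMl// mulr1.
apply: ae_ge0_of_polynomials.
  under eq_fun do rewrite rmorphB rmorphM; apply: circle_L1B (circle_L1_cst _).
  exact: circle_L1Z (sqr_normc_L1 u2).
move=> n c; have := hA n c; rewrite /sqint -RintegralZl//; last first.
  exact: sqr_normc_integrable (cpoly_mul_L2 n c u2).
rewrite -subr_ge0 -RintegralB//.
- rewrite (_ : (fun x => _) = (fun t => nc (cpoly n c t) ^+ 2 * (A * nc (u t) ^+ 2 - 1)))//.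
  by apply/funext => t; rewrite Normc.normcM exprMn; ring.
- rewrite (_ : _ \o _ = fun t => A%:E * (nc (cpoly n c t * u t) ^+ 2)%:E)%E; last by apply/funext.
  by apply: integrableZl => //; exact: sqr_normc_integrable (cpoly_mul_L2 n c u2).
- exact: sqr_normc_integrable (cpoly_L2 n c).
Qed.

(** The system of equations expressing the coefficients of p u through those of
    p is triangular, with the entry coef u 0 on the diagonal. *)
Lemma coef_cpoly_mul n c (u : angle -> C) j : analytic u -> (j < n)%N ->
  coef (fun t => cpoly n c t * u t) j = \sum_(i < j.+1) c i * coef u (j - i).
Proof.
move=> [u2 u0] jn; have u1 := circle_L2_L1 u2.
rewrite /coef (_ : (fun t => _) = fun t => \sum_(i < n) c i * (u t * circle_exp (i%:Z - j%:Z) t)).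
  rewrite circle_int_sum; last by move=> i; apply: circle_L1Z; exact: circle_L1_mul_exp.
  rewrite (big_ord_widen n (fun i => c i * circle_int (fun t => u t * circle_exp (- (j - i)%:Z) t)) jn).
  rewrite [RHS]big_mkcond/=; apply: eq_bigr => i _.
  rewrite circle_intZ; last exact: circle_L1_mul_exp.
  case: ltnP => ij; first by rewrite -subzn // opprB.
  rewrite -(subnK ij) -addSnnS PoszD addrK.
  by rewrite u0 mulr0.
apply/funext => t; rewrite /cpoly !mulr_suml; apply: eq_bigr => i _.
by rewrite circle_expD -!mulrA; congr (_ * _); rewrite mulrCA.
Qed.

(** Solving the triangular system bounds the first j coefficients of p by the norm
    of p u, with a constant independent of p. *)
Lemma coef_division (u : angle -> C) j : analytic u -> coef u 0 != 0 ->
  exists2 K, 0 <= K & forall n c i, (i < j)%N -> (i < n)%N ->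
    nc (c i) <= K * Num.sqrt (sqint (fun t => cpoly n c t * u t)).
Proof.
move=> au u00; have U0 : 0 < nc (coef u 0) by rewrite lt_def normc_eq0 u00 normc_ge0.
elim: j => [|j [K K0 hK]]; first by exists 0.
(* The equation of index j expresses c j * coef u 0 through the coefficient of
   index j of p u and the c i with i < j. *)
pose B := 1 + \sum_(i < j) K * nc (coef u (j - i)).
have B0 : 0 <= B by rewrite addr_ge0// sumr_ge0// => i _; rewrite mulr_ge0 ?normc_ge0.
have B'0 : 0 <= B / nc (coef u 0) by rewrite divr_ge0 ?normc_ge0.
exists (K + B / nc (coef u 0)) => [|n c i]; first exact: addr_ge0.
set s := Num.sqrt _; have s0 : 0 <= s by exact: sqrtr_ge0.
rewrite ltnS leq_eqVlt => /predU1P[-> jn|ij i_n]; last first.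
  by rewrite (le_trans (hK n c i ij i_n))// -/s mulrDl lerDl mulr_ge0.
have pu2 := analytic_L2 (cpoly_mul_analytic n c au).
have : nc (c j * coef u 0) <= s + \sum_(i < j) (K * s) * nc (coef u (j - i)).
  have := coef_cpoly_mul c au jn; rewrite big_ord_recr/= subnn.
  move=> /eqP; rewrite addrC -subr_eq => /eqP <-.
  rewrite (le_trans (ler_normcB _ _))// lerD//.
    rewrite /s -[leLHS]ger0_norm ?normc_ge0// -sqrtr_sqr ler_wsqrtr//.
    exact: normc_fourier_le.
  rewrite (le_trans (normc_sum _ _ _))//; apply: ler_sum => k _.
  by rewrite Normc.normcM ler_wpM2r ?normc_ge0// hK// (ltn_trans _ jn).
rewrite Normc.normcM -ler_pdivlMr// => /le_trans; apply.
have -> : s + \sum_(i < j) (K * s) * nc (coef u (j - i)) = B * s.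
  by rewrite mulrDl mul1r mulr_suml; congr (_ + _); apply: eq_bigr => k _; rewrite mulrAC.
by rewrite mulrAC [leRHS]mulrDl lerDr mulr_ge0.
Qed.

Definition pad n (c : nat -> C) i := if (i < n)%N then c i else 0.

Lemma cpoly_pad n N c : (n <= N)%N -> cpoly N (pad n c) = cpoly n c.
Proof.
move=> nN; apply/funext => t; rewrite /cpoly.
rewrite (big_ord_widen N (fun i => c i * circle_exp i%:Z t) nN) [RHS]big_mkcond/=.
by apply: eq_bigr => i _; rewrite /pad; case: ifP; rewrite ?mul0r.
Qed.

(** Solvability of p u = y up to any precision, with control of p. *)
Definition almost_onto (u : angle -> C) A := forall y e, analytic y -> 0 < e ->
  exists n c, sqint (fun t => y t - cpoly n c t * u t) <= e /\ sqint (cpoly n c) <= A * sqint y.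

(** Approximate solutions p of p u = q u have coefficients close to those of q,
    so that q itself is bounded as the p are. *)
Lemma almost_onto_lower_coef0 u A : analytic u -> coef u 0 != 0 -> almost_onto u A ->
  forall n q, sqint (cpoly n q) <= A * sqint (fun t => cpoly n q t * u t).
Proof.
move=> au u00 hu n q; set y := (fun t => _).
have ay : analytic y by exact: cpoly_mul_analytic.
have [K K0 hK] := coef_division n au u00.
pose Q := \sum_(i < n) nc (q i).
have Q0 : 0 <= Q by apply: sumr_ge0 => i _; exact: normc_ge0.
(* Coefficients within K * d of those of q cost at most 2 * (K * d) * Q <= e. *)
apply/ler_addgt0Pl => e e0; pose d := e / (2 * (Q + 1) * (K + 1)).
have den0 : 0 < 2 * (Q + 1) * (K + 1) by rewrite !mulr_gt0// ltr_wpDl.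
have d0 : 0 < d by rewrite divr_gt0.
have [m [c [hy hc]]] := hu y (d ^+ 2) ay (exprn_gt0 _ d0).
pose N := maxn n m; pose D i := pad n q i - pad m c i.
have DE : cpoly N D = fun t => cpoly n q t - cpoly m c t.
  rewrite -(cpoly_pad q (leq_maxl n m)) -(cpoly_pad c (leq_maxr n m)).
  by apply/funext => t; rewrite /cpoly -sumrB; apply: eq_bigr => i _; rewrite mulrBl.
have hD i : (i < n)%N -> nc (q i) <= nc (pad m c i) + K * d.
  move=> i_n; have := hK N D i i_n (leq_trans i_n (leq_maxl _ _)).
  have -> : (fun t => cpoly N D t * u t) = (fun t => y t - cpoly m c t * u t).
    by apply/funext => t; rewrite DE mulrBl.
  move=> h; have {}h : nc (D i) <= K * d.
    rewrite (le_trans h)// ler_wpM2l// -(ger0_norm (ltW d0)) -sqrtr_sqr.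
    by rewrite ler_wsqrtr.
  rewrite -[q i](subrK (pad m c i)) addrC (le_trans (le_normcD _ _))// lerD2l.
  by apply: le_trans h; rewrite /D /pad i_n.
have : sqint (cpoly n q) <= \sum_(i < n) nc (pad m c i) ^+ 2 + 2 * (K * d) * Q.
  rewrite sqint_cpoly mulr_sumr -big_split/=; apply: ler_sum => i _.
  have := hD i (ltn_ord i); have := normc_ge0 (pad m c i); have := normc_ge0 (q i).
  have : 0 <= K * d by rewrite mulr_ge0// ltW.
  move: (K * d) (nc (q i)) (nc (pad m c i)) => x a b x0 a0 b0 ab.
  have [xa|ax] := leP x a; last nra.
  have : (a - x) ^+ 2 <= b ^+ 2 by rewrite !expr2 ler_pM ?subr_ge0//; lra.
  nra.
move=> /le_trans; apply; rewrite addrC lerD//.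
  rewrite (_ : 2 * (K * d) * Q = e * ((K / (K + 1)) * (Q / (Q + 1)))).
    rewrite ler_piMr ?(ltW e0)// mulr_ile1 ?divr_ge0 ?addr_ge0//.
      by rewrite ler_pdivrMr ?ltr_wpDl// mul1r lerDl.
    by rewrite ler_pdivrMr ?ltr_wpDl// mul1r lerDl.
  rewrite /d; field; apply/andP; split; rewrite gt_eqF ?ltr_wpDl//.
apply: le_trans hc; rewrite -(cpoly_pad c (leq_maxr n m)) sqint_cpoly -/N.
rewrite (big_ord_widen N (fun i => nc (pad m c i) ^+ 2) (leq_maxl n m)) big_mkcond/=.
by apply: ler_sum => i _; case: ifP; rewrite ?sqr_ge0.
Qed.

Lemma sqint_exp_mul n (f : angle -> C) : sqint (fun t => circle_exp n t * f t) = sqint f.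
Proof.
by rewrite /sqint; apply: eq_Rintegral => t _; rewrite Normc.normcM normc_circle_exp mul1r.
Qed.

(** Dividing u by its leading power of z reduces to a nonzero constant coefficient,
    without changing any norm. *)
Lemma almost_onto_lower u A : analytic u -> almost_onto u A ->
  forall n q, sqint (cpoly n q) <= A * sqint (fun t => cpoly n q t * u t).
Proof.
move=> au hu n q; have [|] := pselect (exists m, coef u m != 0); last first.
  move=> u0; have half0 : 0 < 2^-1 :> R by rewrite invr_gt0.
  have [m [c [h _]]] := hu _ _ (@analytic1 R) half0.
  have u_ae : {ae mu, forall t, u t = 0}.
    apply: (analytic_unique au (@analytic0 R)) => k; apply/eqP.
    rewrite [coef (fun=> 0) k](_ : _ = 0); first by apply: contra_notT u0; exists k.
    by rewrite /coef; under eq_fun do rewrite mul0r; rewrite circle_int_cst.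
  have s1 : sqint (fun=> 1 : C) = 1.
    apply: (@complexI R); rewrite -circle_int_sqint.
    by under eq_fun do rewrite rmorph1 mulr1; rewrite circle_int_cst.
  have s1m : sqint (fun t => 1 - cpoly m c t * u t) = 1.
    rewrite -[RHS]s1; apply: sqint_ae => [||].
    - exact: circle_L2B (analytic_L2 (@analytic1 R)) (cpoly_mul_L2 m c (analytic_L2 au)).
    - exact: analytic_L2 (@analytic1 R).
    - by apply: filterS u_ae => t ->; rewrite mulr0 subr0.
  by move: h; rewrite s1m; lra.
move=> /ex_minnP[m um hm]; pose v t := circle_exp (- m%:Z) t * u t.
have vu t : circle_exp m%:Z t * v t = u t by rewrite mulrA -circle_expD subrr circle_exp0 mul1r.
have av : analytic v.
  split; first exact/circle_exp_mul_L2/analytic_L2.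
  move=> l; rewrite (_ : (fun t => _) = fun t => u t * circle_exp (l.+1%:Z - m%:Z) t).
    have [ml|lm] := leqP m l.
      have -> : l.+1%:Z - m%:Z = (l - m).+1%:Z by rewrite subzn ?subSn// (leq_trans ml).
      by case: au => _ ->.
    have -> : l.+1%:Z - m%:Z = - (m - l.+1)%N%:Z by rewrite -(subzn lm) opprB.
    apply/eqP; apply: contraTT lm => /hm h.
    by apply: contraL h => lm; rewrite -ltnNge ltn_subrL /=; exact: leq_ltn_trans lm.
  by apply/funext => t; rewrite /v circle_expD; ring.
have hv : almost_onto v A.
  move=> y e ay e0; have [k [c [hk hc]]] := hu _ e (circle_exp_mul_analytic m ay) e0.
  exists k, c; rewrite sqint_exp_mul in hc; split=> //.
  rewrite -(sqint_exp_mul m); congr (_ <= _): hk; congr sqint; apply/funext => t.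
  by rewrite -vu mulrBr mulrCA.
have := almost_onto_lower_coef0 av _ hv n q.
rewrite -(sqint_exp_mul (- m%:Z) (fun t => cpoly n q t * u t)).
rewrite [X in _ -> _ <= _ * sqint X](_ : _ = fun t => cpoly n q t * v t); last first.
  by apply/funext => t; rewrite mulrCA.
apply; move: um; congr (circle_int _ != 0); apply/funext => t.
by rewrite oppr0 circle_exp0 mulr1 mulrC.
Qed.

Lemma H2_ofB (f g : angle -> C) : analytic f -> analytic g ->
  H2_of (fun t => f t - g t) = H2_of f - H2_of g.
Proof.
move=> af ag; transitivity (-1 *: H2_of g + H2_of f); last first.
  by rewrite scaleN1r; exact: addrC.
rewrite -(H2_of_lin (-1) ag af); congr H2_of.
by apply/funext => t; rewrite mulN1r addrC.
Qed.

(** From left to right the bounds on |u| come from those on p |-> p u, and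
    approximate solutions of p u = 1 converge to 1/u.  From right to left, p is
    taken as a partial sum of the Fourier series of y/u. *)
Theorem synthesis_onto_unit u : analytic u ->
  synthesis_onto (fun n => iter n (@shift R) (H2_of u)) <-> analytic_unit u.
Proof.
move=> au; have u2 := analytic_L2 au; split=> [[A A0 [hA hB]]|[_ [d [M [d0 udM]]] av]].
  have upper : {ae mu, forall t, nc (u t) ^+ 2 <= A}.
    apply: multiplier_upper => // n c; have := hA n c.
    by rewrite sum_iter_shift// rnorm_H2_of ?sqint_cpoly//; exact: cpoly_mul_analytic.
  have onto : almost_onto u A.
    move=> y e ay e0; have s0 : 0 < Num.sqrt e by rewrite sqrtr_gt0.
    have [n [c [hy hc]]] := hB (H2_of y) _ s0; exists n, c; split; last first.
      by move: hc; rewrite rnorm_H2_of// sqint_cpoly.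
    have apu := cpoly_mul_analytic n c au.
    rewrite -rnorm_H2_of; last exact: analyticB.
    rewrite -(sqr_sqrtr (ltW e0)) ler_sqr ?nnegrE ?rnorm_ge0 ?sqrtr_ge0//; move: hy; rewrite sum_iter_shift//.
    by rewrite -(H2_ofB ay apu).
  have lower := multiplier_lower A0 u2 (almost_onto_lower au onto).
  have udM : {ae mu, forall t, (Num.sqrt A)^-1 <= nc (u t) <= Num.sqrt A}.
    apply: filterS2 upper lower => t h1 h2; rewrite -(ger0_norm (normc_ge0 (u t))) -sqrtr_sqr.
    by rewrite -sqrtrV ?(ltW A0)// !ler_wsqrtr.
  have sA0 : 0 < Num.sqrt A by rewrite sqrtr_gt0.
  split=> //; first by exists (Num.sqrt A)^-1, (Num.sqrt A); rewrite invr_gt0.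
  have mv : cmeasurable (fun t => (u t)^-1) by apply: cmeasurableV; case/circle_L2P: u2.
  have v2 : (fun t => (u t)^-1) \in circle_Lfun 2%:E.
    apply: (@bounded_circle_L2 _ _ (Num.sqrt A)) => //.
    apply: filterS udM => t /andP[h _]; rewrite Normc.normcV invf_ple ?posrE//.
    by rewrite (lt_le_trans _ h)// invr_gt0.
  apply: analytic_closed => // e e0.
  have [n [c [hc _]]] := onto _ (e / A) (@analytic1 R) (divr_gt0 e0 A0).
  exists (cpoly n c); first exact: cpoly_analytic.
  have d2 := circle_L2B (analytic_L2 (@analytic1 R)) (cpoly_mul_L2 n c u2).
  have := sqint_le (circle_L2B v2 (cpoly_L2 n c)) d2 (M := Num.sqrt A).
  rewrite sqr_sqrtr ?(ltW A0)// => h; apply: le_trans (h _) _; last by rewrite mulrC -ler_pdivlMr.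
  apply: filterS udM => t /andP[ht _]; have u0 : 0 < nc (u t) by rewrite (lt_le_trans _ ht)// invr_gt0.
  have un : u t != 0 by rewrite -normc_eq0 gt_eqF.
  rewrite (_ : (u t)^-1 - _ = (u t)^-1 * (1 - cpoly n c t * u t)); last by field.
  by rewrite Normc.normcM Normc.normcV ler_wpM2r ?normc_ge0// invf_ple.
have uM : {ae mu, forall t, nc (u t) <= M} by apply: filterS udM => t /andP[].
have vd : {ae mu, forall t, nc (u t)^-1 <= d^-1}.
  apply: filterS udM => t /andP[h _]; rewrite Normc.normcV lef_pV2 ?posrE//.
  exact: lt_le_trans h.
have un : {ae mu, forall t, u t != 0}.
  by apply: filterS udM => t /andP[h _]; rewrite -normc_eq0 gt_eqF// (lt_le_trans d0).
exists (M ^+ 2 + d^-1 ^+ 2); first by rewrite ltr_wpDl ?sqr_ge0// exprn_gt0// invr_gt0.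
split=> [n c|y e e0].
  rewrite sum_iter_shift// rnorm_H2_of; last exact: cpoly_mul_analytic.
  rewrite -sqint_cpoly mulrDl; apply: ler_wpDr.
    by apply: mulr_ge0; [exact: sqr_ge0|exact: sqint_ge0].
  apply: sqint_le; [exact: cpoly_mul_L2|exact: cpoly_L2|].
  by apply: filterS uM => t h; rewrite Normc.normcM mulrC ler_wpM2r ?normc_ge0.
rewrite -(H2_of_fun y); have := H2_fun_analytic y; move: (H2_fun y) => {}y ay.
have ag := bounded_mul_analytic av vd ay; set g := (fun t => _) in ag.
have e1 : 0 < e ^+ 2 / (M ^+ 2 + 1) by rewrite divr_gt0 ?ltr_wpDl ?sqr_ge0// exprn_gt0.
have [n hn] := analytic_approx ag e1; exists n, (coef g).
have apu := cpoly_mul_analytic n (coef g) au.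
rewrite sum_iter_shift// rnorm_H2_of//; split.
  rewrite -(H2_ofB ay apu).
  rewrite -ler_sqr ?nnegrE ?rnorm_ge0 ?(ltW e0)// rnorm_H2_of; last exact: analyticB.
  have d2 := circle_L2B (analytic_L2 ag) (cpoly_L2 n (coef g)).
  apply: le_trans (sqint_le (analytic_L2 (analyticB ay apu)) d2 (M := M) _) _.
    apply: filterS2 un uM => t ut uM; rewrite (_ : y t - _ = u t * (g t - cpoly n (coef g) t)).
      by rewrite Normc.normcM ler_wpM2r ?normc_ge0.
    by rewrite /g; field.
  apply: (le_trans (ler_wpM2l (sqr_ge0 M) hn)).
  rewrite mulrA ler_pdivrMr ?ltr_wpDl ?sqr_ge0//.
  by rewrite mulrC ler_pM2l ?exprn_gt0// lerDl.
rewrite (le_trans (bessel n (analytic_L2 ag)))// (le_trans (sqint_le (analytic_L2 ag) (analytic_L2 ay) (M := d^-1) _))//.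
  by apply: filterS vd => t h; rewrite /g Normc.normcM ler_wpM2r ?normc_ge0.
by rewrite mulrDl lerDr; apply: mulr_ge0; [exact: sqr_ge0|exact: sqint_ge0].
Qed.

End HardyUnits.

(** * Cauchy integrals of analytic boundary functions *)

Section CauchyIntegral.
Variable R : realType.
Local Notation C := (R[i]).
Local Notation angle := (measurableTypeR R).
Local Notation mu := (circle_measure R).
Local Notation nc := (@Normc.normc R).
Arguments Normc.normc : simpl never.

Implicit Types f phi : angle -> C.

Definition cauchy_int (f : angle -> C) (z : C) := circle_int (fun t => f t * cauchy_kernel z t).

Lemma normc_circle_int_weight (f : angle -> C) (w : angle -> R) M : 0 <= M -> f \in circle_Lfun 1%E ->
  (forall t, 0 <= w t) -> (fun t => (w t)%:C%C) \in circle_Lfun 1%E ->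
  (fun t => f t * (w t)%:C%C) \in circle_Lfun 1%E ->
  {ae mu, forall t, nc (f t) <= M} ->
  nc (circle_int (fun t => f t * (w t)%:C%C)) <= M * \int[mu]_t w t.
Proof.
move=> M0 /circle_L1P[mf _] w0 /circle_LfunP[/Lfun1_integrable iw _] fw1 fM.
have /circle_L1P[mfw ifw] := fw1.
have iMw : mu.-integrable setT (fun t => (M * w t)%:E).
  by under eq_fun do rewrite EFinM; exact: integrableZl.
rewrite (le_trans (normc_circle_int fw1))// -RintegralZl// /Rintegral fine_le ?integrable_fin_num//.
apply: ae_ge0_le_integral => //.
- by move=> t _; rewrite lee_fin normc_ge0.
- exact: measurable_int ifw.
- by move=> t _; rewrite lee_fin mulr_ge0.
- exact: measurable_int iMw.
by apply: filterS fM => t h _; rewrite lee_fin Normc.normcM normc_real ger0_norm// ler_wpM2r.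
Qed.

(** The Poisson kernel at the point z of the disk, without reference to polar
    coordinates of z. *)
Definition disk_weight (z : C) (t : angle) := (1 - nc z ^+ 2) * nc (cauchy_kernel z t) ^+ 2.

Lemma disk_weight_ge0 z t : nc z < 1 -> 0 <= disk_weight z t.
Proof.
move=> z1; have z0 := normc_ge0 z; apply: mulr_ge0; last exact: sqr_ge0.
by nra.
Qed.

Lemma disk_weightE z t : nc z < 1 -> (disk_weight z t)%:C%C =
  cauchy_kernel z t + conjC (cauchy_kernel z t) - 1.
Proof. exact: sqr_normc_cauchy. Qed.

Lemma cauchy_kernel_L1 z : nc z < 1 -> cauchy_kernel z \in circle_Lfun 1%E.
Proof.
move=> z1; apply: (@bounded_circle_L1 _ _ (1 - nc z)^-1); first exact: cauchy_kernel_measurable.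
by apply: aeW => t; exact: cauchy_kernel_bound.
Qed.

Lemma disk_weight_L1 z : nc z < 1 -> (fun t => (disk_weight z t)%:C%C) \in circle_Lfun 1%E.
Proof.
move=> z1; under eq_fun do rewrite disk_weightE//.
apply: circle_L1B (circle_L1_cst _); apply: circle_L1D; first exact: cauchy_kernel_L1.
exact/circle_L1_conj/cauchy_kernel_L1.
Qed.

Lemma disk_weight_mul_L1 f z : f \in circle_Lfun 1%E -> nc z < 1 ->
  (fun t => f t * (disk_weight z t)%:C%C) \in circle_Lfun 1%E.
Proof.
move=> f1 z1; rewrite (_ : (fun t => _) =
    fun t => f t * cauchy_kernel z t + f t * conjC (cauchy_kernel z t) - f t).
  have k1 := circle_L1_mul_cauchy f1 z1; have k2 := circle_L1_mul_cauchy_conj f1 z1.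
  exact: circle_L1B (circle_L1D k1 k2) f1.
by apply/funext => t; rewrite disk_weightE// !mulrDr mulrN1.
Qed.

Lemma disk_weight_int z : nc z < 1 -> \int[mu]_t disk_weight z t = 1.
Proof.
move=> z1; have k1 := cauchy_kernel_L1 z1.
have : circle_int (fun t => (disk_weight z t)%:C%C) = 1.
  under eq_fun do rewrite disk_weightE//.
  rewrite circle_intB ?circle_L1_cst//; last by apply: circle_L1D => //; exact: circle_L1_conj.
  rewrite circle_intD//; last exact: circle_L1_conj.
  by rewrite circle_int_conj// circle_int_cauchy// circle_int_cst rmorph1 addrK.
by move=> [].
Qed.

(** For an analytic function the Poisson and Cauchy integrals agree, the
    conjugate half of the Poisson kernel only seeing the mean value. *)
Lemma analytic_cauchy_conj f z : analytic f -> nc z < 1 ->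
  circle_int (fun t => f t * conjC (cauchy_kernel z t)) = circle_int f.
Proof.
move=> [f2 f0] z1; have f1 := circle_L2_L1 f2.
have fe1 := circle_L1_mul_exp 1 f1.
rewrite (_ : (fun t => _) = fun t =>
    f t + conjC z * (f t * circle_exp 1 t * conjC (cauchy_kernel z t))).
  rewrite circle_intD ?circle_intZ//; first last.
  - by apply: circle_L1Z; exact: circle_L1_mul_cauchy_conj.
  - exact: circle_L1_mul_cauchy_conj.
  rewrite circle_int_cauchy_conj_eq0 ?mulr0 ?addr0// => n.
  by under eq_fun do rewrite -mulrA -circle_expD -PoszD add1n; exact: f0.
apply/funext => t; rewrite {1}(circle_exp_mul_cauchy t z1) rmorphD rmorph1 !rmorphM/=.
by rewrite (circle_expN 1) conjCK; ring.
Qed.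

Lemma cauchy_intE f z : analytic f -> nc z < 1 ->
  cauchy_int f z = circle_int (fun t => f t * (disk_weight z t)%:C%C).
Proof.
move=> af z1; have f1 := circle_L2_L1 (analytic_L2 af).
rewrite (_ : (fun t => f t * _%:C%C) =
    fun t => f t * cauchy_kernel z t + f t * conjC (cauchy_kernel z t) - f t).
  have k1 := circle_L1_mul_cauchy f1 z1; have k2 := circle_L1_mul_cauchy_conj f1 z1.
  by rewrite circle_intB ?circle_L1D// circle_intD// analytic_cauchy_conj// addrK.
by apply/funext => t; rewrite disk_weightE// !mulrDr mulrN1.
Qed.

Lemma cauchy_int_poisson f r x : analytic f -> 0 <= r < 1 ->
  cauchy_int f (polar r x) = poisson_int f r x.
Proof.
move=> af r01; rewrite cauchy_intE ?normc_polar_lt1//; congr circle_int; apply/funext => t.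
by rewrite mulrC poisson_normc_cauchy /disk_weight normc_polar//; case/andP: r01.
Qed.

(** The Cauchy integral is an average of f with positive weights. *)
Lemma cauchy_int_bound f M z : analytic f -> 0 <= M -> {ae mu, forall t, nc (f t) <= M} ->
  nc z < 1 -> nc (cauchy_int f z) <= M.
Proof.
move=> af M0 fM z1; have f1 := circle_L2_L1 (analytic_L2 af).
rewrite cauchy_intE// -[M]mulr1 -(disk_weight_int z1); apply: normc_circle_int_weight => //.
- by move=> t; exact: disk_weight_ge0.
- exact: disk_weight_L1.
- exact: disk_weight_mul_L1.
Qed.

Lemma cauchy_int_exp_mul f n z : analytic f -> nc z < 1 ->
  cauchy_int (fun t => f t * circle_exp n%:Z t) z = z ^+ n * cauchy_int f z.
Proof.
move=> [f2 f0] z1; have f1 := circle_L2_L1 f2.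
rewrite /cauchy_int (circle_int_cauchy_expansion n) //; last exact: circle_L1_mul_exp.
rewrite big1 ?add0r => [|i _].
  by congr (_ * circle_int _); apply/funext => t; rewrite -(mulrA (f t)) -circle_expD subrr circle_exp0 mulr1.
under eq_fun do rewrite -mulrA -circle_expD.
rewrite subzn ?(ltnW (ltn_ord i))//; case: (n - i)%N (subn_gt0 i n) => [|k _].
  by rewrite ltn_ord.
by rewrite f0 mulr0.
Qed.

Lemma cauchy_int_cpoly_mul f n c z : analytic f -> nc z < 1 ->
  cauchy_int (fun t => f t * cpoly n c t) z = cauchy_int f z * cauchy_int (cpoly n c) z.
Proof.
have sumE g : analytic g -> nc z < 1 -> cauchy_int (fun t => g t * cpoly n c t) z =
    (\sum_(i < n) c i * z ^+ i) * cauchy_int g z.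
  move=> ag z1; have g1 := circle_L2_L1 (analytic_L2 ag).
  rewrite /cauchy_int (_ : (fun t => _) =
    fun t => \sum_(i < n) c i * (g t * circle_exp i%:Z t * cauchy_kernel z t)).
    rewrite circle_int_sum; last first.
      by move=> i; apply: circle_L1Z; apply: circle_L1_mul_cauchy => //; exact: circle_L1_mul_exp.
    rewrite mulr_suml; apply: eq_bigr => i _; rewrite circle_intZ; last first.
      by apply: circle_L1_mul_cauchy => //; exact: circle_L1_mul_exp.
    by rewrite -mulrA -cauchy_int_exp_mul.
  apply/funext => t; rewrite /cpoly mulr_sumr mulr_suml; apply: eq_bigr => i _; ring.
move=> af z1; rewrite sumE// mulrC; congr (_ * _).
have := sumE _ (@analytic1 R) z1; rewrite /cauchy_int.
under eq_fun do rewrite mul1r; move=> ->.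
rewrite [circle_int _](_ : _ = 1) ?mulr1// -[RHS](circle_int_cauchy z1).
by congr circle_int; apply/funext => t; rewrite mul1r.
Qed.

Lemma normc_cauchy_int_le f z : f \in circle_Lfun 2%:E -> nc z < 1 ->
  nc (cauchy_int f z) ^+ 2 <= (1 - nc z)^-1 ^+ 2 * sqint f.
Proof.
move=> f2 z1.
have fk2 : (fun t => f t * cauchy_kernel z t) \in circle_Lfun 2%:E.
  apply: (circle_L2_mul_bounded f2 (cauchy_kernel_measurable z)).
  by apply: aeW => t; exact: cauchy_kernel_bound.
have := normc_fourier_le 0 fk2; under eq_fun do rewrite circle_exp0 mulr1.
move=> /le_trans; apply; apply: sqint_le => //; apply: aeW => t.
by rewrite Normc.normcM mulrC ler_wpM2r ?normc_ge0 ?cauchy_kernel_bound.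
Qed.

(** Point evaluation in the disk is multiplicative: it is on polynomials, and it
    is continuous in square mean. *)
Lemma cauchy_int_mul phi f M z : analytic phi -> {ae mu, forall t, nc (phi t) <= M} ->
  analytic f -> nc z < 1 -> cauchy_int (fun t => phi t * f t) z = cauchy_int phi z * cauchy_int f z.
Proof.
move=> aphi phiM af z1; apply/eqP; rewrite -subr_eq0 -normc_eq0 -sqrf_eq0 eq_le sqr_ge0 andbT.
set N := nc (cauchy_int phi z); set B := (1 - nc z)^-1.
pose k := 2 * B ^+ 2 * (M ^+ 2 + N ^+ 2); have k0 : 0 <= k.
  by rewrite /k; have := sqr_ge0 B; have := sqr_ge0 M; have := sqr_ge0 N; nra.
apply/ler_addgt0Pl => e e0; rewrite addr0.
have e1 : 0 < e / (k + 1) by rewrite divr_gt0 ?ltr_wpDl.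
have [n hn] := analytic_approx af e1; set p := cpoly n (coef f) in hn.
have ap : analytic p := cpoly_analytic n (coef f); have ad := analyticB af ap.
have ad2 := bounded_mul_analytic aphi phiM ad.
have L1 g : analytic g -> (fun t => g t * cauchy_kernel z t) \in circle_Lfun 1%E.
  by move=> /analytic_L2/circle_L2_L1 g1; exact: circle_L1_mul_cauchy.
have cB g h : analytic g -> analytic h ->
    cauchy_int (fun t => g t - h t) z = cauchy_int g z - cauchy_int h z.
  move=> ag ah; rewrite /cauchy_int -circle_intB ?L1//.
  by congr circle_int; apply/funext => t; rewrite mulrBl.
have -> : cauchy_int (fun t => phi t * f t) z - cauchy_int phi z * cauchy_int f z =
    cauchy_int (fun t => phi t * (f t - p t)) z - cauchy_int phi z * cauchy_int (fun t => f t - p t) z.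
  have -> : (fun t => phi t * (f t - p t)) = (fun t => phi t * f t - phi t * p t).
    by apply/funext => t; rewrite mulrBr.
  rewrite !cB ?cauchy_int_cpoly_mul//; first by ring.
  + exact: bounded_mul_analytic phiM af.
  + exact: bounded_mul_analytic phiM ap.
have h1 := normc_cauchy_int_le (analytic_L2 ad2) z1.
have h2 := normc_cauchy_int_le (analytic_L2 ad) z1.
have h3 : sqint (fun t => phi t * (f t - p t)) <= M ^+ 2 * sqint (fun t => f t - p t).
  apply: sqint_le (analytic_L2 ad2) (analytic_L2 ad) _.
  by apply: filterS phiM => t h; rewrite Normc.normcM ler_wpM2r ?normc_ge0.
have s0 := sqint_ge0 (fun t => f t - p t).
move: (ler_normcB (cauchy_int (fun t => phi t * (f t - p t)) z)
  (cauchy_int phi z * cauchy_int (fun t => f t - p t) z)).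
rewrite Normc.normcM -/N.
move: (normc_ge0 (cauchy_int (fun t => phi t * (f t - p t)) z - cauchy_int phi z * cauchy_int (fun t => f t - p t) z)).
move: h1 h2 h3 hn s0 (normc_ge0 (cauchy_int (fun t => phi t * (f t - p t)) z)) (normc_ge0 (cauchy_int (fun t => f t - p t) z)).
move: (nc (_ - _)) (nc (cauchy_int (fun t => phi t * (f t - p t)) z)) (nc (cauchy_int (fun t => f t - p t) z)).
move: (sqint (fun t => phi t * _)) (sqint (fun t => f t - _)) => s' s D a b.
rewrite -/B => ha hb hs hse s0 a0 b0 D0 Dab.
have {}Dab : D ^+ 2 <= (a + N * b) ^+ 2 by rewrite ler_sqr ?nnegrE ?(le_trans D0 Dab).
have ha' : a ^+ 2 <= B ^+ 2 * (M ^+ 2 * s) by rewrite (le_trans ha)// ler_wpM2l ?sqr_ge0.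
have hb' : (N * b) ^+ 2 <= N ^+ 2 * (B ^+ 2 * s) by rewrite exprMn ler_wpM2l ?sqr_ge0.
have : D ^+ 2 <= k * s.
  have := sqr_ge0 (a - N * b); rewrite /k; move: Dab ha' hb'.
  move: (N * b) (B ^+ 2) (M ^+ 2) (N ^+ 2) => x b2 m2 n2; nra.
move=> /le_trans; apply; rewrite (le_trans (ler_wpM2l k0 hse))// mulrCA ler_piMr ?(ltW e0)//.
by rewrite ler_pdivrMr ?ltr_wpDl// mul1r lerDl.
Qed.

(** By the identity K(z + w) - K(z) = w e K(z + w) K(z), with e the function
    circle_exp (-1), the difference quotient of the kernel converges uniformly. *)
Lemma cauchy_int_derivable f M (z : C) : analytic f -> 0 <= M -> {ae mu, forall t, nc (f t) <= M} ->
  `|z| < 1 -> derivable (cauchy_int f : C^o -> C^o) z 1.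
Proof.
move=> af M0 fM; rewrite normr_normc ltcR => z1.
have f1 := circle_L2_L1 (analytic_L2 af).
pose K := @cauchy_kernel R; pose e1 := @circle_exp R (-1).
pose D := circle_int (fun t => f t * (e1 t * K z t * K z t)).
(* Points within d of z stay at distance at least d from the circle, which bounds
   the kernel by d^-1. *)
pose d := (1 - nc z) / 2; have d0 : 0 < d by rewrite divr_gt0 ?subr_gt0.
have zd w : nc w < d -> 1 - nc (z + w) >= d.
  by move=> wd; have := le_normcD z w; rewrite /d in wd *; lra.
have bK w t : nc w < d -> nc (K (z + w) t) <= d^-1.
  move=> wd; have := zd w wd => h; have h0 := lt_le_trans d0 h.
  rewrite (le_trans (cauchy_kernel_bound t _)) ?lef_pV2 ?posrE//; by move: h0; rewrite subr_gt0.
have mK w : cmeasurable (K w) by exact: cauchy_kernel_measurable.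
have me1 : cmeasurable e1 by exact: circle_exp_measurable.
have bK0 t : nc (K z t) <= d^-1 by have := bK 0 t; rewrite addr0 Normc.normc0; exact.
(* The error is w ^+ 2 times an integral bounded independently of w. *)
have main w : nc w < d -> nc (cauchy_int f (z + w) - cauchy_int f z - w * D) <= nc w ^+ 2 * (M * d^-1 ^+ 3).
  move=> wd; have := bK w ^~ wd => bKw.
  have zw1 : nc (z + w) < 1 by have := zd w wd; lra.
  pose g t := w ^+ 2 * (f t * (e1 t * e1 t * (K (z + w) t * K z t * K z t))).
  have mf : cmeasurable f by have /circle_L1P[] := f1.
  have B3 t : nc (K (z + w) t * K z t * K z t) <= d^-1 ^+ 3.
    rewrite !Normc.normcM 2!exprSr expr1 !ler_pM ?mulr_ge0 ?normc_ge0//.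
  have Kg t : nc (f t) <= M -> nc (g t) <= nc w ^+ 2 * (M * d^-1 ^+ 3).
    move=> ft; rewrite /g (Normc.normcM (w ^+ 2)) normcX ler_wpM2l ?sqr_ge0//.
    rewrite (Normc.normcM (f t)) (Normc.normcM (e1 t * e1 t)) (Normc.normcM (e1 t)).
    by rewrite normc_circle_exp !mul1r ler_pM ?normc_ge0.
  have -> : cauchy_int f (z + w) - cauchy_int f z - w * D = circle_int g.
    have k1 := circle_L1_mul_cauchy f1 zw1; have k2 := circle_L1_mul_cauchy f1 z1.
    have k3 : (fun t => f t * (e1 t * K z t * K z t)) \in circle_Lfun 1%E.
      have mk := cmeasurableM (cmeasurableM me1 (mK z)) (mK z).
      apply: (@circle_L1_mul_bounded _ _ _ (d^-1 * d^-1) f1 mk).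
      apply: aeW => t; rewrite !Normc.normcM normc_circle_exp mul1r.
      by rewrite ler_pM ?normc_ge0.
    rewrite /cauchy_int /D -circle_intZ// -(circle_intB k1 k2) -circle_intB ?circle_L1B ?circle_L1Z//.
    congr circle_int; apply/funext => t; rewrite /g /K /cauchy_kernel /e1.
    have n1 := cauchy_den_neq0 t z1; have n2 := cauchy_den_neq0 t zw1.
    by field; rewrite n1.
  apply: normc_circle_int_le.
  - by rewrite mulr_ge0 ?sqr_ge0// mulr_ge0// exprn_ge0// invr_ge0 ltW.
  - have mk := cmeasurableM (cmeasurableM me1 me1)
      (cmeasurableM (cmeasurableM (mK (z + w)) (mK z)) (mK z)).
    apply: circle_L1Z; apply: (@circle_L1_mul_bounded _ _ _ (d^-1 ^+ 3) f1 mk).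
    apply: aeW => t; rewrite (Normc.normcM (e1 t * e1 t)) (Normc.normcM (e1 t)).
    by rewrite normc_circle_exp !mul1r.
  - by apply: filterS fM => t; exact: Kg.
pose m := M * d^-1 ^+ 3; have m0 : 0 <= m by rewrite mulr_ge0// exprn_ge0// invr_ge0 ltW.
apply/cvg_ex; exists D; apply/cvgrPdist_le => e /gt0_complexE[r r0 ->].
have r1 : 0 < Num.min d (r / (m + 1)) by rewrite lt_min d0 divr_gt0 ?ltr_wpDl.
exists (Num.min d (r / (m + 1)))%:C%C => /=; first by rewrite ltcR.
move=> h; rewrite /ball_/= sub0r normrN normr_normc ltcR lt_min => /andP[hd hr] h0.
have hn : 0 < nc h by rewrite lt_def normc_eq0 h0 normc_ge0.
have -> : D - h^-1 *: (cauchy_int f (h *: 1 + z) - cauchy_int f z) =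
    - (h^-1 * (cauchy_int f (z + h) - cauchy_int f z - h * D)).
  by rewrite [h *: 1]mulr1 (addrC h) mulrBr [h^-1 * (h * D)]mulKf// opprB.
rewrite normrN normr_normc lecR Normc.normcM Normc.normcV.
rewrite mulrC ler_pdivrMr// (le_trans (main h hd))// -/m expr2 -mulrA mulrC ler_wpM2r ?normc_ge0//.
rewrite ltr_pdivlMr ?ltr_wpDl// in hr; nra.
Qed.
End CauchyIntegral.

(** * Units as radial limits *)

Section BoundaryFunctions.
Variable R : realType.
Local Notation C := (R[i]).
Local Notation angle := (measurableTypeR R).
Local Notation mu := (circle_measure R).
Local Notation nc := (@Normc.normc R).
Arguments Normc.normc : simpl never.
Implicit Types phi : angle -> C.

Lemma analytic_unit_Linfty phi : analytic_unit phi -> phi \in circle_Lfun +oo%E.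
Proof.
move=> [/analytic_L2/circle_L2P[mphi _] [d [M [_ h]]] _]; apply/circle_LinftyP; split=> //.
by exists M; apply: filterS h => t /andP[].
Qed.

(** The function is the Cauchy integral of phi.  Its product with the Cauchy
    integral of 1/phi is 1, and the latter is bounded. *)
Lemma analytic_unit_boundary phi : analytic_unit phi ->
  exists F : C -> C, [/\ Hinfty_disk F, bounded_away_from_0 F & radial_limit F phi].
Proof.
move=> [aphi [d [M [d0 phidM]]] aV]; pose M' := Num.max M 0.
have M'0 : 0 <= M' by rewrite le_max lexx orbT.
have phiM : {ae mu, forall t, nc (phi t) <= M'}.
  by apply: filterS phidM => t /andP[_ h]; rewrite le_max h.
have dV : 0 <= d^-1 by rewrite invr_ge0 ltW.
have Vd : {ae mu, forall t, nc (phi t)^-1 <= d^-1}.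
  by apply: filterS phidM => t /andP[h _]; rewrite Normc.normcV lef_pV2 ?posrE// (lt_le_trans d0).
exists (cauchy_int phi); split.
- split=> [z|]; first exact: cauchy_int_derivable phiM.
  by exists M'%:C%C => z; rewrite normr_normc ltcR lecR; exact: cauchy_int_bound.
- exists d%:C%C; first by rewrite ltcR.
  move=> z; rewrite normr_normc ltcR lecR => z1.
  have FG : cauchy_int phi z * cauchy_int (fun t => (phi t)^-1) z = 1.
    rewrite -(cauchy_int_mul aphi phiM aV z1) -[RHS](circle_int_cauchy z1).
    have apV := bounded_mul_analytic aphi phiM aV.
    apply: ae_circle_int.
    + by apply: circle_L1_mul_cauchy => //; apply: circle_L2_L1; exact: analytic_L2.
    + exact: cauchy_kernel_L1.
    apply: filterS phidM => t /andP[h _] _; rewrite divff ?mul1r//.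
    by rewrite -normc_eq0 gt_eqF// (lt_le_trans d0).
  have := congr1 nc FG; rewrite Normc.normcM Normc.normc1.
  have := cauchy_int_bound aV dV Vd z1; have := normc_ge0 (cauchy_int phi z).
  move: (nc _) (nc _) => b a a0 bd ab.
  by rewrite -[d]mul1r -ab -mulrA ler_piMr// -ler_pdivlMr// mul1r.
- have := poisson_radial_limit (circle_L2_L1 (analytic_L2 aphi)).
  apply: filterS => x hx; apply/cvgrPdist_le => e /gt0_complexE[r r0 ->].
  have [k k0 hk] := hx r r0; near=> s.
  have s1 : s < 1 by near: s; exact: nbhs_left_lt.
  have s0 : 0 <= s by near: s; exact: nbhs_left_ge.
  have sk : 1 - k < s by near: s; apply: nbhs_left_gt; rewrite ltrBlDr ltrDl.
  rewrite normr_normc lecR distcC -/(polar s x) cauchy_int_poisson ?s0 ?s1//.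
  by apply: hk; rewrite sk s1.
Unshelve. all: by end_near. Qed.

(** Both F and 1/F are bounded, so phi and 1/phi are radial limits of bounded
    analytic functions and have no Fourier coefficients of negative index. *)
Lemma radial_limit_unit (F : C -> C) phi : Hinfty_disk F -> bounded_away_from_0 F ->
  phi \in circle_Lfun +oo%E -> radial_limit F phi -> analytic_unit phi.
Proof.
move=> HF [d /gt0_complexE[r r0 ->] Fd] /circle_LinftyP[mphi [M phiM]] lim.
have phi_ge : {ae mu, forall t, r <= nc (phi t)}.
  apply: filterS lim => t lim; apply/ler_addgt0Pl => e e0.
  have e0C : 0 < e%:C%C :> C by rewrite ltcR.
  move/cvgrPdist_le: lim => /(_ _ e0C) lim; near (1:R)^'- => s.
  have s1 : s < 1 by near: s; exact: nbhs_left_lt.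
  have s0 : 0 <= s by near: s; exact: nbhs_left_ge.
  have : `|phi t - F (polar s t)| <= e%:C%C by near: s.
  rewrite normr_normc lecR => h.
  have : r%:C%C <= `|F (polar s t)| by apply: Fd; rewrite normr_normc ltcR normc_polar.
  rewrite normr_normc lecR => /le_trans; apply.
  by rewrite -[F _](subKr (phi t)) (le_trans (ler_normcB _ _))// addrC lerD2r.
have analytic_limit G psi : Hinfty_disk G -> cmeasurable psi -> radial_limit G psi ->
    (exists B, {ae mu, forall t, nc (psi t) <= B}) -> analytic psi.
  move=> HG mpsi limG [B hB]; split; first exact: bounded_circle_L2 hB.
  by move=> m; exact: radial_limit_fourier limG.
split; first by apply: analytic_limit HF mphi lim _; exists M.
- by exists r, M; split=> //; apply: filterS2 phi_ge phiM => t -> ->.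
apply: (analytic_limit (fun z => (F z)^-1)).
- split=> [z z1|].
    apply: derivableV; last exact: HF.1.
    have := Fd z z1; rewrite normr_normc lecR => h.
    by rewrite -normc_eq0 gt_eqF// (lt_le_trans r0).
  exists (r^-1)%:C%C => z z1; have := Fd z z1.
  rewrite !normr_normc !lecR Normc.normcV => h.
  by rewrite lef_pV2 ?posrE// (lt_le_trans r0).
- exact: cmeasurableV.
- apply: filterS2 lim phi_ge => t lim ht; apply: cvgV => //.
  by rewrite -normc_eq0 gt_eqF// (lt_le_trans r0).
- by exists r^-1; apply: filterS phi_ge => t h; rewrite Normc.normcV lef_pV2 ?posrE// (lt_le_trans r0).
Unshelve. all: by end_near. Qed.
End BoundaryFunctions.

(** * Isometry of a Hilbert space with H^2 *)

Section HilbertModel.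
Variable R : realType.
Local Notation C := (R[i]).
Local Notation angle := (measurableTypeR R).
Local Notation mu := (circle_measure R).
Local Notation nc := (@Normc.normc R).
Arguments Normc.normc : simpl never.
Variables (H : completeNormedModType C) (ip : {dot H for conjC}).
Hypothesis ip_norm : forall x : H, `|x| ^+ 2 = ip x x.

Lemma coef_lin a (f g : angle -> C) k : f \in circle_Lfun 2%:E -> g \in circle_Lfun 2%:E ->
  coef (fun t => a * f t + g t) k = a * coef f k + coef g k.
Proof.
move=> /circle_L2_L1 f1 /circle_L2_L1 g1; rewrite /coef -circle_int_lin; try exact: circle_L1_mul_exp.
by congr circle_int; apply/funext => t; rewrite mulrDl mulrA.
Qed.

Section OrthonormalBasis.
Variable e : nat -> H.
Hypothesis e_basis : orthonormal_basis ip e.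

Let e_on m n : ip (e m) (e n) = (m == n)%:R.
Proof. by case: e_basis. Qed.

Lemma ip_partial_sum (a : nat -> C) n k : (k < n)%N -> ip (\sum_(i < n) a i *: e i) (e k) = a k.
Proof.
move=> kn; rewrite ip_suml (bigD1 (Ordinal kn))//= e_on eqxx mulr1 big1 ?addr0// => i ik.
rewrite e_on (_ : (_ == k)%N = false) ?mulr0//.
by apply/negbTE; apply: contra ik => /eqP ik; apply/eqP/val_inj.
Qed.

Lemma orthonormal_bessel y n : \sum_(i < n) nc (ip y (e i)) ^+ 2 <= rnorm y ^+ 2.
Proof.
set s := \sum_(i < n) _; rewrite -subr_ge0.
have -> : rnorm y ^+ 2 - s = rnorm (y - \sum_(i < n) ip y (e i) *: e i) ^+ 2.
  rewrite (rnorm_sqrB ip_norm) (orthonormal_rnorm ip_norm n (fun i => ip y (e i)) e_on) -/s.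
  rewrite (ip_sumr ip e n (fun i => ip y (e i))).
  have -> : \sum_(i < n) conjC (ip y (e i)) * ip y (e i) = s%:C%C.
    by rewrite rmorph_sum; apply: eq_bigr => i _; rewrite mulrC mul_conj_normc.
  by move=> /=; ring.
exact: sqr_ge0.
Qed.

(** The pairing of y with approximants from the span of the basis only involves
    the coefficients of y. *)
Lemma orthonormal_parseval y B : (forall n, \sum_(i < n) nc (ip y (e i)) ^+ 2 <= B) ->
  rnorm y ^+ 2 <= B.
Proof.
move=> hB; have [A A0 [_ onto]] := orthonormal_synthesis_onto ip_norm e_basis.
have ny := rnorm_ge0 y.
(* With a precision r the bound is off by at most r (4 |y| + 1). *)
apply/ler_addgt0Pl => d d0; pose r := Num.min 1 (d / (4 * rnorm y + 1)).
have k0 : 0 < 4 * rnorm y + 1 by rewrite ltr_wpDl// mulr_ge0.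
have r0 : 0 < r by rewrite lt_min ltr01 divr_gt0.
have r1 : r <= 1 by rewrite ge_min lexx.
have rd : r * (4 * rnorm y + 1) <= d by rewrite -ler_pdivlMr// ge_min lexx orbT.
have [n [c [hc _]]] := onto y r r0; set s := \sum_(i < n) _ in hc.
have s_norm : rnorm s <= rnorm y + r.
  by rewrite -[s](subKr y) (le_trans (rnormD _ _))// rnormN lerD2l.
have ys : rnorm s ^+ 2 = \sum_(i < n) nc (c i) ^+ 2 by exact: orthonormal_rnorm.
have h1 : 2 * nc (ip y s) <= \sum_(i < n) nc (c i) ^+ 2 + B.
  apply: le_trans (ip_sum_bound ip e n c y ltr01) _.
  by rewrite mul1r invr1 mul1r lerD2l; exact: hB.
have h2 : rnorm y ^+ 2 <= rnorm y * r + nc (ip y s).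
  rewrite -[rnorm y ^+ 2]ger0_norm ?sqr_ge0// -normc_real -(ip_rnorm ip_norm).
  rewrite -{2}(subrK s y) linearDr (le_trans (le_normcD _ _))// lerD2r.
  by rewrite (le_trans (ip_CauchySchwarz ip_norm _ _))// ler_wpM2l.
have h3 : rnorm s ^+ 2 <= (rnorm y + r) ^+ 2 by rewrite ler_sqr ?nnegrE ?rnorm_ge0// addr_ge0// ltW.
rewrite ys in h3.
have : r ^+ 2 <= r by rewrite expr2 ler_piMl// ltW.
nra.
Qed.

(** The partial sums form a Cauchy sequence, and H is complete. *)
Lemma orthonormal_series (a : nat -> C) B : (forall n, \sum_(i < n) nc (a i) ^+ 2 <= B) ->
  exists y, forall k, ip y (e k) = a k.
Proof.
move=> hB; pose S n := \sum_(i < n) nc (a i) ^+ 2; pose s n := \sum_(i < n) a i *: e i.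
have hs : has_sup (range S) by split; [exists (S 0%N), 0%N|exists B => _ [n _ <-]; exact: hB].
have sS N n : (N <= n)%N -> rnorm (s n - s N) ^+ 2 = S n - S N.
  move=> Nn; rewrite (rnorm_sqrB ip_norm) !(orthonormal_rnorm ip_norm _ a e_on) -!/(S _).
  rewrite (ip_sumr ip e N a) (_ : \sum_(i < N) _ = (S N)%:C%C).
    by rewrite /=; ring.
  rewrite rmorph_sum; apply: eq_bigr => i _.
  by rewrite ip_partial_sum ?(leq_trans _ Nn)// mulrC mul_conj_normc.
have : cvg (s n @[n --> \oo]).
  apply: cauchy_cvg; apply: cauchy_exP => d /gt0_complexE[r r0 ->].
  have r2 : 0 < r ^+ 2 by rewrite exprn_gt0.
  have [_ [N _ <-] hN] := sup_adherent r2 hs.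
  exists (s N); exists N => // n /= Nn; rewrite -ball_normE/= rnormE ltcR.
  rewrite -rnormN opprB -ltr_sqr ?nnegrE ?rnorm_ge0 ?(ltW r0)// sS//.
  have : S n <= sup (range S) by apply: ub_le_sup; [exact: hs.2|exists n].
  lra.
move=> /cvg_ex[y sy]; exists y => k; apply/eqP; rewrite -subr_eq0 -normc_eq0 eq_le normc_ge0 andbT.
apply/ler_addgt0Pl => d d0; rewrite addr0.
have d0C : 0 < d%:C%C :> C by rewrite ltcR.
move/cvgrPdist_le : sy => /(_ _ d0C)[N _ hN].
have := hN (maxn N k.+1) (leq_maxl _ _); rewrite rnormE lecR => h.
rewrite -(@ip_partial_sum a (maxn N k.+1)) ?leq_maxr// -linearBl.
rewrite (le_trans (ip_CauchySchwarz ip_norm _ _))//.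
have -> : rnorm (e k) = 1.
  apply/eqP; rewrite -(eqrXn2 (n := 2))// ?rnorm_ge0//; apply/eqP.
  by apply: (@complexI R); rewrite -(ip_rnorm ip_norm) e_on eqxx expr1n.
by rewrite mulr1.
Qed.

Lemma circle_exp_analytic (n : nat) : analytic (@circle_exp R n).
Proof.
have := circle_exp_mul_analytic n (@analytic1 R); congr analytic.
by apply/funext => t; rewrite mulr1.
Qed.

(** The map from H to H^2 comes first: it sends y to the function whose Fourier
    coefficients are those of y in the basis.  It is isometric by Parseval and
    onto by completeness of H, and W is its inverse. *)
Theorem hardy_model : exists (W : {linear H2 R -> H}) (W' : {linear H -> H2 R}),
  GL W W' /\ forall n : nat, W (H2_of (circle_exp n)) = e n.
Proof.
have [w hw] : exists w : H -> angle -> C, forall y, [/\ analytic (w y),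
    forall k, coef (w y) k = ip y (e k) & sqint (w y) <= rnorm y ^+ 2].
  suff /boolp.choice[w hw] : forall y, exists f, [/\ analytic f,
      forall k, coef f k = ip y (e k) & sqint f <= rnorm y ^+ 2] by exists w.
  by move=> y; apply: riesz_fischer => n; exact: orthonormal_bessel.
have aw y : analytic (w y) by case: (hw y).
have cw y k : coef (w y) k = ip y (e k) by case: (hw y).
pose w' y := H2_of (w y).
have w'_norm y : rnorm (w' y) = rnorm y.
  apply/eqP; rewrite -(eqrXn2 (n := 2)) ?rnorm_ge0//; apply/eqP.
  rewrite rnorm_H2_of//; apply/eqP; rewrite eq_le; apply/andP; split; first by case: (hw y).
  apply: orthonormal_parseval => n; apply: le_trans (bessel n (analytic_L2 (aw y))).
  by apply: ler_sum => i _; rewrite cw.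
have w'_uniq y f : analytic f -> (forall k, ip y (e k) = coef f k) -> w' y = H2_of f.
  move=> af hf; apply: (proj2 (H2_of_ae (aw y) af)); apply: analytic_unique => // k.
  by rewrite cw hf.
have w'_lin : linear w'.
  move=> a x y; rewrite -(H2_of_lin a (aw x) (aw y)); apply: w'_uniq; first exact: analytic_lin.
  by move=> k; rewrite coef_lin ?analytic_L2// !cw linearPl.
have /boolp.choice[W0 W0K] : forall x : H2 R, exists y, w' y = x.
  move=> x; have ax := H2_fun_analytic x.
  have [y hy] := orthonormal_series (fun n => bessel n (analytic_L2 ax)).
  by exists y; rewrite (w'_uniq _ _ ax)// H2_of_fun.
have [W' W'E] : exists W' : {linear H -> H2 R}, forall y, W' y = w' y.
  pose W' : {linear H -> H2 R} := HB.pack w' (GRing.isLinear.Build _ _ _ _ w' w'_lin).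
  by exists W'.
have W'_inj : injective W'.
  move=> x y xy; apply/eqP; rewrite -subr_eq0 -rnorm_eq0 -w'_norm -W'E linearB xy.
  by rewrite subrr rnorm0.
have W0_lin : linear W0.
  by move=> a x y; apply: W'_inj; rewrite linearP !W'E !W0K.
have [W WE] : exists W : {linear H2 R -> H}, forall x, W x = W0 x.
  pose W : {linear H2 R -> H} := HB.pack W0 (GRing.isLinear.Build _ _ _ _ W0 W0_lin).
  by exists W.
have W'K x : W' (W x) = x by rewrite WE W'E W0K.
exists W, W'; split.
  split=> //.
  - by apply/bounded_operatorP; exists 1 => // x; rewrite mul1r -w'_norm -W'E W'K.
  - by apply/bounded_operatorP; exists 1 => // x; rewrite mul1r W'E w'_norm.
  - by move=> y; apply: W'_inj; rewrite W'K.
move=> n; apply: W'_inj; rewrite W'K W'E; apply/esym/w'_uniq; first exact: circle_exp_analytic.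
move=> k; rewrite e_on /coef; under eq_fun do rewrite -circle_expD.
by rewrite circle_int_exp subr_eq0 eqz_nat.
Qed.
End OrthonormalBasis.
End HilbertModel.

(** * Operators similar to the shift *)

Section ShiftModel.
Variable R : realType.
Local Notation C := (R[i]).
Local Notation angle := (measurableTypeR R).
Local Notation mu := (circle_measure R).
Local Notation nc := (@Normc.normc R).
Arguments Normc.normc : simpl never.

Lemma GL_sym (K H : normedModType C) (L : {linear K -> H}) (L' : {linear H -> K}) :
  GL L L' -> GL L' L.
Proof. by case. Qed.

Lemma GL_comp (K H G : normedModType C) (L : {linear K -> H}) (L' : {linear H -> K})
    (U : {linear H -> G}) (U' : {linear G -> H}) : GL L L' -> GL U U' ->
  exists (V : {linear K -> G}) (V' : {linear G -> K}), GL V V' /\ forall x, V x = U (L x).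
Proof.
move=> [bL bL' LK L'K] [bU bU' UK U'K].
have comp (A B D : normedModType C) (S : {linear A -> B}) (S' : {linear B -> D}) :
    bounded_operator S -> bounded_operator S' ->
    exists V : {linear A -> D}, bounded_operator V /\ forall x, V x = S' (S x).
  move=> /bounded_operatorP[M M0 SM] /bounded_operatorP[M' M'0 SM'].
  exists (S' \o S); split=> //; apply/bounded_operatorP; exists (M' * M); first exact: mulr_gt0.
  by move=> x; rewrite -mulrA (le_trans (SM' _))// ler_pM2l.
have [V [bV VE]] := comp _ _ _ _ _ bL bU; have [V' [bV' V'E]] := comp _ _ _ _ _ bU' bL'.
by exists V, V'; split=> //; split=> // x; rewrite V'E VE ?UK ?LK ?L'K ?U'K.
Qed.

Section Operator.
Variables (H : completeNormedModType C) (ip : {dot H for conjC}).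
Hypothesis ip_norm : forall x : H, `|x| ^+ 2 = ip x x.
Variables (T : {linear H -> H}) (f0 : H).

(** Both sides agree on polynomials and are continuous, and polynomials are dense. *)
Lemma shift_intertwining (L : {linear H2 R -> H}) : bounded_operator T -> bounded_operator L ->
  (forall n : nat, L (H2_of (circle_exp n)) = iter n T f0) -> forall x, T (L x) = L (shift x).
Proof.
move=> /bounded_operatorP[N N0 TN] /bounded_operatorP[M M0 LM] LE x.
have L_cpoly n c (k : nat) : L (H2_of (fun t => cpoly n c t * circle_exp k t)) =
    \sum_(i < n) c i *: iter (i + k) T f0.
  rewrite -sum_iter_shift; last exact: circle_exp_analytic.
  rewrite linear_sum; apply: eq_bigr => i _; rewrite linearZ iter_shift_H2_of; last exact: circle_exp_analytic.
  rewrite -LE; congr (_ *: L (H2_of _)).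
  by apply/funext => t; rewrite PoszD circle_expD.
have TL_cpoly n c : T (L (H2_of (cpoly n c))) = L (H2_of (fun t => circle_exp 1 t * cpoly n c t)).
  have -> : cpoly n c = fun t => cpoly n c t * circle_exp 0%N t.
    by apply/funext => t; rewrite circle_exp0 mulr1.
  have -> : (fun t => circle_exp 1 t * (cpoly n c t * circle_exp 0%N t)) =
      (fun t => cpoly n c t * circle_exp 1%N t).
    by apply/funext => t; rewrite circle_exp0 mulr1 mulrC.
  apply: (etrans (congr1 T (L_cpoly n c 0%N))); apply: etrans (esym (L_cpoly n c 1%N)).
  by rewrite linear_sum; apply: eq_bigr => i _; rewrite linearZ addn0 addn1.
rewrite -(H2_of_fun x); have := H2_fun_analytic x; move: (H2_fun x) => f {x} af.
rewrite shift_H2_of//; apply/eqP; rewrite -subr_eq0 -rnorm_eq0 eq_le rnorm_ge0 andbT.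
apply/ler_addgt0Pl => d d0; rewrite addr0.
have k0 : 0 < N * M + M by rewrite addr_gt0// mulr_gt0.
have [n hn] := analytic_approx af (exprn_gt0 2 (divr_gt0 d0 k0)).
set p := cpoly n (coef f) in hn.
have ap : analytic p := cpoly_analytic n (coef f).
have ef := circle_exp_mul_analytic 1 af; have ep := circle_exp_mul_analytic 1 ap.
have small g h : analytic g -> analytic h -> sqint (fun t => g t - h t) <= (d / (N * M + M)) ^+ 2 ->
    rnorm (H2_of g - H2_of h) <= d / (N * M + M).
  move=> ag ah gh; rewrite -(H2_ofB ag ah) -ler_sqr ?nnegrE ?rnorm_ge0 ?divr_ge0 ?(ltW d0) ?(ltW k0)//.
  by rewrite rnorm_H2_of//; exact: analyticB.
have h1 := small _ _ af ap hn.
have h2 : rnorm (H2_of (fun t => circle_exp 1 t * f t) - H2_of (fun t => circle_exp 1 t * p t)) <= d / (N * M + M).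
  apply: small => //; rewrite (_ : (fun t => _) = fun t => circle_exp 1 t * (f t - p t)).
    by rewrite sqint_exp_mul.
  by apply/funext => t; rewrite mulrBr.
have error_le (a b a' b' : H2 R) s : T (L b) = L b' -> rnorm (a - b) <= s ->
    rnorm (a' - b') <= s -> rnorm (T (L a) - L a') <= N * (M * s) + M * s.
  move=> ab abs abs'; have -> : T (L a) - L a' = T (L (a - b)) - L (a' - b').
    have -> : L (a - b) = L a - L b by exact: raddfB.
    have -> : L (a' - b') = L a' - L b' by exact: raddfB.
    have -> : T (L a - L b) = T (L a) - T (L b) by exact: raddfB.
    by rewrite ab opprB addrA subrK.
  move: (a - b) (a' - b') abs abs' => x y xs ys.
  rewrite (le_trans (rnormD _ _))// rnormN lerD//; last by rewrite (le_trans (LM _))// ler_pM2l.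
  by rewrite (le_trans (TN _))// ler_pM2l// (le_trans (LM _))// ler_pM2l.
apply: le_trans (error_le _ _ _ _ _ (TL_cpoly n (coef f)) h1 h2) _.
rewrite le_eqVlt (_ : _ + _ = d) ?eqxx//.
by field; rewrite gt_eqF.
Qed.

Theorem riesz_shift_model : bounded_operator T -> riesz_basis ip (fun n => iter n T f0) ->
  exists (L : {linear H2 R -> H}) (L' : {linear H -> H2 R}),
    GL L L' /\ forall x, T x = L (shift (L' x)).
Proof.
move=> bT [e [U [U' [e_basis GLU fE]]]].
have [W [W' [GLW We]]] := hardy_model ip_norm e_basis.
have [L [L' [GLL LE]]] := GL_comp GLW GLU.
have [bL _ _ L'K] := GLL; exists L, L'; split=> // x; rewrite -{1}(L'K x).
by apply: shift_intertwining => // n; rewrite LE We fE.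
Qed.

Section Frames.
Variables (L : {linear H2 R -> H}) (L' : {linear H -> H2 R}).
Hypotheses (GLL : GL L L') (TE : forall x, T x = L (shift (L' x))).

Lemma iter_shiftE n x : iter n T (L x) = L (iter n (@shift R) x).
Proof. by have [_ _ LK _] := GLL; elim: n => //= n ->; rewrite TE LK. Qed.

(** The frames in the orbits of T correspond through L to those of the shift. *)
Lemma frame_analytic_unit u : analytic u ->
  frame ip (fun n => iter n T (L (H2_of u))) <-> analytic_unit u.
Proof.
move=> au; have [_ _ LK _] := GLL; rewrite -synthesis_onto_unit//.
have -> : (fun n => iter n T (L (H2_of u))) = (fun n => L (iter n (@shift R) (H2_of u))).
  by apply/funext => n; rewrite iter_shiftE.
split=> [/(frame_synthesis_onto ip_norm)/(synthesis_onto_GL (GL_sym GLL))|h].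
  by congr synthesis_onto; apply/funext => n; rewrite LK.
have /(synthesis_onto_frame ip_norm) := synthesis_onto_GL GLL h; exact.
Qed.
End Frames.
End Operator.

Lemma analytic_unit_mul (u v : angle -> C) : analytic_unit u -> analytic_unit v ->
  analytic_unit (fun t => u t * v t).
Proof.
move=> [au [d [M [d0 udM]]] aV] [av [d' [M' [d'0 vdM]]] aV'].
have uM : {ae mu, forall t, nc (u t) <= M} by apply: filterS udM => t /andP[].
split; first exact: bounded_mul_analytic uM av.
- exists (d * d'), (M * M'); split; first exact: mulr_gt0.
  apply: filterS2 udM vdM => t /andP[h1 h2] /andP[h3 h4].
  by rewrite Normc.normcM !ler_pM ?normc_ge0 ?(ltW d0) ?(ltW d'0).
- rewrite (_ : (fun t => _) = fun t => (u t)^-1 * (v t)^-1).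
    apply: (@bounded_mul_analytic _ _ _ d^-1) => //.
    apply: filterS udM => t /andP[h _]; rewrite Normc.normcV lef_pV2 ?posrE//.
    exact: lt_le_trans h.
  by apply/funext => t; rewrite invfM.
Qed.

Lemma analytic_unit_inv (u : angle -> C) : analytic_unit u -> analytic_unit (fun t => (u t)^-1).
Proof.
move=> [au [d [M [d0 udM]]] aV]; split=> //; last first.
  by rewrite (_ : (fun t => _) = u)//; apply/funext => t; rewrite invrK.
exists (Num.max M d)^-1, d^-1; split; first by rewrite invr_gt0 lt_max d0 orbT.
apply: filterS udM => t /andP[h1 h2]; have u0 := lt_le_trans d0 h1.
by rewrite Normc.normcV !lef_pV2 ?posrE ?lt_max ?d0 ?orbT// le_max h2 h1.
Qed.
End ShiftModel.

Theorem proposition24 (R : realType) (H : completeNormedModType R[i])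
  (ip : {dot H for conjC}) (ip_norm : forall x : H, `|x| ^+ 2 = ip x x)
  (H_separable : separable H) (H_infinite : ~ finite_dimensional H)
  (T : {linear H -> H}) (T_bounded : bounded_operator T) (f0 : H)
  (T_riesz : riesz_basis ip (fun n => iter n T f0)) :
  (exists (L : {linear H2 R -> H}) (L' : {linear H -> H2 R}),
     GL L L' /\ forall x, T x = L (shift (L' x))) /\
  (forall (L : {linear H2 R -> H}) (L' : {linear H -> H2 R}),
     GL L L' -> (forall x, T x = L (shift (L' x))) ->
     frame_vectors ip T =
     [set V f0 | V in [set V : H -> H |
        exists (phi : R -> R[i]) (F : R[i] -> R[i]),
          [/\ Hinfty_disk F, bounded_away_from_0 F,
              phi \in circle_Lfun +oo%E, radial_limit F phi &
              forall x, V x = L (toeplitz phi (L' x))]]]).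
Proof.
split; first exact: riesz_shift_model T_riesz.
move=> L L' GLL TE; have [_ _ LK L'K] := GLL.
set g := H2_fun (L' f0); have ag : analytic g := H2_fun_analytic _.
have f0E : f0 = L (H2_of g) by rewrite /g H2_of_fun L'K.
have frameE := frame_analytic_unit ip_norm GLL TE.
have ug : analytic_unit g.
  by apply/frameE => //; rewrite -f0E; apply: synthesis_onto_frame (riesz_synthesis_onto ip_norm T_riesz).
have VE phi : analytic_unit phi -> L (toeplitz phi (L' f0)) = L (H2_of (fun t => phi t * g t)).
  move=> uphi; have [afg _ _] := analytic_unit_mul uphi ug.
  have := toeplitz_H2_of (analytic_unit_Linfty uphi) ag afg.
  by rewrite [X in toeplitz _ X]H2_of_fun => ->.
apply/seteqP; split=> [h|_ [V [phi [F [HF F0 phioo lim V_E]]] <-]] /=.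
  set u := H2_fun (L' h); have au : analytic u := H2_fun_analytic _.
  have hE : h = L (H2_of u) by rewrite /u H2_of_fun L'K.
  rewrite hE => /frameE -/(_ au) uu.
  have uphi := analytic_unit_mul uu (analytic_unit_inv ug).
  have [F [HF F0 lim]] := analytic_unit_boundary uphi.
  exists (fun x => L (toeplitz (fun t => u t * (g t)^-1) (L' x))).
    by exists (fun t => u t * (g t)^-1), F; split=> //; exact: analytic_unit_Linfty.
  apply: (etrans (VE _ uphi)); apply: (congr1 L); have [apg _ _] := analytic_unit_mul uphi ug.
  apply: (proj2 (H2_of_ae apg au)); have [_ [d [M [d0 gd]]] _] := ug; apply: filterS gd => t /andP[gt _].
  by rewrite divfK// -normc_eq0 gt_eqF// (lt_le_trans d0).
have uphi := radial_limit_unit HF F0 phioo lim.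
rewrite /frame_vectors /= V_E VE//.
have upg := analytic_unit_mul uphi ug; have [apg _ _] := upg.
exact: (proj2 (frameE _ apg) upg).
Qed.
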